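(* Let $\sigma>1/2$. There exist a positive constant $c_\sigma$ depending only on $\sigma$ and a positive absolute constant $C$ such that, with $c=\frac{\zeta(2\sigma)}{2\sqrt{1+C}}$, the following holds. For any integer $\nu\ge2$ with $\max_{k,\ell:\,[k,\ell]\mid\nu}\frac{\max(k,\ell)}{(k,\ell)}\ge c_\sigma$ and any $0\le\varepsilon<\sigma$, $$\max_{1\le t\le T}|\zeta(\sigma+it)|\ge c\Big(\frac1{\sigma_{-2\varepsilon}(\nu)}\sum_{n|\nu}\frac{\sigma_{-\sigma+\varepsilon}(n)^2}{n^{2\varepsilon}}\Big)^{1/2}$$ whenever $\nu$ and the real number $T$ satisfy $$\frac{\sigma_{-\varepsilon}(\nu)\,\sigma_{1-\sigma-\varepsilon}(\nu)\log(\nu T)}{\sum_{n|\nu}\frac{\sigma_{-\sigma+\varepsilon}(n)^2}{n^{2\varepsilon}}}\le\frac{\zeta(2\sigma)^{1/2}}4T^{2\sigma-1}.$$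
   Context: $\zeta$ is the Riemann zeta function. For real $u$, $\sigma_u(n)=\sum_{d|n}d^u$ (a divisor function, distinguished from the real number $\sigma$ by its subscript). $(k,\ell)$ is the gcd and $[k,\ell]$ the lcm. *)

(* Defs.v *)
From Stdlib Require Import Reals Lra Lia List.
From Coquelicot Require Import Coquelicot.
Open Scope R_scope.

Definition Cexp (z : C) : C :=
  (exp (Re z) * cos (Im z), exp (Re z) * sin (Im z)).

(* [x ^ s] for a positive real base *)
Definition cpow (x : R) (s : C) : C := Cexp (s * RtoC (ln x))%C.

Definition CSeries (a : nat -> C) : C :=
  (Series (fun n => Re (a n)), Series (fun n => Im (a n))).

(* [n^(-s) - \int_n^(n+1) x^(-s) dx], with the integral evaluated *)
Definition zeta_term (s : C) (n : R) : C :=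
  (cpow n (- s) - (cpow (n + 1) (1 - s) - cpow n (1 - s)) / (1 - s))%C.

(* The Riemann zeta function in the half-plane [0 < Re s], [s <> 1]: since
   [1/(s-1) = \int_1^oo x^(-s) dx] for [1 < Re s], the Dirichlet series equals
   [1/(s-1) + \sum_(n >= 1) (n^(-s) - \int_n^(n+1) x^(-s) dx)], and the latter
   series converges locally uniformly for [0 < Re s].  That this is indeed the
   analytic continuation of the Dirichlet series is proved in [zeta_dirichlet]
   and [zeta_holomorphic]; the values for [Re s <= 0] and at [s = 1] are
   meaningless. *)
Definition zeta (s : C) : C :=
  (/ (s - 1) + CSeries (fun n => zeta_term s (INR (S n))))%C.

Definition divisors (n : nat) : list nat :=
  filter (fun d => Nat.eqb (Nat.modulo n d) 0) (seq 1 n).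

Definition sum_over (l : list nat) (f : nat -> R) : R :=
  fold_right Rplus 0 (map f l).

Definition divisor_sigma (u : R) (n : nat) : R :=
  sum_over (divisors n) (fun d => Rpower (INR d) u).

Definition is_maximum (E : R -> Prop) (m : R) : Prop :=
  E m /\ is_upper_bound E m.

(* [\sum_(n | nu) sigma_(-s+e)(n)^2 / n^(2e)] *)
Definition resonance_sum (s e : R) (nu : nat) : R :=
  sum_over (divisors nu)
    (fun n => (divisor_sigma (- s + e) n) ^ 2 / Rpower (INR n) (2 * e)).

(** [zeta] is the analytic continuation of the Dirichlet series. *)

Lemma Cexp_plus (a b : C) : Cexp (a + b) = (Cexp a * Cexp b)%C.
Proof.
  destruct a as [a1 a2], b as [b1 b2]; unfold Cexp, Cmult; simpl.
  rewrite exp_plus, cos_plus, sin_plus; f_equal; ring.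
Qed.

Lemma Cmod_Cexp (z : C) : Cmod (Cexp z) = exp (Re z).
Proof.
  assert (Hp := exp_pos (Re z)); assert (Hs := sin2_cos2 (Im z)).
  unfold Rsqr in Hs; unfold Cmod, Cexp; simpl.
  replace (_ + _) with (exp (Re z) * exp (Re z)).
  - apply sqrt_square; lra.
  - transitivity (exp (Re z) * exp (Re z) * (sin (Im z) * sin (Im z) + cos (Im z) * cos (Im z)));
      [rewrite Hs|]; ring.
Qed.

Lemma Cexp_0 : Cexp 0 = 1.
Proof.
  unfold Cexp, RtoC, Re, Im; simpl; rewrite exp_0, cos_0, sin_0.
  now rewrite Rmult_1_l, Rmult_0_r.
Qed.

Lemma Cmod_cpow (x : R) (s : C) : Cmod (cpow x s) = Rpower x (Re s).
Proof. unfold cpow; rewrite Cmod_Cexp, re_scal_r; reflexivity. Qed.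

Lemma cpow_plus (x : R) (a b : C) : cpow x (a + b) = (cpow x a * cpow x b)%C.
Proof. unfold cpow; rewrite <- Cexp_plus; f_equal; ring. Qed.

Lemma cpow_RtoC (x : R) (a : R) : cpow x (RtoC a) = RtoC (Rpower x a).
Proof.
  unfold cpow, Cexp, Rpower, RtoC; simpl.
  replace (a * 0 + 0 * ln x) with 0 by ring.
  rewrite cos_0, sin_0; f_equal; [rewrite Rmult_1_r; f_equal|]; ring.
Qed.

Lemma cpow_1_l (s : C) : cpow 1 s = 1.
Proof. unfold cpow; rewrite ln_1, Cmult_0_r; apply Cexp_0. Qed.

Definition Cderiv (f : R -> C) (x : R) (l : C) : Prop :=
  is_derive (fun x => Re (f x)) x (Re l) /\
  is_derive (fun x => Im (f x)) x (Im l).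

Lemma Cderiv_ext f x l l' : l = l' -> Cderiv f x l -> Cderiv f x l'.
Proof. now intros ->. Qed.

Lemma Cderiv_const c x : Cderiv (fun _ => c) x 0.
Proof. split; simpl; apply @is_derive_const. Qed.

Lemma Cderiv_RtoC f x l : is_derive f x l -> Cderiv (fun y => RtoC (f y)) x (RtoC l).
Proof. intros H; split; simpl; [exact H|apply @is_derive_const]. Qed.

Lemma Cderiv_plus f g x l m :
  Cderiv f x l -> Cderiv g x m -> Cderiv (fun y => f y + g y)%C x (l + m)%C.
Proof.
  intros [H1 H2] [H3 H4]; split; simpl.
  - apply @is_derive_plus; assumption.
  - apply @is_derive_plus; assumption.
Qed.

Lemma Cderiv_mult f g x l m :
  Cderiv f x l -> Cderiv g x m ->
  Cderiv (fun y => f y * g y)%C x (l * g x + f x * m)%C.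
Proof.
  intros [H1 H2] [H3 H4].
  assert (M : forall u v (a b : R), is_derive u x a -> is_derive v x b ->
      is_derive (fun y => u y * v y) x (a * v x + u x * b)).
  { intros u v a b Hu Hv.
    apply (is_derive_mult u v x a b Hu Hv); intros; apply Rmult_comm. }
  split.
  - apply is_derive_ext with
      (fun y => minus (Re (f y) * Re (g y)) (Im (f y) * Im (g y))).
    { intros; reflexivity. }
    replace (Re (l * g x + f x * m)%C) with
      (minus (Re l * Re (g x) + Re (f x) * Re m) (Im l * Im (g x) + Im (f x) * Im m)).
    2:{ unfold minus, plus, opp, Re, Im; simpl; ring. }
    apply @is_derive_minus; apply M; assumption.
  - apply is_derive_ext with
      (fun y => plus (Re (f y) * Im (g y)) (Im (f y) * Re (g y))).
    { intros; reflexivity. }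
    replace (Im (l * g x + f x * m)%C) with
      (plus (Re l * Im (g x) + Re (f x) * Im m) (Im l * Re (g x) + Im (f x) * Re m)).
    2:{ unfold plus, Re, Im; simpl; ring. }
    apply @is_derive_plus; apply M; assumption.
Qed.

Lemma Cderiv_scal c f x l : Cderiv f x l -> Cderiv (fun y => c * f y)%C x (c * l)%C.
Proof.
  intros H; eapply Cderiv_ext; [|exact (Cderiv_mult _ _ x _ _ (Cderiv_const c x) H)].
  cbv beta; ring.
Qed.

Lemma Cderiv_opp f x l : Cderiv f x l -> Cderiv (fun y => - f y)%C x (- l)%C.
Proof.
  intros [H1 H2]; split; simpl; apply @is_derive_opp; assumption.
Qed.

Lemma Cderiv_minus f g x l m :
  Cderiv f x l -> Cderiv g x m -> Cderiv (fun y => f y - g y)%C x (l - m)%C.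
Proof. intros; apply Cderiv_plus; [|apply Cderiv_opp]; assumption. Qed.

Lemma Cderiv_Cexp f x l :
  Cderiv f x l -> Cderiv (fun y => Cexp (f y)) x (l * Cexp (f x))%C.
Proof.
  intros [H1 H2].
  set (u := fun y => Re (f y)) in *; set (v := fun y => Im (f y)) in *.
  assert (D1 := is_derive_unique _ _ _ H1); assert (D2 := is_derive_unique _ _ _ H2).
  split; unfold Cexp; simpl; fold (u x) (v x).
  - apply is_derive_ext with (fun y => exp (u y) * cos (v y)); [reflexivity|].
    auto_derive; [repeat split; eexists; eassumption|].
    unfold u, v in *; simpl in *; rewrite D1, D2; unfold Re, Im; ring.
  - apply is_derive_ext with (fun y => exp (u y) * sin (v y)); [reflexivity|].
    auto_derive; [repeat split; eexists; eassumption|].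
    unfold u, v in *; simpl in *; rewrite D1, D2; unfold Re, Im; ring.
Qed.

Lemma Cderiv_cpow s x : 0 < x -> Cderiv (fun y => cpow y s) x (s * cpow x (s - 1))%C.
Proof.
  intros Hx; eapply Cderiv_ext.
  2:{ apply Cderiv_Cexp with (f := fun y => (s * RtoC (ln y))%C).
      apply Cderiv_scal, Cderiv_RtoC; auto_derive; [exact Hx|reflexivity]. }
  change (Cexp (s * RtoC (ln x))) with (cpow x s).
  unfold Cminus; rewrite cpow_plus, <- RtoC_opp, cpow_RtoC, Rpower_Ropp, Rpower_1 by assumption.
  rewrite Rmult_1_l; ring.
Qed.

Lemma Cmod_le_parts (z : C) : Cmod z <= Rabs (Re z) + Rabs (Im z).
Proof.
  assert (A := Rabs_pos (Re z)); assert (B := Rabs_pos (Im z)).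
  unfold Cmod; rewrite <- (sqrt_square (Rabs (Re z) + Rabs (Im z))) by lra.
  apply sqrt_le_1_alt.
  replace (fst z ^ 2) with (Rabs (Re z) ^ 2) by (unfold Re; now rewrite pow2_abs).
  replace (snd z ^ 2) with (Rabs (Im z) ^ 2) by (unfold Im; now rewrite pow2_abs).
  nra.
Qed.

Lemma im_le_Cmod (z : C) : Rabs (Im z) <= Cmod z.
Proof. eapply Rle_trans; [apply Rmax_r|apply Rmax_Cmod]. Qed.

Lemma mean_value (f f' : R -> C) (a b M : R) :
  a <= b -> (forall x, a <= x <= b -> Cderiv f x (f' x)) ->
  (forall x, a <= x <= b -> Cmod (f' x) <= M) ->
  Cmod (f b - f a)%C <= 2 * M * (b - a).
Proof.
  intros Hab Hd HM.
  assert (E : forall (u u' : R -> R), (forall x, a <= x <= b -> is_derive u x (u' x)) ->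
     (forall x, a <= x <= b -> Rabs (u' x) <= M) -> Rabs (u b - u a) <= M * (b - a)).
  { intros u u' Hu HuM.
    destruct (MVT_gen u a b u') as [c [Hc ->]].
    - rewrite Rmin_left, Rmax_right by lra; intros; apply Hu; lra.
    - rewrite Rmin_left, Rmax_right by lra; intros x Hx.
      apply continuity_pt_filterlim, @ex_derive_continuous; eexists; apply Hu; lra.
    - rewrite Rmin_left, Rmax_right in Hc by lra.
      rewrite Rabs_mult, (Rabs_right (b - a)) by lra.
      apply Rmult_le_compat_r; [lra|apply HuM; lra]. }
  eapply Rle_trans; [apply Cmod_le_parts|].
  assert (E1 := E (fun x => Re (f x)) (fun x => Re (f' x))).
  assert (E2 := E (fun x => Im (f x)) (fun x => Im (f' x))).
  cbv beta in E1, E2.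
  change (Re (f b - f a)%C) with (Re (f b) - Re (f a)).
  change (Im (f b - f a)%C) with (Im (f b) - Im (f a)).
  assert (Rabs (Re (f b) - Re (f a)) <= M * (b - a)).
  { apply E1; [apply Hd|]; intros x Hx.
    eapply Rle_trans; [apply re_le_Cmod|auto]. }
  assert (Rabs (Im (f b) - Im (f a)) <= M * (b - a)).
  { apply E2; [apply Hd|]; intros x Hx.
    eapply Rle_trans; [apply im_le_Cmod|auto]. }
  lra.
Qed.

Lemma mean_value_err (P p q : R -> C) (a M : R) :
  0 <= M ->
  (forall x, a <= x <= a + 1 -> Cderiv P x (p x)) ->
  (forall x, a <= x <= a + 1 -> Cderiv p x (q x)) ->
  (forall x, a <= x <= a + 1 -> Cmod (q x) <= M) ->
  Cmod (p a - (P (a + 1)%R - P a))%C <= 4 * M.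
Proof.
  intros H0 HP Hp Hq.
  assert (K := mean_value (fun x => RtoC (x - a) * p a - P x)%C
                 (fun x => p a - p x)%C a (a + 1) (2 * M)).
  cbv beta in K.
  replace (RtoC (a + 1 - a)) with (RtoC 1) in K by (f_equal; ring).
  replace (RtoC (a - a)) with (RtoC 0) in K by (f_equal; ring).
  replace (p a - (P (a + 1)%R - P a))%C
    with (1 * p a - P (a + 1)%R - (0 * p a - P a))%C by ring.
  eapply Rle_trans; [apply K|]; [lra| | |lra].
  - intros x Hx; apply Cderiv_minus; [|auto].
    eapply Cderiv_ext.
    2:{ apply Cderiv_mult; [|apply Cderiv_const].
        apply Cderiv_RtoC with (l := 1); auto_derive; trivial; ring. }
    cbv beta; ring.
  - intros x Hx.
    replace (p a - p x)%C with (- (p x - p a))%C by ring; rewrite Cmod_opp.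
    eapply Rle_trans; [apply mean_value with (M := M) (f' := q)|]; [lra| | |nra].
    + intros; apply Hp; lra.
    + intros; apply Hq; lra.
Qed.

Lemma exp_le_compat (x y : R) : x <= y -> exp x <= exp y.
Proof. intros [H| ->]; [left; apply exp_increasing, H|right; reflexivity]. Qed.

Lemma Cderiv_line (w : C) (t : R) :
  Cderiv (fun t => Cexp (w * RtoC t)) t (w * Cexp (w * RtoC t))%C.
Proof.
  eapply Cderiv_ext.
  2:{ apply Cderiv_Cexp with (f := fun t => (w * RtoC t)%C).
      apply Cderiv_scal, (Cderiv_RtoC (fun t => t) t 1), @is_derive_id. }
  cbv beta; ring.
Qed.

Lemma Cmod_scal_unit (w : C) (t : R) : 0 <= t <= 1 -> Cmod (w * RtoC t) <= Cmod w.
Proof.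
  intros Ht; rewrite Cmod_mult, Cmod_R, Rabs_right by lra.
  assert (H := Cmod_ge_0 w); nra.
Qed.

Lemma Cexp_le (w : C) : Cmod (Cexp w) <= exp (Cmod w).
Proof.
  rewrite Cmod_Cexp; apply exp_le_compat.
  eapply Rle_trans; [apply Rle_abs|apply re_le_Cmod].
Qed.

Lemma Cexp_bound1 (w : C) : Cmod (Cexp w - 1)%C <= 2 * (Cmod w * exp (Cmod w)).
Proof.
  assert (K := mean_value (fun t => Cexp (w * RtoC t)) (fun t => w * Cexp (w * RtoC t))%C
                 0 1 (Cmod w * exp (Cmod w))).
  cbv beta in K; rewrite Cmult_1_r, Cmult_0_r, Cexp_0 in K.
  eapply Rle_trans; [apply K; [lra| |]|lra].
  - intros; apply Cderiv_line.
  - intros t Ht; rewrite Cmod_mult; apply Rmult_le_compat_l; [apply Cmod_ge_0|].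
    eapply Rle_trans; [apply Cexp_le|apply exp_le_compat, Cmod_scal_unit, Ht].
Qed.

Lemma Cexp_bound2 (w : C) : Cmod (Cexp w - 1 - w)%C <= 4 * (Cmod w ^ 2 * exp (Cmod w)).
Proof.
  assert (K := mean_value (fun t => Cexp (w * RtoC t) - w * RtoC t)%C
                 (fun t => w * (Cexp (w * RtoC t) - 1))%C
                 0 1 (2 * (Cmod w ^ 2 * exp (Cmod w)))).
  cbv beta in K; rewrite Cmult_1_r, Cmult_0_r, Cexp_0 in K.
  replace (Cexp w - 1 - w)%C with (Cexp w - w - (1 - 0))%C by ring.
  eapply Rle_trans; [apply K; [lra| |]|lra].
  - intros t Ht; eapply Cderiv_ext.
    2:{ apply Cderiv_minus; [apply Cderiv_line|].
        apply Cderiv_scal, (Cderiv_RtoC (fun t => t) t 1), @is_derive_id. }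
    cbv beta; ring.
  - intros t Ht; rewrite Cmod_mult.
    assert (A := Cmod_scal_unit w t Ht).
    assert (B := exp_le_compat _ _ A).
    assert (D := Cexp_bound1 (w * RtoC t)).
    assert (W := Cmod_ge_0 w); assert (W' := Cmod_ge_0 (w * RtoC t)).
    assert (E := exp_pos (Cmod (w * RtoC t))).
    assert (F : Cmod (w * RtoC t) * exp (Cmod (w * RtoC t)) <= Cmod w * exp (Cmod w)).
    { apply Rmult_le_compat; lra. }
    simpl; rewrite Rmult_1_r.
    assert (G : Cmod w * Cmod (Cexp (w * RtoC t) - 1) <= Cmod w * (2 * (Cmod w * exp (Cmod w)))).
    { apply Rmult_le_compat_l; lra. }
    lra.
Qed.

Definition primitive (s : C) (x : R) : C := (cpow x (1 - s) / (1 - s))%C.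

Lemma Cminus_neq (a b : C) : a <> b -> (a - b)%C <> 0.
Proof. intros H K; apply H; apply Ceq_minus; exact K. Qed.

Lemma Cderiv_primitive s x :
  s <> RtoC 1 -> 0 < x -> Cderiv (primitive s) x (cpow x (- s)).
Proof.
  intros Hs Hx; eapply Cderiv_ext.
  2:{ apply Cderiv_mult; [apply Cderiv_cpow, Hx|apply Cderiv_const]. }
  cbv beta; replace (1 - s - 1)%C with (- s)%C by ring.
  field; apply Cminus_neq; congruence.
Qed.

Lemma zeta_termE s n : s <> RtoC 1 ->
  zeta_term s n = (cpow n (- s) - (primitive s (n + 1) - primitive s n))%C.
Proof.
  intros Hs; unfold zeta_term, primitive; field; apply Cminus_neq; congruence.
Qed.

Lemma Rpower_decr (n x a : R) : 0 < n -> n <= x -> a <= 0 -> Rpower x a <= Rpower n a.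
Proof.
  intros Hn Hx Ha; unfold Rpower; apply exp_le_compat.
  assert (ln n <= ln x) by (apply ln_le; assumption); nra.
Qed.

Lemma zeta_term_bound s n : s <> RtoC 1 -> 0 < Re s -> 1 <= n ->
  Cmod (zeta_term s n) <= 4 * (Cmod s * Rpower n (- 1 - Re s)).
Proof.
  intros Hs H0 Hn; rewrite zeta_termE by exact Hs.
  apply mean_value_err with (p := fun x => cpow x (- s)) (q := fun x => (- s * cpow x (- s - 1))%C).
  - apply Rmult_le_pos; [apply Cmod_ge_0|left; apply exp_pos].
  - intros; apply Cderiv_primitive; [exact Hs|lra].
  - intros; apply Cderiv_cpow; lra.
  - intros x Hx; rewrite Cmod_mult, Cmod_opp, Cmod_cpow.
    apply Rmult_le_compat_l; [apply Cmod_ge_0|].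
    replace (Re (- s - 1)%C) with (- 1 - Re s) by (unfold Re; simpl; ring).
    apply Rpower_decr; lra.
Qed.

Definition zeta_term' (s : C) (n : R) : C :=
  let P x := ((/ (1 - s) - RtoC (ln x)) * primitive s x)%C in
  (- (RtoC (ln n) * cpow n (- s)) - (P (n + 1)%R - P n))%C.

Lemma zeta_term_taylor s h n a :
  s <> RtoC 1 -> (s + h)%C <> RtoC 1 -> 0 < a -> Re s = 8 * a -> Cmod h <= 2 * a -> 1 <= n ->
  Cmod (zeta_term (s + h) n - zeta_term s n - h * zeta_term' s n)%C <=
  4 * (Cmod h ^ 2 * ((4 * Cmod s / a ^ 2 + 2 / a) * Rpower n (- 1 - 4 * a))).
Proof.
  intros Hs Hsh Ha Hsa Hh Hn; rewrite !zeta_termE by assumption.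
  unfold zeta_term'.
  set (P' := fun x => ((/ (1 - s) - RtoC (ln x)) * primitive s x)%C).
  set (P := fun x => (primitive (s + h) x - primitive s x - h * P' x)%C).
  set (p := fun x => (cpow x (- (s + h)) - cpow x (- s) + h * (RtoC (ln x) * cpow x (- s)))%C).
  set (E := fun x => Cexp (- h * RtoC (ln x))%C).
  set (q := fun x => (cpow x (- s - 1) *
       (- s * (E x - 1 - (- h * RtoC (ln x))) - h * (E x - 1)))%C).
  match goal with |- Cmod ?z <= _ => replace z with (p n - (P (n + 1)%R - P n))%C end.
  2:{ unfold p, P, P'; cbv beta; ring. }
  assert (Hc := Cmod_ge_0 s); assert (Hch := Cmod_ge_0 h).
  assert (Ia : 0 < / a) by (apply Rinv_0_lt_compat; exact Ha).
  assert (K0 : 0 <= 4 * Cmod s / a ^ 2 + 2 / a).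
  { unfold Rdiv; rewrite <- pow_inv.
    assert (0 <= (/ a) ^ 2) by apply pow2_ge_0; nra. }
  apply mean_value_err with (p := p) (q := q).
  - apply Rmult_le_pos; [apply pow2_ge_0|].
    apply Rmult_le_pos; [exact K0|left; apply exp_pos].
  - intros x Hx; unfold P.
    eapply Cderiv_ext.
    2:{ apply Cderiv_minus; [apply Cderiv_minus; apply Cderiv_primitive; try assumption; lra|].
        apply Cderiv_scal; unfold P'.
        apply Cderiv_mult; [apply Cderiv_minus; [apply Cderiv_const|]
                           |apply Cderiv_primitive; [assumption|lra]].
        apply Cderiv_RtoC with (l := / x); auto_derive; [lra|field; lra]. }
    unfold p, primitive; cbv beta.
    assert (X : (RtoC (/ x) * cpow x (1 - s))%C = cpow x (- s)).
    { replace (1 - s)%C with (- s + RtoC 1)%C by ring.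
      rewrite cpow_plus, cpow_RtoC, Rpower_1, RtoC_inv by lra.
      field; intro Z; apply RtoC_inj in Z; lra. }
    assert (N : (1 - s)%C <> 0) by (apply Cminus_neq; congruence).
    transitivity (cpow x (- (s + h)) - cpow x (- s) -
      h * (- (RtoC (/ x) * cpow x (1 - s)) / (1 - s) + (/ (1 - s) - RtoC (ln x)) * cpow x (- s)))%C.
    { field; exact N. }
    rewrite X; field; exact N.
  - intros x Hx; unfold p.
    eapply Cderiv_ext.
    2:{ apply Cderiv_plus; [apply Cderiv_minus; apply Cderiv_cpow; lra|].
        apply Cderiv_scal, Cderiv_mult; [|apply Cderiv_cpow; lra].
        apply Cderiv_RtoC with (l := / x); auto_derive; [lra|field; lra]. }
    unfold q; cbv beta.
    assert (X1 : (RtoC (/ x) * cpow x (- s))%C = cpow x (- s - 1)).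
    { unfold Cminus at 1; rewrite cpow_plus, <- RtoC_opp, cpow_RtoC, Rpower_Ropp, Rpower_1 by lra.
      ring. }
    assert (X2 : cpow x (- (s + h) - 1) = (cpow x (- s - 1) * E x)%C).
    { replace (- (s + h) - 1)%C with (- s - 1 + - h)%C by ring.
      rewrite cpow_plus; reflexivity. }
    rewrite X1, X2; ring.
  - intros x Hx; unfold q.
    assert (L0 : 0 <= ln x) by (rewrite <- ln_1; apply ln_le; lra).
    set (L := ln x) in *.
    assert (M : Cmod (- h * RtoC L) = Cmod h * L).
    { rewrite Cmod_mult, Cmod_opp, Cmod_R, Rabs_right; [reflexivity|lra]. }
    assert (B1 := Cexp_bound1 (- h * RtoC L)).
    assert (B2 := Cexp_bound2 (- h * RtoC L)).
    rewrite M in B1, B2.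
    set (X := Rpower x a).
    assert (X1 : 1 <= X).
    { unfold X, Rpower; rewrite <- exp_0; apply exp_le_compat; fold L; nra. }
    assert (LX : L <= X / a).
    { apply Rmult_le_reg_l with a; [exact Ha|].
      replace (a * (X / a)) with X by (field; lra).
      unfold X, Rpower; fold L; assert (Z := exp_ineq1_le (a * L)); lra. }
    assert (EX : exp (Cmod h * L) <= X ^ 2).
    { unfold X, Rpower; fold L; simpl; rewrite Rmult_1_r, <- exp_plus.
      apply exp_le_compat; nra. }
    assert (EX0 := exp_pos (Cmod h * L)).
    rewrite Cmod_mult, Cmod_cpow.
    replace (Re (- s - 1)%C) with (- 1 - 4 * a + - (4 * a)).
    2:{ unfold Re in *; simpl; lra. }
    rewrite Rpower_plus.
    assert (R1 : Rpower x (- (4 * a)) * X ^ 4 = 1).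
    { rewrite Rpower_Ropp; unfold X.
      replace (Rpower x a ^ 4) with (Rpower x (4 * a)).
      - apply Rinv_l; unfold Rpower; assert (Z := exp_pos (4 * a * ln x)); lra.
      - rewrite <- Rpower_pow by apply exp_pos; rewrite Rpower_mult; f_equal; simpl; ring. }
    assert (R2 : Cmod (- s * (E x - 1 - - h * RtoC L) - h * (E x - 1))%C <=
       Cmod h ^ 2 * (4 * Cmod s / a ^ 2 + 2 / a) * X ^ 4).
    { eapply Rle_trans; [apply Cmod_triangle|].
      rewrite Cmod_opp, !Cmod_mult, Cmod_opp; unfold E; fold L.
      apply Rle_trans with (Cmod s * (4 * ((Cmod h * L) ^ 2 * exp (Cmod h * L))) +
                            Cmod h * (2 * (Cmod h * L * exp (Cmod h * L)))).
      { apply Rplus_le_compat; apply Rmult_le_compat_l; assumption. }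
      assert (S2 : L ^ 2 * exp (Cmod h * L) <= X ^ 4 / a ^ 2).
      { replace (X ^ 4 / a ^ 2) with ((X / a) ^ 2 * X ^ 2) by (field; lra).
        apply Rmult_le_compat; [apply pow2_ge_0|lra| |exact EX].
        apply pow_incr; lra. }
      assert (S1 : L * exp (Cmod h * L) <= X ^ 4 / a).
      { replace (X ^ 4 / a) with ((X / a) * X ^ 3) by (field; lra).
        apply Rmult_le_compat; [lra|lra|exact LX|].
        assert (0 <= X ^ 2) by apply pow2_ge_0; simpl in *; nra. }
      replace (Cmod s * (4 * ((Cmod h * L) ^ 2 * exp (Cmod h * L))) +
               Cmod h * (2 * (Cmod h * L * exp (Cmod h * L))))
        with (Cmod h ^ 2 * (4 * Cmod s * (L ^ 2 * exp (Cmod h * L)) +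
               2 * (L * exp (Cmod h * L)))) by ring.
      replace (Cmod h ^ 2 * (4 * Cmod s / a ^ 2 + 2 / a) * X ^ 4)
        with (Cmod h ^ 2 * (4 * Cmod s * (X ^ 4 / a ^ 2) + 2 * (X ^ 4 / a)))
        by (field; lra).
      apply Rmult_le_compat_l; [apply pow2_ge_0|].
      apply Rplus_le_compat; [apply Rmult_le_compat_l; lra|lra]. }
    set (Kc := 4 * Cmod s / a ^ 2 + 2 / a) in *.
    assert (PX := exp_pos ((-1 - 4 * a) * ln x)); fold (Rpower x (-1 - 4 * a)) in PX.
    assert (PY := exp_pos (- (4 * a) * ln x)); fold (Rpower x (- (4 * a))) in PY.
    apply Rle_trans with (Rpower x (-1 - 4 * a) * Rpower x (- (4 * a)) *
                          (Cmod h ^ 2 * Kc * X ^ 4)).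
    { apply Rmult_le_compat_l; [|exact R2]. nra. }
    replace (Rpower x (-1 - 4 * a) * Rpower x (- (4 * a)) * (Cmod h ^ 2 * Kc * X ^ 4))
      with (Cmod h ^ 2 * (Kc * (Rpower x (-1 - 4 * a) * (Rpower x (- (4 * a)) * X ^ 4)))) by ring.
    rewrite R1, Rmult_1_r.
    apply Rmult_le_compat_l; [apply pow2_ge_0|].
    apply Rmult_le_compat_l; [exact K0|apply Rpower_decr; lra].
Qed.

Lemma Rpower_summable (b : R) : 0 < b ->
  ex_series (fun n => Rpower (INR (S n)) (- 1 - b)).
Proof.
  intros Hb.
  assert (B : forall n, sum_n (fun n => Rpower (INR (S n)) (- 1 - b)) n <=
              1 + / b - / b * Rpower (INR (S n)) (- b)).
  { induction n as [|n IH].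
    - rewrite sum_O; simpl; unfold Rpower; rewrite ln_1, !Rmult_0_r, exp_0; lra.
    - rewrite sum_Sn; unfold plus; simpl plus.
      assert (Hn : 0 < INR (S n)) by (apply lt_0_INR; lia).
      destruct (MVT_gen (fun x => Rpower x (- b)) (INR (S n)) (INR (S (S n)))
                 (fun x => - b * Rpower x (- b - 1))) as [c [Hc E]].
      + intros x Hx; rewrite Rmin_left, Rmax_right in Hx by (rewrite (S_INR (S n)); lra).
        apply is_derive_Reals, derivable_pt_lim_power; lra.
      + intros x Hx; rewrite Rmin_left, Rmax_right in Hx by (rewrite (S_INR (S n)); lra).
        apply derivable_continuous_pt; eexists; apply derivable_pt_lim_power; lra.
      + rewrite Rmin_left, Rmax_right in Hc by (rewrite (S_INR (S n)); lra).
        replace (INR (S (S n)) - INR (S n)) with 1 in E by (rewrite (S_INR (S n)); ring).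
        rewrite Rmult_1_r in E.
        assert (D : Rpower (INR (S (S n))) (- 1 - b) <= Rpower c (- b - 1)).
        { replace (- 1 - b) with (- b - 1) by ring; apply Rpower_decr; lra. }
        change (sum_n (fun n => Rpower (INR (S n)) (- 1 - b)) n +
                Rpower (INR (S (S n))) (- 1 - b) <=
                1 + / b - / b * Rpower (INR (S (S n))) (- b)).
        assert (F : / b * Rpower (INR (S (S n))) (- b) =
                    / b * Rpower (INR (S n)) (- b) - Rpower c (- b - 1)).
        { apply Rmult_eq_reg_l with b; [|lra].
          rewrite Rmult_minus_distr_l, <- !Rmult_assoc, Rinv_r by lra; lra. }
        lra. }
  destruct (ex_finite_lim_seq_incr (sum_n (fun n => Rpower (INR (S n)) (- 1 - b))) (1 + / b))
    as [l Hl].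
  - intros n; rewrite sum_Sn.
    assert (P := exp_pos ((- 1 - b) * ln (INR (S (S n))))).
    unfold plus; simpl; unfold Rpower; simpl in P; lra.
  - intros n; eapply Rle_trans; [apply B|].
    assert (P := exp_pos (- b * ln (INR (S n)))); fold (Rpower (INR (S n)) (- b)) in P.
    assert (I : 0 < / b) by (apply Rinv_0_lt_compat; exact Hb); nra.
  - exists l; exact Hl.
Qed.

Notation is_Cseries := (is_series (K := C_AbsRing) (V := C_NormedModule)).

Lemma Csum_O (a : nat -> C) : sum_n (G := C_AbelianMonoid) a 0 = a O :> C.
Proof. exact (sum_O (G := C_AbelianMonoid) a). Qed.

Lemma Csum_Sn (a : nat -> C) n :
  sum_n (G := C_AbelianMonoid) a (S n) =
  (sum_n (G := C_AbelianMonoid) a n + a (S n))%C :> C.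
Proof. exact (sum_Sn (G := C_AbelianMonoid) a n). Qed.

Lemma sum_n_Re (a : nat -> C) n :
  sum_n (fun n => Re (a n)) n = Re (sum_n (G := C_AbelianMonoid) a n).
Proof. induction n as [|n IH]; [now rewrite !sum_O|]; rewrite !sum_Sn, IH; reflexivity. Qed.

Lemma sum_n_Im (a : nat -> C) n :
  sum_n (fun n => Im (a n)) n = Im (sum_n (G := C_AbelianMonoid) a n).
Proof. induction n as [|n IH]; [now rewrite !sum_O|]; rewrite !sum_Sn, IH; reflexivity. Qed.

Lemma is_Cseries_unique (a : nat -> C) (l : C) : is_Cseries a l -> CSeries a = l.
Proof.
  intros H; destruct l as [l1 l2]; unfold CSeries; f_equal; apply is_series_unique.
  - eapply filterlim_ext; [intros n; symmetry; apply sum_n_Re|].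
    eapply filterlim_comp; [exact H|]; intros P [e He]; exists e; intros y Hy.
    apply He, Hy.
  - eapply filterlim_ext; [intros n; symmetry; apply sum_n_Im|].
    eapply filterlim_comp; [exact H|]; intros P [e He]; exists e; intros y Hy.
    apply He, Hy.
Qed.

Lemma CSeries_correct (a : nat -> C) (b : nat -> R) :
  (forall n, Cmod (a n) <= b n) -> ex_series b -> is_Cseries a (CSeries a).
Proof.
  intros Hab Hb.
  destruct (ex_series_le (K := C_AbsRing) (V := C_CompleteNormedModule) a b) as [l Hl].
  - intros n; exact (Hab n).
  - exact Hb.
  - rewrite (is_Cseries_unique a l Hl); exact Hl.
Qed.

Lemma CSeries_bound (a : nat -> C) (b : nat -> R) :
  (forall n, Cmod (a n) <= b n) -> ex_series b -> Cmod (CSeries a) <= 2 * Series b.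
Proof.
  intros Hab Hb.
  assert (E : forall u : nat -> R, (forall n, Rabs (u n) <= b n) ->
              Rabs (Series u) <= Series b).
  { intros u Hu; eapply Rle_trans; [apply Series_Rabs|apply Series_le].
    - apply (ex_series_le (K := R_AbsRing) (V := R_CompleteNormedModule)
               (fun n => Rabs (u n)) b); [|exact Hb].
      intros n; unfold norm; simpl; unfold abs; simpl; rewrite Rabs_Rabsolu; apply Hu.
    - intros n; split; [apply Rabs_pos|apply Hu].
    - exact Hb. }
  eapply Rle_trans; [apply Cmod_le_parts|].
  assert (Rabs (Re (CSeries a)) <= Series b).
  { apply E; intros n; eapply Rle_trans; [apply re_le_Cmod|apply Hab]. }
  assert (Rabs (Im (CSeries a)) <= Series b).
  { apply E; intros n; eapply Rle_trans; [apply im_le_Cmod|apply Hab]. }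
  lra.
Qed.

Lemma INR_S_ge_1 n : 1 <= INR (S n).
Proof. rewrite S_INR; assert (H := pos_INR n); lra. Qed.

Lemma ex_series_scal_R (c : R) (a : nat -> R) :
  ex_series a -> ex_series (fun n => c * a n).
Proof. exact (ex_series_scal_l (K := R_AbsRing) (V := R_NormedModule) c a). Qed.

Lemma zeta_series s : s <> RtoC 1 -> 0 < Re s ->
  is_Cseries (fun n => zeta_term s (INR (S n))) (CSeries (fun n => zeta_term s (INR (S n)))).
Proof.
  intros Hs H0; eapply CSeries_correct.
  - intros n; apply zeta_term_bound; [exact Hs|exact H0|apply INR_S_ge_1].
  - apply (ex_series_scal_R 4 (fun n => Cmod s * Rpower (INR (S n)) (- 1 - Re s))),
      ex_series_scal_R, Rpower_summable, H0.
Qed.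

Lemma zeta_dirichlet (s : C) : 1 < Re s ->
  is_series (K := C_AbsRing) (V := C_NormedModule)
    (fun n => cpow (INR (S n)) (- s)) (zeta s).
Proof.
  intros H1.
  assert (Hs : s <> RtoC 1) by (intros ->; simpl in H1; lra).
  assert (N1 : (1 - s)%C <> 0) by (apply Cminus_neq; congruence).
  assert (H := zeta_series s Hs ltac:(lra)).
  assert (T : forall n, sum_n (G := C_AbelianMonoid) (fun n => cpow (INR (S n)) (- s)) n =
     (sum_n (G := C_AbelianMonoid) (fun n => zeta_term s (INR (S n))) n +
      (/ (s - 1) + primitive s (INR (S (S n)))))%C :> C).
  { induction n as [|n IH].
    - rewrite !Csum_O, zeta_termE by exact Hs; simpl (INR 1); rewrite !cpow_1_l.
      unfold primitive; rewrite cpow_1_l; change (INR 2) with (1 + 1).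
      field; split; apply Cminus_neq; congruence.
    - rewrite !Csum_Sn, IH, (zeta_termE s (INR (S (S n)))) by exact Hs.
      rewrite <- (S_INR (S (S n))); ring. }
  intros P [e He].
  assert (E2 : 0 < e / 2) by (destruct e as [e he]; simpl; lra).
  assert (HP : eventually (fun n => Cmod (primitive s (INR (S (S n)))) < e / 2)).
  { assert (M := proj1 (Cmod_gt_0 (1 - s)%C) N1).
    assert (Hr : 0 < e / 2 * Cmod (1 - s)) by (apply Rmult_lt_0_compat; assumption).
    set (r := e / 2 * Cmod (1 - s)) in *.
    set (d := Re s - 1); assert (Hd : 0 < d) by (unfold d; lra).
    destruct (nfloor_ex (Rpower r (- / d))) as [N HN]; [left; apply exp_pos|].
    exists N; intros n Hn; unfold primitive.
    rewrite Cmod_div by exact N1; apply Rmult_lt_reg_r with (Cmod (1 - s)); [exact M|].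
    unfold Rdiv at 1; rewrite Rmult_assoc, Rinv_l, Rmult_1_r by lra; fold r.
    rewrite Cmod_cpow.
    replace (Re (1 - s)%C) with (- d) by (unfold d, Re; simpl; ring).
    assert (G : Rpower r (- / d) < INR (S (S n))).
    { apply Rlt_le_trans with (INR N + 1); [apply HN|].
      rewrite <- S_INR; apply le_INR; lia. }
    assert (G2 : - / d * ln r < ln (INR (S (S n)))).
    { rewrite <- (ln_exp (- / d * ln r)); apply ln_increasing; [apply exp_pos|exact G]. }
    unfold Rpower; rewrite <- (exp_ln r) by exact Hr; apply exp_increasing.
    assert (G3 := Rmult_lt_compat_l d _ _ Hd G2).
    replace (d * (- / d * ln r)) with (- ln r) in G3 by (field; lra); lra. }
  assert (HS := H (fun y => Cmod (y - CSeries (fun n => zeta_term s (INR (S n))))%C < e / 2)).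
  assert (HS' : eventually (fun n => Cmod (sum_n (G := C_AbelianMonoid)
      (fun n => zeta_term s (INR (S n))) n - CSeries (fun n => zeta_term s (INR (S n))))%C < e / 2)).
  { apply HS.
    assert (E4 : 0 < e / 2 / 2) by lra.
    exists (mkposreal _ E4); intros y Hy.
    assert (Q := C_NormedModule_mixin_compat2 _ _ _ Hy); simpl in Q.
    eapply Rlt_le_trans; [exact Q|].
    assert (sqrt 2 <= 2).
    { rewrite <- (sqrt_square 2) at 2 by lra; apply sqrt_le_1_alt; lra. }
    assert (sqrt 2 * (e / 2 / 2) <= 2 * (e / 2 / 2)) by (apply Rmult_le_compat_r; lra).
    lra. }
  destruct HP as [N1' HP], HS' as [N2 HS'].
  exists (max N1' N2); intros n Hn; apply He.
  apply C_NormedModule_mixin_compat1.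
  specialize (HP n ltac:(lia)); specialize (HS' n ltac:(lia)).
  change (Cmod (sum_n (G := C_AbelianMonoid) (fun n => cpow (INR (S n)) (- s)) n - zeta s)%C < e).
  rewrite T; unfold zeta.
  match goal with |- Cmod ?z < _ => replace z with
   (sum_n (G := C_AbelianMonoid) (fun n => zeta_term s (INR (S n))) n -
      CSeries (fun n => zeta_term s (INR (S n))) + primitive s (INR (S (S n))))%C end.
  2:{ ring. }
  eapply Rle_lt_trans; [apply Cmod_triangle|lra].
Qed.

Lemma is_derive_quadratic (f : C -> C) (s l : C) (K r : R) :
  0 < r -> 
  (forall h, Cmod h <= r -> Cmod (f (s + h) - f s - h * l)%C <= K * Cmod h ^ 2) ->
  is_derive (K := C_AbsRing) (V := C_NormedModule) f s l.
Proof.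
  intros Hr H; split; [apply is_linear_scal_l|].
  intros y Hy; rewrite <- (is_filter_lim_locally_unique _ _ Hy); clear y Hy.
  intros e.
  assert (K1 : 0 < Rabs K + 1) by (assert (Z := Rabs_pos K); lra).
  assert (D : 0 < Rmin r (e / (Rabs K + 1))).
  { apply Rmin_pos; [exact Hr|]; apply Rdiv_lt_0_compat; [apply cond_pos|exact K1]. }
  exists (mkposreal _ D); intros y Hy.
  change (Cmod (y - s)%C < Rmin r (e / (Rabs K + 1))) in Hy.
  change (norm (V := C_NormedModule)
    (minus (minus (f y) (f s)) (scal (minus y s) l)) <= e * Cmod (y - s)%C).
  change (Cmod (f y - f s - (y - s) * l)%C <= e * Cmod (y - s)%C).
  set (h := (y - s)%C) in *; replace y with (s + h)%C by (unfold h; ring).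
  assert (H1 := Rmin_l r (e / (Rabs K + 1))); assert (H2 := Rmin_r r (e / (Rabs K + 1))).
  eapply Rle_trans; [apply H; lra|].
  assert (H3 : Cmod h * (Rabs K + 1) <= e).
  { replace (pos e) with (e / (Rabs K + 1) * (Rabs K + 1)) by (field; lra).
    apply Rmult_le_compat_r; lra. }
  assert (H4 := Cmod_ge_0 h); assert (H5 := Rle_abs K).
  simpl; nra.
Qed.

Lemma inv_quadratic (w h : C) : w <> 0 -> Cmod h <= Cmod w / 2 ->
  Cmod (/ (w + h) - / w - h * (- / w ^ 2))%C <= 2 / Cmod w ^ 3 * Cmod h ^ 2.
Proof.
  intros Hw Hh.
  assert (M := proj1 (Cmod_gt_0 w) Hw).
  assert (T : Cmod w / 2 <= Cmod (w + h)).
  { assert (Z := Cmod_triangle (w + h) (- h)).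
    replace (w + h + - h)%C with w in Z by ring; rewrite Cmod_opp in Z; lra. }
  assert (Hwh : (w + h)%C <> 0) by (apply Cmod_gt_0; lra).
  replace (/ (w + h) - / w - h * (- / w ^ 2))%C with (h ^ 2 / (w ^ 2 * (w + h)))%C.
  2:{ field; split; assumption. }
  rewrite Cmod_div.
  2:{ apply Cmult_neq_0; [apply Cpow_nz|]; assumption. }
  rewrite Cmod_mult, !Cmod_pow.
  replace (2 / Cmod w ^ 3 * Cmod h ^ 2) with (Cmod h ^ 2 * / (Cmod w ^ 2 * (Cmod w / 2)))
    by (field; lra).
  apply Rmult_le_compat_l; [apply pow2_ge_0|].
  assert (0 < Cmod w ^ 2) by (apply pow_lt; exact M).
  apply Rinv_le_contravar; [nra|].
  apply Rmult_le_compat_l; lra.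
Qed.

Lemma zeta_holomorphic (s : C) : 0 < Re s -> s <> RtoC 1 ->
  ex_derive (K := C_AbsRing) (V := C_NormedModule) zeta s.
Proof.
  intros H0 Hs.
  set (a := Re s / 8); assert (Ha : 0 < a) by (unfold a; lra).
  assert (Hsa : Re s = 8 * a) by (unfold a; lra).
  assert (W : (s - 1)%C <> 0) by (apply Cminus_neq, Hs).
  assert (M := proj1 (Cmod_gt_0 _) W).
  set (r := Rmin (2 * a) (Cmod (s - 1) / 2)).
  assert (Hr : 0 < r) by (apply Rmin_pos; lra).
  assert (r1 : r <= 2 * a) by apply Rmin_l.
  assert (r2 : r <= Cmod (s - 1) / 2) by apply Rmin_r.
  assert (Hsh : forall h, Cmod h <= r -> (s + h)%C <> RtoC 1).
  { intros h Hh Z.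
    assert (Q : (s - 1)%C = (- h)%C) by (rewrite <- Z; ring).
    rewrite Q, Cmod_opp in r2, M; lra. }
  assert (Hre : forall h, Cmod h <= r -> 0 < Re (s + h)%C).
  { intros h Hh; rewrite re_plus.
    assert (A := re_le_Cmod h); assert (B := Rabs_maj2 (Re h)); lra. }
  set (b := fun n => Rpower (INR (S n)) (- 1 - 4 * a)).
  assert (Hb : ex_series b) by (apply Rpower_summable; lra).
  set (K := 4 * Cmod s / a ^ 2 + 2 / a).
  set (t' := fun n => zeta_term' s (INR (S n))).
  set (R := fun h n => (zeta_term (s + h) (INR (S n)) - zeta_term s (INR (S n)) - h * t' n)%C).
  assert (TR : forall h n, Cmod h <= r -> Cmod (R h n) <= 4 * (Cmod h ^ 2 * (K * b n))).
  { intros h n Hh; apply zeta_term_taylor; auto; [lra|apply INR_S_ge_1]. }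
  assert (SB : forall h, ex_series (fun n => 4 * (Cmod h ^ 2 * (K * b n)))).
  { intros h; apply (ex_series_scal_R 4 (fun n => Cmod h ^ 2 * (K * b n))),
      (ex_series_scal_R (Cmod h ^ 2) (fun n => K * b n)), ex_series_scal_R, Hb. }
  assert (SR : forall h, Cmod h <= r -> is_Cseries (R h) (CSeries (R h))).
  { intros h Hh; eapply CSeries_correct; [intros n; apply TR, Hh|apply SB]. }
  assert (ST : exists d, is_Cseries t' d).
  { set (h := RtoC r).
    assert (Hh : Cmod h <= r) by (unfold h; rewrite Cmod_R, Rabs_right; lra).
    assert (h0 : h <> 0) by (intros Z; apply RtoC_inj in Z; lra).
    eexists.
    eapply is_series_ext.
    2:{ apply (is_series_scal_l (K := C_AbsRing) (V := C_NormedModule) (/ h)%C).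
        apply (is_series_minus (K := C_AbsRing) (V := C_NormedModule)).
        - apply (is_series_minus (K := C_AbsRing) (V := C_NormedModule)).
          + apply (zeta_series (s + h)); auto.
          + apply (zeta_series s); auto.
        - apply (SR h Hh). }
    intros n; unfold R.
    change ((/ h * (zeta_term (s + h) (INR (S n)) - zeta_term s (INR (S n)) -
      (zeta_term (s + h) (INR (S n)) - zeta_term s (INR (S n)) - h * t' n)))%C = t' n).
    field; exact h0. }
  destruct ST as [d Hd].
  exists (- / (s - 1) ^ 2 + d)%C.
  apply is_derive_quadratic with (K := 2 / Cmod (s - 1) ^ 3 + 8 * K * Series b) (r := r);
    [exact Hr|].
  intros h Hh.
  assert (E : CSeries (R h) = (CSeries (fun n => zeta_term (s + h) (INR (S n))) -
     CSeries (fun n => zeta_term s (INR (S n))) - h * d)%C).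
  { apply is_Cseries_unique.
    apply (is_series_minus (K := C_AbsRing) (V := C_NormedModule)).
    - apply (is_series_minus (K := C_AbsRing) (V := C_NormedModule)).
      + apply (zeta_series (s + h)); auto.
      + apply (zeta_series s); auto.
    - exact (is_series_scal_l (K := C_AbsRing) (V := C_NormedModule) h t' d Hd). }
  assert (B := CSeries_bound (R h) _ (fun n => TR h n Hh) (SB h)).
  rewrite !Series_scal_l in B.
  assert (I := inv_quadratic (s - 1) h W ltac:(lra)).
  unfold zeta.
  match goal with |- Cmod ?z <= _ => replace z with
    (/ (s - 1 + h) - / (s - 1) - h * (- / (s - 1) ^ 2) + CSeries (R h))%C end.
  2:{ rewrite E; replace (s + h - 1)%C with (s - 1 + h)%C by ring; ring. }
  eapply Rle_trans; [apply Cmod_triangle|lra].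
Qed.

(* Main.v *)
(** The theorem is a resonance argument.  Put [r(n) = n^(-e)] on the divisors of [nu] and let [h] be
    the convolution of [r] with [n^(-s)], so that the sum on the right is [\sum_(n | nu) h(n)^2] and
    [sigma_(-2e)(nu) = \sum_(n | nu) r(n)^2].  Since [zeta] times the Dirichlet polynomial of [r] has
    the coefficients [h], testing it against the Dirichlet polynomial of [h] bounds the maximum of
    [|zeta|] from below by [|h| / |r|].  As [nu] may be much larger than [T], the frequencies
    [ln n] are first collected in cells of length about [1 / T], each carrying the l^2 norm of its
    coefficients; the mean values over the sample points [d tau] are then controlled by Parseval on
    a finite cyclic group, and Cauchy-Schwarz shows that the correlation of the two polynomials is
    not decreased, because Fejer's kernel is positive.  Everything near the pole of [zeta] is
    estimated trivially, and this is where the condition on [T] enters.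

    The constant contains the factor [zeta(2s)], which is unbounded for [s] near [1/2].  There the
    condition forces [T] to be a large power of what the argument needs, so that finitely many new
    primes [q], with [\sum q^(-s)] as large as desired, can be adjoined to the resonator.  For
    [s > 1] the bound follows from the almost periodicity of [zeta(s + it)].  The maximum over [k]
    and [l] in the hypothesis is simply [nu]. *)

From Stdlib Require Import Reals ZArith Lra Lia List Permutation Classical.
From mathcomp Require all_boot zify.
From Coquelicot Require Import Coquelicot.
Require Import Defs.
Open Scope R_scope.

(** The argument needs the product of the l^1 norms of [r] and [h] to be at most T^(2s-1) times
    |h|^2, up to a small spare power of T. The first norm is sigma_(-e)(nu), the second at most
    sigma_(-s)(nu) sigma_(-e)(nu), which the condition does not control directly; but sigma_(-s)
    sigma_(-e) <= 2 sigma_(-1) sigma_(1-s-e) for s <= 1, and sigma_(-1)(nu) = O(sqrt(1 + ln nu)) is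
    paid by the factor ln(nu T) of the condition. The constant c_sigma has a single use: by the
    condition a bounded T would bound nu, so a large nu forces T beyond any threshold depending on
    s. For 1/2 < s < 1 the spare power of T then swallows all constants; it vanishes at s = 1, where
    a finer count is made. The adjoined primes must be coprime to nu. For e <= 2/5 the condition
    bounds nu by a power of T, so that nu has only O(1 + ln T) prime factors. For larger e every
    small prime may divide nu, but a factor q^j then hardly affects the sum on the right and can be
    removed. Enough primes are supplied by Chebyshev's bound. *)

Definition nat_prime (p : nat) : Prop :=
  (2 <= p)%nat /\ forall d, Nat.divide d p -> d = 1%nat \/ d = p.

(** * Chebyshev's lower bound for the number of primes *)

Module CentralBinomial.

Import all_boot zify.
Local Open Scope nat_scope.

(** By Legendre's formula the exponent of [p] is the sum over k of floor(2n/p^k) - 2 floor(n/p^k).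
    Each summand is 0 or 1 and vanishes once p^k > 2n, so the exponent is at most the largest [t]
    with p^t <= 2n. *)
Lemma pow_logn_central_binomial (p n : nat) :
  prime p -> 0 < n -> p ^ logn p 'C(n.*2, n) <= n.*2.
Proof.
move=> pp n0.
have p1 := prime_gt1 pp.
have H : logn p 'C(n.*2, n) =
     \sum_(1 <= k < n.*2.+1) n.*2 %/ p ^ k - (\sum_(1 <= k < n.+1) n %/ p ^ k).*2.
  have := bin_fact (leq_addr n n); rewrite addnn => /(congr1 (logn p)).
  rewrite -{2}addnn addnK !lognM ?muln_gt0 ?fact_gt0 ?bin_gt0 -?addnn ?leq_addr //.
  rewrite addnn !logn_fact //; lia.
(* The two sums of Legendre's formula are brought to a common range; the added terms are zero. *)
have X : \sum_(1 <= k < n.+1) n %/ p ^ k = \sum_(1 <= k < n.*2.+1) n %/ p ^ k.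
  rewrite [RHS](@big_cat_nat _ _ _ n.+1) //=; last by lia.
  rewrite [X in _ = _ + X]big1_seq ?addn0 // => k /andP[_]; rewrite mem_index_iota => /andP[nk _].
  by rewrite divn_small // (leq_trans (ltn_expl n p1)) // leq_exp2l // ltnW.
set t := trunc_log p n.*2.
have tl : t <= n.*2.
  by apply: leq_trans (ltnW (ltn_expl t p1)) _; apply: trunc_logP; lia.
have E : logn p 'C(n.*2, n) <= \sum_(1 <= k < n.*2.+1) (k <= t).
  rewrite H X leq_subLR -[X in X + _]addnn -!big_split /=.
  apply: leq_sum => k _; case: (leqP k t) => [_|tk].
    rewrite -addnn divnD ?expn_gt0 ?(ltnW p1) // leq_add2l; apply: leq_b1.
  by rewrite divn_small // (leq_trans (trunc_log_ltn _ p1)) // leq_exp2l.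
have F : \sum_(1 <= k < n.*2.+1) (k <= t) = t.
  rewrite (@big_cat_nat _ _ _ t.+1) //=.
  rewrite [X in _ + X]big1_seq ?addn0; last first.
    by move=> k /andP[_]; rewrite mem_index_iota => /andP[tk _]; rewrite leqNgt tk.
  rewrite (eq_big_nat _ _ (F2 := fun=> 1)) ?sum_nat_const_nat ?muln1 ?subn1 //.
  by move=> k /andP[_]; rewrite ltnS => ->.
apply: leq_trans (trunc_logP (n := n.*2) p1 _); last by lia.
by rewrite leq_exp2l // -/t -F.
Qed.

Lemma central_binomial_ge (n : nat) : 2 ^ n <= 'C(n.*2, n).
Proof.
elim: n => [|n IH]; first by rewrite bin0.
rewrite doubleS binS.
have -> : 'C(n.*2.+1, n.+1) = 'C(n.*2.+1, n).
  by rewrite -bin_sub; [congr 'C(_, _)|]; lia.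
have : 'C(n.*2, n) <= 'C(n.*2.+1, n).
  by case: (n) => [|k]; rewrite ?bin0 // [X in _ <= X]binS leq_addr.
rewrite expnS; lia.
Qed.

Lemma expnE_pow (m n : nat) : m ^ n = Nat.pow m n.
Proof. by elim: n => [//|n IH]; rewrite expnS IH. Qed.

Lemma nat_primeP (p : nat) : prime p -> nat_prime p.
Proof.
move=> pp; split; first by apply/leP; exact: prime_gt1.
move=> d [k E].
have /(prime_nt_dvdP pp) : d %| p by apply/dvdnP; exists k.
by case: (eqVneq d 1) => [-> _|d1 H]; [left|right; apply: H].
Qed.

Lemma In_mem (x : nat) (s : seq nat) : List.In x s <-> x \in s.
Proof.
elim: s => [//|y s IH] /=; rewrite inE; split.
  by case=> [->|/IH ->]; rewrite ?eqxx ?orbT.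
by case/orP => [/eqP ->|/IH]; [left|right].
Qed.

(** The list consists of the primes dividing the central binomial coefficient, which is at least 2^n
    while each prime power in its factorization is at most 2n. Chebyshev's bound is kept in
    multiplicative form; logarithms are taken where it is used. *)
Lemma many_primes (n : nat) : (0 < n)%coq_nat ->
  exists l : list nat, NoDup l /\
    (forall q, List.In q l -> nat_prime q /\ (q <= Nat.mul 2 n)%coq_nat) /\
    (Nat.pow 2 n <= Nat.pow (Nat.mul 2 n) (length l))%coq_nat.
Proof.
move=> /ltP n0.
have C0 : 0 < 'C(n.*2, n) by rewrite bin_gt0 -addnn leq_addr.
exists (primes 'C(n.*2, n)); split; [|split].
- have := primes_uniq 'C(n.*2, n); elim: (primes _) => [|x s IH] /=; first by constructor.
  by case/andP=> xs /IH u; constructor=> // /In_mem; rewrite (negPf xs).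
- move=> q /In_mem; rewrite mem_primes => /and3P[pq _ dq]; split; first exact: nat_primeP.
  apply/leP; rewrite -[Nat.mul 2 n]/(2 * n) mul2n.
  apply: leq_trans (pow_logn_central_binomial _ _ pq n0).
  rewrite -{1}(expn1 q) leq_exp2l ?prime_gt1 // logn_gt0 mem_primes pq C0 //.
- have -> : Nat.mul 2 n = n.*2 by rewrite -mul2n.
  rewrite -!expnE_pow; apply/leP; apply: leq_trans (central_binomial_ge n) _.
  rewrite [X in X <= _](prod_prime_decomp C0) prime_decompE big_map /=.
  have : all prime (primes 'C(n.*2, n)) by apply/allP => p; rewrite mem_primes => /andP[].
  elim: (primes _) => [|p s IH] /=; first by rewrite big_nil.
  case/andP=> pp /IH H; rewrite big_cons expnS leq_mul //.
  exact: pow_logn_central_binomial.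
Qed.

End CentralBinomial.

(** * Finite sums *)

Lemma sum_over_cons (a : nat) l f : sum_over (a :: l) f = f a + sum_over l f.
Proof. reflexivity. Qed.

Lemma sum_over_app l l' f : sum_over (l ++ l') f = sum_over l f + sum_over l' f.
Proof.
  induction l as [|a l IH]; [unfold sum_over; simpl; ring|].
  rewrite <- app_comm_cons, !sum_over_cons, IH; ring.
Qed.

Lemma sum_over_ext l f g : (forall x, In x l -> f x = g x) -> sum_over l f = sum_over l g.
Proof.
  induction l as [|a l IH]; intros H; [reflexivity|].
  rewrite !sum_over_cons, (H a (in_eq _ _)), IH; [reflexivity|].
  intros; apply H; now right.
Qed.

Lemma sum_over_le l f g : (forall x, In x l -> f x <= g x) -> sum_over l f <= sum_over l g.
Proof.
  induction l as [|a l IH]; intros H; [right; reflexivity|].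
  rewrite !sum_over_cons; apply Rplus_le_compat; [apply H, in_eq|].
  apply IH; intros; apply H; now right.
Qed.

Lemma sum_over_plus l f g :
  sum_over l (fun x => f x + g x) = sum_over l f + sum_over l g.
Proof.
  induction l as [|a l IH]; [unfold sum_over; simpl; ring|].
  rewrite !sum_over_cons, IH; ring.
Qed.

Lemma sum_over_scal l c f : sum_over l (fun x => c * f x) = c * sum_over l f.
Proof.
  induction l as [|a l IH]; [unfold sum_over; simpl; ring|].
  rewrite !sum_over_cons, IH; ring.
Qed.

Lemma sum_over_scal_r l c f : sum_over l (fun x => f x * c) = sum_over l f * c.
Proof.
  rewrite Rmult_comm, <- sum_over_scal; apply sum_over_ext; intros; ring.
Qed.

Lemma sum_over_const l c : sum_over l (fun _ => c) = INR (length l) * c.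
Proof.
  induction l as [|a l IH]; [unfold sum_over; simpl; ring|].
  rewrite sum_over_cons, IH; simpl length; rewrite S_INR; ring.
Qed.

Lemma sum_over_eq0 l f : (forall x, In x l -> f x = 0) -> sum_over l f = 0.
Proof.
  intros H; rewrite (sum_over_ext l f (fun _ => 0) H), sum_over_const; ring.
Qed.

Lemma sum_over_ge0 l f : (forall x, In x l -> 0 <= f x) -> 0 <= sum_over l f.
Proof.
  intros H; replace 0 with (sum_over l (fun _ => 0)).
  - now apply sum_over_le.
  - rewrite sum_over_const; ring.
Qed.

Lemma sum_over_swap l l' (f : nat -> nat -> R) :
  sum_over l (fun x => sum_over l' (f x)) =
  sum_over l' (fun y => sum_over l (fun x => f x y)).
Proof.
  induction l as [|a l IH].
  - change (0 = sum_over l' (fun _ => 0)); rewrite sum_over_const; ring.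
  - rewrite sum_over_cons, IH, <- sum_over_plus; reflexivity.
Qed.

Lemma sum_over_mult l l' f g :
  sum_over l f * sum_over l' g = sum_over l (fun x => sum_over l' (fun y => f x * g y)).
Proof.
  rewrite <- sum_over_scal_r; apply sum_over_ext; intros x _.
  now rewrite sum_over_scal.
Qed.

Lemma sum_over_map l (k : nat -> nat) f :
  sum_over (map k l) f = sum_over l (fun x => f (k x)).
Proof. unfold sum_over; now rewrite map_map. Qed.

Lemma sum_over_Permutation l l' f : Permutation l l' -> sum_over l f = sum_over l' f.
Proof.
  induction 1 as [|x l l' _ IH|x y l|l1 l2 l3 _ IH1 _ IH2];
    [reflexivity|now rewrite !sum_over_cons, IH|rewrite !sum_over_cons; ring|congruence].
Qed.

Lemma sum_over_incl l l' f :
  NoDup l -> incl l l' -> (forall x, In x l' -> 0 <= f x) -> sum_over l f <= sum_over l' f.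
Proof.
  revert l'; induction l as [|a l IH]; intros l' ND I P.
  - apply sum_over_ge0, P.
  - destruct (in_split a l' (I a (in_eq _ _))) as [l1 [l2 ->]].
    inversion ND as [|? ? Ha ND']; subst.
    rewrite (sum_over_Permutation (l1 ++ a :: l2) (a :: l1 ++ l2)).
    2:{ symmetry; apply Permutation_middle. }
    rewrite !sum_over_cons; apply Rplus_le_compat_l, IH; [exact ND'| |].
    + intros x Hx; assert (Hx' := I x (in_cons _ _ _ Hx)).
      rewrite in_app_iff in *; destruct Hx' as [|[->|]]; tauto.
    + intros x Hx; apply P; rewrite in_app_iff in *; simpl; tauto.
Qed.

Lemma sum_over_term_le l f a :
  In a l -> (forall x, In x l -> 0 <= f x) -> f a <= sum_over l f.
Proof.
  intros Ha P; replace (f a) with (sum_over (a :: nil) f) by (unfold sum_over; simpl; ring).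
  apply sum_over_incl; [constructor; [easy|constructor]| |exact P].
  now intros x [<-|[]].
Qed.

Lemma sum_over_filter l (b : nat -> bool) f :
  sum_over (filter b l) f = sum_over l (fun x => if b x then f x else 0).
Proof.
  induction l as [|a l IH]; [reflexivity|]; simpl filter.
  destruct (b a) eqn:E; rewrite !sum_over_cons, E, ?sum_over_cons, IH; ring.
Qed.

Lemma sum_over_inj_le l l' (k : nat -> nat) f :
  NoDup l -> (forall x y, In x l -> In y l -> k x = k y -> x = y) ->
  (forall x, In x l -> In (k x) l') -> (forall x, In x l' -> 0 <= f x) ->
  sum_over l (fun x => f (k x)) <= sum_over l' f.
Proof.
  intros ND inj I P; rewrite <- sum_over_map; apply sum_over_incl; [| |exact P].
  - apply NoDup_map_NoDup_ForallPairs; [|exact ND].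
    intros x y Hx Hy; apply inj; assumption.
  - intros y Hy; apply in_map_iff in Hy; destruct Hy as [x [<- Hx]]; auto.
Qed.

Lemma Cauchy_Schwarz_sum l f g :
  (sum_over l (fun x => f x * g x)) ^ 2 <=
  sum_over l (fun x => f x ^ 2) * sum_over l (fun x => g x ^ 2).
Proof.
  set (A := sum_over l (fun x => f x ^ 2)); set (B := sum_over l (fun x => f x * g x)).
  set (D := sum_over l (fun x => g x ^ 2)).
  assert (Q : forall t, 0 <= A + 2 * t * B + t ^ 2 * D).
  { intros t; replace (A + 2 * t * B + t ^ 2 * D) with
      (sum_over l (fun x => (f x + t * g x) ^ 2)).
    - apply sum_over_ge0; intros; apply pow2_ge_0.
    - unfold A, B, D; rewrite <- !sum_over_scal, <- !sum_over_plus.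
      apply sum_over_ext; intros; ring. }
  assert (D0 : 0 <= D) by (apply sum_over_ge0; intros; apply pow2_ge_0).
  assert (A0 : 0 <= A) by (apply sum_over_ge0; intros; apply pow2_ge_0).
  destruct (Req_dec D 0) as [E|E].
  - assert (H1 := Q (- (A + 1) / (2 * B))).
    destruct (Req_dec B 0) as [Z|Z]; [rewrite Z, E; nra|].
    exfalso; rewrite E in H1.
    replace (A + 2 * (- (A + 1) / (2 * B)) * B + (- (A + 1) / (2 * B)) ^ 2 * 0)
      with (- (1)) in H1 by (field; exact Z); lra.
  - assert (H1 := Q (- B / D)).
    replace (A + 2 * (- B / D) * B + (- B / D) ^ 2 * D) with ((A * D - B ^ 2) / D) in H1
      by (field; exact E).
    assert (H2 : 0 <= (A * D - B ^ 2) / D * D) by (apply Rmult_le_pos; assumption).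
    replace ((A * D - B ^ 2) / D * D) with (A * D - B ^ 2) in H2 by (field; exact E); lra.
Qed.

Lemma Cauchy_Schwarz_sqrt l f g :
  sum_over l (fun x => f x * g x) <=
  sqrt (sum_over l (fun x => f x ^ 2)) * sqrt (sum_over l (fun x => g x ^ 2)).
Proof.
  rewrite <- sqrt_mult_alt by (apply sum_over_ge0; intros; apply pow2_ge_0).
  eapply Rle_trans; [apply Rle_abs|].
  rewrite <- sqrt_Rsqr_abs, Rsqr_pow2; apply sqrt_le_1_alt, Cauchy_Schwarz_sum.
Qed.

Lemma sqrt_sum_squares_le l f :
  (forall x, In x l -> 0 <= f x) -> sqrt (sum_over l (fun x => f x ^ 2)) <= sum_over l f.
Proof.
  intros P.
  assert (H : 0 <= sum_over l f /\ sum_over l (fun x => f x ^ 2) <= sum_over l f ^ 2).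
  { induction l as [|a l IH]; [unfold sum_over; simpl; split; lra|].
    rewrite !sum_over_cons.
    assert (Pa := P a (in_eq _ _)).
    destruct IH as [I1 I2]; [intros; apply P; now right|].
    split; [lra|nra]. }
  rewrite <- (sqrt_pow2 (sum_over l f)) by apply H; now apply sqrt_le_1_alt.
Qed.

Lemma sum_over_fibres l (c : nat -> nat) P f :
  (forall x, In x l -> (c x < P)%nat) ->
  sum_over (seq 0 P) (fun j => sum_over l (fun x => if Nat.eqb (c x) j then f x else 0)) =
  sum_over l f.
Proof.
  intros H; rewrite sum_over_swap; apply sum_over_ext; intros x Hx.
  specialize (H x Hx).
  destruct (in_split (c x) (seq 0 P)) as [l1 [l2 E]]; [apply in_seq; lia|].
  assert (ND := seq_NoDup P 0); rewrite E in ND |- *.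
  apply NoDup_remove_2 in ND; rewrite in_app_iff in ND.
  rewrite sum_over_app, sum_over_cons, Nat.eqb_refl.
  assert (Z : forall l', ~ In (c x) l' ->
     sum_over l' (fun j => if Nat.eqb (c x) j then f x else 0) = 0).
  { intros l' N; apply sum_over_eq0; intros j Hj.
    destruct (Nat.eqb_spec (c x) j) as [E2|]; [subst j; contradiction|reflexivity]. }
  rewrite !Z by tauto; ring.
Qed.

(** * Divisors *)

Lemma in_divisors n d : (1 <= n)%nat -> In d (divisors n) <-> Nat.divide d n.
Proof.
  intros Hn; unfold divisors; rewrite filter_In, in_seq, Nat.eqb_eq; split.
  - intros [H E]; apply Nat.mod_divide in E; [exact E|lia].
  - intros H; assert (d <= n)%nat by (apply Nat.divide_pos_le; [lia|exact H]).
    assert (d <> 0%nat) by (intros ->; destruct H; lia).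
    split; [lia|]; apply Nat.mod_divide; assumption.
Qed.

Lemma divisors_pos n d : In d (divisors n) -> (1 <= d)%nat.
Proof. unfold divisors; rewrite filter_In, in_seq; lia. Qed.

Lemma NoDup_divisors n : NoDup (divisors n).
Proof. apply NoDup_filter, seq_NoDup. Qed.

Lemma in_divisors_div n d :
  (1 <= n)%nat -> In d (divisors n) -> In (n / d)%nat (divisors n).
Proof.
  intros Hn Hd; assert (d1 := divisors_pos _ _ Hd); rewrite in_divisors in * by assumption.
  destruct Hd as [k E]; exists d; rewrite E, Nat.div_mul by lia; lia.
Qed.

Lemma divisor_mul_div n d : (1 <= n)%nat -> In d (divisors n) -> (d * (n / d) = n)%nat.
Proof.
  intros Hn Hd; assert (d1 := divisors_pos _ _ Hd); rewrite in_divisors in * by assumption.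
  destruct Hd as [k E]; rewrite E, Nat.div_mul by lia; lia.
Qed.

Lemma incl_divisors m n : (1 <= n)%nat -> Nat.divide m n -> incl (divisors m) (divisors n).
Proof.
  intros Hn H d Hd.
  assert (1 <= m)%nat by (destruct m; [destruct H; lia|lia]).
  rewrite in_divisors in * by assumption; eauto using Nat.divide_trans.
Qed.

(** A range of summation independent of [n] allows an exchange with a sum over [n]. *)
Lemma sum_divisors_seq n N f : (1 <= n <= N)%nat ->
  sum_over (divisors n) f =
  sum_over (seq 1 N) (fun m => if Nat.eqb (Nat.modulo n m) 0 then f m else 0).
Proof.
  intros H; unfold divisors; rewrite sum_over_filter.
  replace N with (n + (N - n))%nat by lia; rewrite seq_app, sum_over_app.
  assert (Z : sum_over (seq (1 + n) (N - n))
     (fun m => if Nat.eqb (Nat.modulo n m) 0 then f m else 0) = 0).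
  { apply sum_over_eq0; intros m Hm; apply in_seq in Hm.
    rewrite Nat.mod_small by lia; destruct (Nat.eqb_spec n 0); [lia|reflexivity]. }
  rewrite Z; ring.
Qed.

(** * Positive kernels *)

Definition cis (x : R) : C := (cos x, sin x).

Lemma Cmod_cis x : Cmod (cis x) = 1.
Proof.
  unfold cis, Cmod; simpl; rewrite !Rmult_1_r.
  assert (H := sin2_cos2 x); unfold Rsqr in H; rewrite Rplus_comm, H; apply sqrt_1.
Qed.

Lemma cis_plus x y : cis (x + y) = (cis x * cis y)%C.
Proof. unfold cis, Cmult; simpl; rewrite cos_plus, sin_plus; f_equal; ring. Qed.

Definition csum (l : list nat) (f : nat -> C) : C :=
  (sum_over l (fun x => Re (f x)), sum_over l (fun x => Im (f x))).

Lemma csum_cons a l f : csum (a :: l) f = (f a + csum l f)%C.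
Proof. apply injective_projections; reflexivity. Qed.

Lemma csum_ext l f g : (forall x, f x = g x) -> csum l f = csum l g.
Proof.
  intros H; unfold csum; f_equal; apply sum_over_ext; intros; now rewrite H.
Qed.

Lemma csum_scal a l g : (a * csum l g)%C = csum l (fun y => a * g y)%C.
Proof.
  induction l as [|b l IH].
  - unfold csum, sum_over; simpl; apply injective_projections; simpl; ring.
  - rewrite !csum_cons, <- IH; ring.
Qed.

Lemma csum_mult l l' f g :
  (csum l f * csum l' g)%C = csum l (fun x => csum l' (fun y => f x * g y)%C).
Proof.
  induction l as [|b l IH].
  - unfold csum, sum_over; simpl; apply injective_projections; simpl; ring.
  - rewrite !csum_cons, <- IH, <- csum_scal; ring.
Qed.

Lemma Cmod_csum_le l f : Cmod (csum l f) <= sum_over l (fun x => Cmod (f x)).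
Proof.
  induction l as [|a l IH].
  - unfold csum, sum_over; simpl; change (Cmod 0 <= 0); rewrite Cmod_0; lra.
  - rewrite csum_cons, sum_over_cons; eapply Rle_trans; [apply Cmod_triangle|lra].
Qed.

(** Truncated subtraction makes one of the summands zero. The cosine being even, this absolute
    difference can replace a - b as a frequency. *)
Definition dist (a b : nat) : nat := ((a - b) + (b - a))%nat.

Lemma cos_dist a b x : cos (INR (dist a b) * x) = cos (INR a * x - INR b * x).
Proof.
  unfold dist; destruct (Nat.le_ge_cases a b) as [H|H].
  - replace (a - b + (b - a))%nat with (b - a)%nat by lia.
    rewrite minus_INR, <- cos_neg by assumption; f_equal; ring.
  - replace (a - b + (b - a))%nat with (a - b)%nat by lia.
    rewrite minus_INR by assumption; f_equal; ring.
Qed.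

(* [|\sum_(l < L) exp (i l x)|^2], expanded with nonnegative frequencies only. *)
Definition fejer (L : nat) (x : R) : R :=
  sum_over (seq 0 L) (fun a => sum_over (seq 0 L) (fun b => cos (INR (dist a b) * x))).

Lemma fejer_square L x :
  fejer L x = sum_over (seq 0 L) (fun a => cos (INR a * x)) ^ 2 +
              sum_over (seq 0 L) (fun a => sin (INR a * x)) ^ 2.
Proof.
  unfold fejer; simpl; rewrite !Rmult_1_r, !sum_over_mult, <- sum_over_plus.
  apply sum_over_ext; intros a _; rewrite <- sum_over_plus.
  apply sum_over_ext; intros b _; rewrite cos_dist; apply cos_minus.
Qed.

Lemma fejer_ge0 L x : 0 <= fejer L x.
Proof.
  rewrite fejer_square.
  assert (H := pow2_ge_0 (sum_over (seq 0 L) (fun a => cos (INR a * x)))).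
  assert (K := pow2_ge_0 (sum_over (seq 0 L) (fun a => sin (INR a * x)))); lra.
Qed.

Lemma cos_ge_half x : Rabs x <= 1 -> 1 / 2 <= cos x.
Proof.
  intros H; apply Rabs_le_between in H.
  assert (P : 3 < PI) by (assert (Q := PI2_3_2); unfold PI2 in Q; lra).
  replace (1 / 2) with (cos (PI / 3)) by (rewrite cos_PI3; reflexivity).
  destruct (Rle_dec 0 x).
  - apply cos_decr_1; lra.
  - rewrite <- (cos_neg x); apply cos_decr_1; lra.
Qed.

(** All phases a d with a < L stay in [-1, 1], where the cosine is at least 1/2, so the cosine sum
    alone reaches L/2. Multiples of 2 pi appear on both sides because [q] and [q'] are natural
    numbers. *)
Lemma fejer_large L x d (q q' : nat) :
  x + 2 * INR q * PI = d + 2 * INR q' * PI -> INR L * Rabs d <= 1 ->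
  INR L ^ 2 / 4 <= fejer L x.
Proof.
  intros E Hd.
  assert (H : INR L * (1 / 2) <= sum_over (seq 0 L) (fun a => cos (INR a * x))).
  { apply Rle_trans with (sum_over (seq 0 L) (fun _ => 1 / 2));
      [rewrite sum_over_const, length_seq; lra|].
    apply sum_over_le; intros a Ha; apply in_seq in Ha.
    replace (cos (INR a * x)) with (cos (INR a * d)).
    - apply cos_ge_half; rewrite Rabs_mult, (Rabs_right (INR a)) by (apply Rle_ge, pos_INR).
      assert (INR a <= INR L) by (apply le_INR; lia).
      assert (Z := Rabs_pos d); nra.
    - rewrite <- (cos_period _ (a * q')), <- (cos_period (INR a * x) (a * q)).
      f_equal; rewrite !mult_INR.
      transitivity (INR a * (d + 2 * INR q' * PI)); [ring|rewrite <- E; ring]. }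
  assert (P := pos_INR L).
  assert (K := pow2_ge_0 (sum_over (seq 0 L) (fun a => sin (INR a * x)))).
  rewrite fejer_square; simpl in *; nra.
Qed.

(** For fixed [a] a positive distance is attained by at most one [b] on either side, and distance 0
    only by [a] itself. *)
Lemma sum_dist_le (L : nat) (Z : nat -> R) : (forall d, 0 <= Z d) ->
  sum_over (seq 0 L) (fun a => sum_over (seq 0 L) (fun b => Z (dist a b))) <=
  INR L * (Z 0%nat + 2 * sum_over (seq 1 (L - 1)) Z).
Proof.
  intros P; set (K := Z 0%nat + 2 * sum_over (seq 1 (L - 1)) Z).
  apply Rle_trans with (sum_over (seq 0 L) (fun _ => K));
    [|rewrite sum_over_const, length_seq; lra].
  unfold K; clear K.
  apply sum_over_le; intros a Ha; apply in_seq in Ha.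
  assert (A1 : sum_over (filter (fun b => Nat.ltb b a) (seq 0 L)) (fun b => Z (dist a b)) <=
     sum_over (seq 1 (L - 1)) Z).
  { apply (sum_over_inj_le _ _ (dist a)); [apply NoDup_filter, seq_NoDup| | |auto].
    - intros x y; rewrite !filter_In, !Nat.ltb_lt; unfold dist; lia.
    - intros x; rewrite filter_In, Nat.ltb_lt, !in_seq; unfold dist; lia. }
  assert (A2 : sum_over (filter (fun b => Nat.ltb a b) (seq 0 L)) (fun b => Z (dist a b)) <=
     sum_over (seq 1 (L - 1)) Z).
  { apply (sum_over_inj_le _ _ (dist a)); [apply NoDup_filter, seq_NoDup| | |auto].
    - intros x y; rewrite !filter_In, !Nat.ltb_lt; unfold dist; lia.
    - intros x; rewrite filter_In, Nat.ltb_lt, !in_seq; unfold dist; lia. }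
  assert (A3 : sum_over (filter (fun b => Nat.eqb b a) (seq 0 L)) (fun b => Z (dist a b)) <= Z 0%nat).
  { replace (Z 0%nat) with (sum_over (0%nat :: nil) Z) by (unfold sum_over; simpl; ring).
    apply (sum_over_inj_le _ _ (dist a)); [apply NoDup_filter, seq_NoDup| | |auto].
    - intros x y; rewrite !filter_In, !Nat.eqb_eq; lia.
    - intros x; rewrite filter_In, Nat.eqb_eq; unfold dist; intros [_ ->]; left; lia. }
  rewrite !sum_over_filter in *.
  rewrite (sum_over_ext _ (fun b => Z (dist a b)) (fun b =>
     (if Nat.ltb b a then Z (dist a b) else 0) +
     ((if Nat.ltb a b then Z (dist a b) else 0) +
      (if Nat.eqb b a then Z (dist a b) else 0)))).
  - rewrite !sum_over_plus; lra.
  - intros b _; destruct (Nat.ltb_spec b a), (Nat.ltb_spec a b), (Nat.eqb_spec b a);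
      try lia; ring.
Qed.

Lemma sum_cos_geometric n x :
  2 * sin (x / 2) * sum_over (seq 0 n) (fun d => cos (INR d * x)) =
  sin (INR n * x - x / 2) + sin (x / 2).
Proof.
  induction n as [|n IH].
  - unfold sum_over; simpl; replace (0 * x - x / 2) with (- (x / 2)) by field.
    rewrite sin_neg; ring.
  - rewrite seq_S, sum_over_app, Rmult_plus_distr_l, IH, sum_over_cons, Nat.add_0_l.
    change (sum_over nil _) with 0.
    rewrite S_INR; replace ((INR n + 1) * x - x / 2) with (INR n * x + x / 2) by field.
    rewrite sin_plus, sin_minus; ring.
Qed.

Lemma sum_cos_orthogonal P a b : (a < P)%nat -> (b < P)%nat ->
  sum_over (seq 0 P) (fun d => cos (INR d * (2 * PI * INR a / INR P - 2 * PI * INR b / INR P))) =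
  if Nat.eqb a b then INR P else 0.
Proof.
  assert (W : forall a b, (b < a < P)%nat ->
    sum_over (seq 0 P) (fun d => cos (INR d * (2 * PI * INR a / INR P - 2 * PI * INR b / INR P))) = 0).
  { clear a b; intros a b H.
    assert (P0 : 0 < INR P) by (apply lt_0_INR; lia).
    set (x := 2 * PI * INR a / INR P - 2 * PI * INR b / INR P).
    assert (E := sum_cos_geometric P x).
    assert (Ex : x / 2 = PI * INR (a - b) / INR P).
    { unfold x; rewrite minus_INR by lia; field; lra. }
    assert (PI0 := PI_RGT_0).
    assert (J : 0 < INR (a - b) < INR P) by (split; [apply lt_0_INR|apply lt_INR]; lia).
    assert (S0 : 0 < sin (x / 2)).
    { rewrite Ex; apply sin_gt_0.
      - apply Rdiv_lt_0_compat; nra.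
      - apply Rmult_lt_reg_r with (INR P); [exact P0|].
        unfold Rdiv; rewrite Rmult_assoc, Rinv_l by lra; nra. }
    replace (INR P * x - x / 2) with (- (x / 2) + 2 * INR (a - b) * PI) in E.
    2:{ replace x with (2 * (x / 2)) at 2 by field; rewrite Ex; field; lra. }
    rewrite sin_period, sin_neg in E; nra. }
  intros Ha Hb; destruct (Nat.eqb_spec a b) as [->|N].
  - rewrite (sum_over_ext _ _ (fun _ => 1)).
    + rewrite sum_over_const, length_seq; ring.
    + intros d _; rewrite Rminus_diag, Rmult_0_r; apply cos_0.
  - destruct (Nat.lt_ge_cases b a).
    + apply W; lia.
    + rewrite <- (W b a) by lia; apply sum_over_ext; intros d _.
      rewrite <- cos_neg; f_equal; ring.
Qed.

(** The sign [e] lets one statement serve both the resonator (-1) and the polynomial it is tested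
    against (1). *)
Lemma parseval P (r : nat -> R) (e : R) : e = 1 \/ e = -1 ->
  sum_over (seq 0 P) (fun d =>
    Cmod (csum (seq 0 P) (fun c => r c * cis (e * (INR d * (2 * PI * INR c / INR P))))%C) ^ 2) =
  INR P * sum_over (seq 0 P) (fun c => r c ^ 2).
Proof.
  intros He.
  rewrite (sum_over_ext _ _ (fun d => sum_over (seq 0 P) (fun a => sum_over (seq 0 P) (fun b =>
     r a * r b * cos (INR d * (2 * PI * INR a / INR P - 2 * PI * INR b / INR P)))))).
  - rewrite sum_over_swap, <- sum_over_scal; apply sum_over_ext; intros a Ha.
    apply in_seq in Ha; rewrite sum_over_swap.
    rewrite (sum_over_ext _ _ (fun b => if Nat.eqb a b then r b ^ 2 * INR P else 0)).
    + assert (Hf := sum_over_fibres (a :: nil) (fun x => x) P (fun x => r x ^ 2 * INR P)).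
      rewrite sum_over_cons in Hf; change (sum_over nil _) with 0 in Hf.
      transitivity (r a ^ 2 * INR P + 0); [|ring].
      rewrite <- Hf by (intros x [<-|[]]; lia).
      apply sum_over_ext; intros b _; rewrite sum_over_cons; change (sum_over nil _) with 0.
      destruct (Nat.eqb_spec a b) as [->|]; ring.
    + intros b Hb; apply in_seq in Hb; rewrite sum_over_scal, sum_cos_orthogonal by lia.
      destruct (Nat.eqb_spec a b) as [->|]; ring.
  - intros d _; unfold Cmod, csum; simpl fst; simpl snd.
    rewrite pow2_sqrt.
    2:{ apply Rplus_le_le_0_compat; apply pow2_ge_0. }
    simpl pow; rewrite !Rmult_1_r, !sum_over_mult, <- sum_over_plus.
    apply sum_over_ext; intros a _; rewrite <- sum_over_plus.
    apply sum_over_ext; intros b _; unfold cis, Re, Im; simpl.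
    set (A := INR d * (2 * PI * INR a / INR P)); set (B := INR d * (2 * PI * INR b / INR P)).
    replace (INR d * (2 * PI * INR a / INR P - 2 * PI * INR b / INR P)) with (A - B)
      by (unfold A, B; ring).
    rewrite cos_minus.
    destruct He as [-> | ->].
    + rewrite !Rmult_1_l; ring.
    + replace (-1 * A) with (- A) by ring; replace (-1 * B) with (- B) by ring.
      rewrite !cos_neg, !sin_neg; ring.
Qed.

(** * The resonance inequality *)

Definition cell_norm (nu : nat) (cell : nat -> nat) (r : nat -> R) (c : nat) : R :=
  sqrt (sum_over (divisors nu) (fun n => if Nat.eqb (cell n) c then r n ^ 2 else 0)).

(* The [n]-th coefficient of [\sum_(m <= N) w(m) m^(-s)] times the Dirichlet polynomial of [r]. *)
Definition conv (N : nat) (w r : nat -> R) (n : nat) : R :=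
  sum_over (seq 1 N) (fun m => if Nat.eqb (n mod m) 0 then w m * r (n / m)%nat else 0).

Lemma cell_norm_ge0 nu cell r c : 0 <= cell_norm nu cell r c.
Proof. apply sqrt_pos. Qed.

Lemma sum_cell_norm_le nu cell r P :
  (forall n, (cell n < P)%nat) -> (forall n, 0 <= r n) ->
  sum_over (seq 0 P) (cell_norm nu cell r) <= sum_over (divisors nu) r.
Proof.
  intros Hc Hr; rewrite <- (sum_over_fibres (divisors nu) cell P) by auto.
  apply sum_over_le; intros c _; unfold cell_norm.
  rewrite (sum_over_ext _ _ (fun n => (if Nat.eqb (cell n) c then r n else 0) ^ 2)).
  - apply sqrt_sum_squares_le; intros n _; destruct (Nat.eqb _ _); [apply Hr|lra].
  - intros n _; destruct (Nat.eqb _ _); ring.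
Qed.

Lemma sum_cell_norm_sq nu cell r P :
  (forall n, (cell n < P)%nat) ->
  sum_over (seq 0 P) (fun c => cell_norm nu cell r c ^ 2) =
  sum_over (divisors nu) (fun n => r n ^ 2).
Proof.
  intros Hc; rewrite <- (sum_over_fibres (divisors nu) cell P) by auto.
  apply sum_over_ext; intros c _; unfold cell_norm; rewrite pow2_sqrt; [reflexivity|].
  apply sum_over_ge0; intros n _; destruct (Nat.eqb _ _); [apply pow2_ge_0|lra].
Qed.

(** This is why a cell carries the l^2 norm of its coefficients: by Cauchy-Schwarz the correlation
    of r(k) and s(mk) between two cells is at most the product of their norms, since n -> n/m is
    injective on the multiples of [m]. *)
Lemma linked_cells_le nu cell r s m c c' : (1 <= nu)%nat -> (1 <= m)%nat ->
  sum_over (divisors nu) (fun n =>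
     (if (Nat.eqb (n mod m) 0 && Nat.eqb (cell (n / m)%nat) c)%bool then r (n / m)%nat else 0) *
     (if Nat.eqb (cell n) c' then s n else 0)) <=
  cell_norm nu cell r c * cell_norm nu cell s c'.
Proof.
  intros Hnu Hm; eapply Rle_trans; [apply Cauchy_Schwarz_sqrt|].
  apply Rmult_le_compat; [apply sqrt_pos|apply sqrt_pos| |]; apply sqrt_le_1_alt.
  - rewrite (sum_over_ext _ _ (fun n => if Nat.eqb (n mod m) 0 then
       (if Nat.eqb (cell (n / m)%nat) c then r (n / m)%nat ^ 2 else 0) else 0)).
    2:{ intros n _; destruct (Nat.eqb (n mod m) 0), (Nat.eqb (cell _) c); simpl; ring. }
    rewrite <- sum_over_filter.
    apply (sum_over_inj_le _ _ (fun n => n / m)%nat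
             (fun k => if Nat.eqb (cell k) c then r k ^ 2 else 0)).
    + apply NoDup_filter, NoDup_divisors.
    + intros x y; rewrite !filter_In, !Nat.eqb_eq; intros [_ Hx] [_ Hy] E.
      rewrite (Nat.div_mod_eq x m), (Nat.div_mod_eq y m), Hx, Hy, E; reflexivity.
    + intros x; rewrite filter_In, Nat.eqb_eq; intros [Hx Ex].
      assert (E := Nat.div_mod_eq x m); rewrite Ex in E.
      rewrite in_divisors in * by exact Hnu.
      apply Nat.divide_trans with x; [exists m; lia|exact Hx].
    + intros x _; destruct (Nat.eqb _ _); [apply pow2_ge_0|lra].
  - apply sum_over_le; intros n _; destruct (Nat.eqb _ _); lra.
Qed.

(* Divisors in a common cell have nearly equal phases modulo [2 pi], so that the kernel is large
   at every pair of cells linked by a multiplication by [m]; at the other pairs it is at least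
   nonnegative. *)
Lemma resonance_kernel nu N L P (w r s alpha : nat -> R) (cell : nat -> nat) :
  (1 <= nu)%nat -> (1 <= P)%nat -> INR L * (2 * PI) <= INR P ->
  (forall m, 0 <= w m) -> (forall n, 0 <= r n) -> (forall n, 0 <= s n) ->
  (forall n, (cell n < P)%nat) ->
  (forall n, (1 <= n)%nat -> exists q d, 0 <= d < 2 * PI / INR P /\
     alpha n = 2 * PI * INR (cell n) / INR P + 2 * INR q * PI + d) ->
  (forall m n, (1 <= m)%nat -> (1 <= n)%nat -> alpha (m * n)%nat = alpha m + alpha n) ->
  INR L ^ 2 / 4 * sum_over (divisors nu) (fun n => conv N w r n * s n) <=
  sum_over (seq 1 N) (fun m => sum_over (seq 0 P) (fun c => sum_over (seq 0 P) (fun c' =>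
     w m * cell_norm nu cell r c * cell_norm nu cell s c' *
     fejer L (alpha m + 2 * PI * INR c / INR P - 2 * PI * INR c' / INR P)))).
Proof.
  intros Hnu HP HL w0 r0 s0 Hc Hphase Hadd.
  assert (P0 : 0 < INR P) by (apply lt_0_INR; lia).
  unfold conv.
  rewrite (sum_over_ext _ _ (fun n => sum_over (seq 1 N) (fun m =>
     (if Nat.eqb (n mod m) 0 then w m * r (n / m)%nat else 0) * s n))).
  2:{ intros n _; now rewrite sum_over_scal_r. }
  rewrite sum_over_swap, <- sum_over_scal; apply sum_over_le; intros m Hm.
  apply in_seq in Hm; assert (m1 : (1 <= m)%nat) by lia.
  rewrite <- (sum_over_fibres (divisors nu) (fun n => cell (n / m)%nat) P) by auto.
  rewrite <- sum_over_scal; apply sum_over_le; intros c Hcc; apply in_seq in Hcc.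
  rewrite <- (sum_over_fibres (divisors nu) cell P) by auto.
  rewrite <- sum_over_scal; apply sum_over_le; intros c' Hcc'; apply in_seq in Hcc'.
  set (x := alpha m + 2 * PI * INR c / INR P - 2 * PI * INR c' / INR P).
  assert (LK := linked_cells_le nu cell r s m c c' Hnu m1).
  set (A := sum_over _ _) in LK.
  replace (sum_over _ _) with (w m * A).
  2:{ unfold A; rewrite <- sum_over_scal; apply sum_over_ext; intros n _.
      destruct (Nat.eqb (n mod m) 0), (Nat.eqb (cell (n / m)%nat) c), (Nat.eqb (cell n) c');
        simpl; ring. }
  assert (wm := w0 m).
  assert (B0 : 0 <= w m * cell_norm nu cell r c * cell_norm nu cell s c').
  { repeat apply Rmult_le_pos; trivial; apply cell_norm_ge0. }
  destruct (classic (exists n, In n (divisors nu) /\ Nat.modulo n m = 0%nat /\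
     cell (n / m)%nat = c /\ cell n = c')) as [[n [Hn [E1 [E2 E3]]]]|NE].
  - assert (n1 := divisors_pos _ _ Hn).
    assert (E := Nat.div_mod_eq n m); rewrite E1, Nat.add_0_r in E.
    assert (k1 : (1 <= n / m)%nat) by (destruct (n / m)%nat; lia).
    destruct (Hphase n n1) as [q [d [Hd Ed]]].
    destruct (Hphase (n / m)%nat k1) as [q' [d' [Hd' Ed']]].
    rewrite E3 in Ed; rewrite E2 in Ed'.
    assert (Es := Hadd m (n / m)%nat m1 k1); rewrite <- E in Es.
    assert (F : INR L ^ 2 / 4 <= fejer L x).
    { apply (fejer_large L x (d - d') q' q).
      - unfold x; lra.
      - assert (L0 := pos_INR L).
        assert (Rabs (d - d') <= 2 * PI / INR P) by (apply Rabs_le; lra).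
        apply Rle_trans with (INR L * (2 * PI / INR P)).
        + apply Rmult_le_compat_l; assumption.
        + apply Rmult_le_reg_r with (INR P); [exact P0|].
          replace (INR L * (2 * PI / INR P) * INR P) with (INR L * (2 * PI)) by (field; lra); lra. }
    apply Rle_trans with (w m * cell_norm nu cell r c * cell_norm nu cell s c' * (INR L ^ 2 / 4)).
    + replace (INR L ^ 2 / 4 * (w m * A)) with (w m * A * (INR L ^ 2 / 4)) by ring.
      apply Rmult_le_compat_r; [assert (Z := pow2_ge_0 (INR L)); lra|].
      rewrite Rmult_assoc; apply Rmult_le_compat_l; assumption.
    + apply Rmult_le_compat_l; assumption.
  - replace A with 0.
    + rewrite !Rmult_0_r; apply Rmult_le_pos; [exact B0|apply fejer_ge0].
    + symmetry; apply sum_over_eq0; intros n Hn.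
      destruct (Nat.eqb_spec (n mod m) 0), (Nat.eqb_spec (cell (n / m)%nat) c),
        (Nat.eqb_spec (cell n) c'); simpl; try ring.
      exfalso; apply NE; now exists n.
Qed.

(** At each frequency d = |a - b| of the kernel the triple sum factors as the real part of D(d) F(d)
    S(d), which is at most the product of the moduli; [sum_dist_le] then collects equal
    frequencies. *)
Lemma kernel_expand N L P (w r s alpha : nat -> R) :
  (forall m, 0 <= w m) -> (forall n, 0 <= r n) -> (forall n, 0 <= s n) ->
  let D d := csum (seq 1 N) (fun m => w m * cis (- (INR d * alpha m)))%C in
  let F d := csum (seq 0 P) (fun c => r c * cis (-1 * (INR d * (2 * PI * INR c / INR P))))%C in
  let S d := csum (seq 0 P) (fun c => s c * cis (1 * (INR d * (2 * PI * INR c / INR P))))%C in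
  let Z d := Cmod (D d) * Cmod (F d) * Cmod (S d) in
  sum_over (seq 1 N) (fun m => sum_over (seq 0 P) (fun c => sum_over (seq 0 P) (fun c' =>
     w m * r c * s c' *
     fejer L (alpha m + 2 * PI * INR c / INR P - 2 * PI * INR c' / INR P)))) <=
  INR L * (Z 0%nat + 2 * sum_over (seq 1 (L - 1)) Z).
Proof.
  intros w0 r0 s0 D F S Z.
  eapply Rle_trans; [|apply sum_dist_le].
  2:{ intros d; unfold Z; repeat apply Rmult_le_pos; apply Cmod_ge_0. }
  assert (EZ : forall d, sum_over (seq 1 N) (fun m => sum_over (seq 0 P) (fun c =>
     sum_over (seq 0 P) (fun c' => w m * r c * s c' *
     cos (INR d * (alpha m + 2 * PI * INR c / INR P - 2 * PI * INR c' / INR P))))) <= Z d).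
  { intros d; apply Rle_trans with (Re (D d * (F d * S d))%C).
    - right; unfold D, F, S; rewrite csum_mult, csum_mult.
      apply sum_over_ext; intros m _; apply sum_over_ext; intros c _.
      rewrite csum_scal; apply sum_over_ext; intros c' _.
      replace (INR d * (alpha m + 2 * PI * INR c / INR P - 2 * PI * INR c' / INR P)) with
        (- (- (INR d * alpha m) + -1 * (INR d * (2 * PI * INR c / INR P)) +
            1 * (INR d * (2 * PI * INR c' / INR P)))) by (unfold Rdiv; ring).
      rewrite cos_neg.
      set (u := - (INR d * alpha m)); set (v := -1 * _); set (x := 1 * _).
      replace (RtoC (w m) * cis u * (RtoC (r c) * cis v * (RtoC (s c') * cis x)))%C with
        (RtoC (w m * r c * s c') * cis (u + v + x))%C.
      2:{ rewrite !cis_plus, !RtoC_mult; ring. }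
      rewrite re_scal_l; reflexivity.
    - eapply Rle_trans; [apply Rle_abs|]; eapply Rle_trans; [apply re_le_Cmod|].
      unfold Z; rewrite !Cmod_mult; lra. }
  apply Rle_trans with (sum_over (seq 0 L) (fun a => sum_over (seq 0 L) (fun b =>
    sum_over (seq 1 N) (fun m => sum_over (seq 0 P) (fun c =>
     sum_over (seq 0 P) (fun c' => w m * r c * s c' * cos (INR (dist a b) *
       (alpha m + 2 * PI * INR c / INR P - 2 * PI * INR c' / INR P)))))))).
  2:{ do 2 (apply sum_over_le; intros); apply EZ. }
  right; unfold fejer.
  transitivity (sum_over (seq 1 N) (fun m => sum_over (seq 0 P) (fun c =>
    sum_over (seq 0 P) (fun c' => sum_over (seq 0 L) (fun a => sum_over (seq 0 L) (fun b =>
     w m * r c * s c' * cos (INR (dist a b) *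
       (alpha m + 2 * PI * INR c / INR P - 2 * PI * INR c' / INR P)))))))).
  - do 3 (apply sum_over_ext; intros); rewrite <- sum_over_scal.
    apply sum_over_ext; intros; now rewrite <- sum_over_scal.
  - symmetry.
    erewrite sum_over_ext; [|intros; apply sum_over_swap].
    rewrite sum_over_swap; apply sum_over_ext; intros m _.
    erewrite sum_over_ext.
    2:{ intros; erewrite sum_over_ext; [apply sum_over_swap|intros; reflexivity]. }
    rewrite sum_over_swap; apply sum_over_ext; intros c _.
    erewrite sum_over_ext.
    2:{ intros; erewrite sum_over_ext; [apply sum_over_swap|intros; reflexivity]. }
    rewrite sum_over_swap; reflexivity.
Qed.

(** The cells are the [P] arcs of the circle. The integer part of P alpha / (2 pi) is divided by
    [P]: the quotient counts full turns and the remainder is the cell. *)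
Lemma exists_cells (alpha : nat -> R) P : (1 <= P)%nat ->
  (forall n, (1 <= n)%nat -> 0 <= alpha n) ->
  exists cell : nat -> nat, (forall n, (cell n < P)%nat) /\
  forall n, (1 <= n)%nat -> exists q d, 0 <= d < 2 * PI / INR P /\
     alpha n = 2 * PI * INR (cell n) / INR P + 2 * INR q * PI + d.
Proof.
  intros HP Ha.
  assert (P0 : 0 < INR P) by (apply lt_0_INR; lia).
  assert (PI0 := PI_RGT_0).
  set (u := fun n => alpha n * INR P / (2 * PI)).
  exists (fun n => Nat.modulo (Z.to_nat (Int_part (u n))) P); split.
  { intros n; apply Nat.mod_upper_bound; lia. }
  intros n Hn; assert (an := Ha n Hn).
  assert (u0 : 0 <= u n).
  { unfold u; apply Rmult_le_pos; [nra|left; apply Rinv_0_lt_compat; lra]. }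
  destruct (base_Int_part (u n)) as [B1 B2].
  assert (Z0 : (0 <= Int_part (u n))%Z).
  { assert (-1 < Int_part (u n))%Z; [|lia]. apply lt_IZR; lra. }
  set (j := Z.to_nat (Int_part (u n))).
  assert (Ej : INR j = IZR (Int_part (u n))).
  { unfold j; rewrite INR_IZR_INZ, Z2Nat.id; trivial. }
  rewrite <- Ej in B1, B2.
  exists (j / P)%nat, (2 * PI / INR P * (u n - INR j)); split.
  - assert (0 < 2 * PI / INR P) by (apply Rdiv_lt_0_compat; lra); split; nra.
  - assert (E := Nat.div_mod_eq j P).
    apply (f_equal INR) in E; rewrite plus_INR, mult_INR in E.
    replace (alpha n) with (2 * PI / INR P * u n) by (unfold u; field; lra).
    rewrite E; field; lra.
Qed.

Lemma conv_ge0 N w r n : (forall m, 0 <= w m) -> (forall k, 0 <= r k) -> 0 <= conv N w r n.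
Proof.
  intros w0 r0; apply sum_over_ge0; intros m _.
  destruct (Nat.eqb _ _); [apply Rmult_le_pos; auto|lra].
Qed.

Lemma Cmod_csum_cis_le l (r x : nat -> R) : (forall c, 0 <= r c) ->
  Cmod (csum l (fun c => r c * cis (x c))%C) <= sum_over l r.
Proof.
  intros r0; eapply Rle_trans; [apply Cmod_csum_le|right].
  apply sum_over_ext; intros c _.
  rewrite Cmod_mult, Cmod_cis, Cmod_R, Rabs_right; [ring|apply Rle_ge, r0].
Qed.

Lemma sum_seq_mono a b f : (a <= b)%nat -> (forall x, 0 <= f x) ->
  sum_over (seq 0 a) f <= sum_over (seq 0 b) f.
Proof.
  intros H P; apply sum_over_incl; [apply seq_NoDup| |auto].
  intros x; rewrite !in_seq; lia.
Qed.

(** The bound at the sample d tau is split into a uniform part [M], which Parseval weighs with the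
    l^2 norms, and an exceptional part E(d), weighed only with the l^1 norms. The latter is meant
    for the few samples near the pole. *)
Lemma resonance_discrete nu N L (w r : nat -> R) (tau M : R) (E : nat -> R) :
  (1 <= nu)%nat -> (1 <= L)%nat -> 0 <= tau -> 0 <= M ->
  (forall m, 0 <= w m) -> (forall n, 0 <= r n) -> (forall d, 0 <= E d) ->
  (forall d, (d < L)%nat ->
     Cmod (csum (seq 1 N) (fun m => w m * cis (- (INR d * (tau * ln (INR m)))))%C) <= M + E d) ->
  INR L / 4 * sum_over (divisors nu) (fun n => conv N w r n ^ 2) <=
  16 * INR L * M * (sqrt (sum_over (divisors nu) (fun n => r n ^ 2)) *
                    sqrt (sum_over (divisors nu) (fun n => conv N w r n ^ 2))) +
  2 * sum_over (seq 0 L) E *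
    (sum_over (divisors nu) r * sum_over (divisors nu) (conv N w r)).
Proof.
  intros Hnu HL Ht M0 w0 r0 E0 HD.
  set (s := conv N w r).
  assert (s0 : forall n, 0 <= s n) by (intros; now apply conv_ge0).
  (* As pi <= 4, eight cells per sample give 2 pi L <= P, the closeness of phases that the kernel
     needs; Parseval then costs a factor 8. *)
  set (P := (8 * L)%nat); assert (HP : (1 <= P)%nat) by (unfold P; lia).
  assert (L0 : 0 < INR L) by (apply lt_0_INR; lia).
  assert (EP : INR P = 8 * INR L) by (unfold P; rewrite mult_INR; simpl; ring).
  set (alpha := fun n => tau * ln (INR n)).
  destruct (exists_cells alpha P HP) as [cell [C1 C2]].
  { intros n Hn; apply Rmult_le_pos; [exact Ht|].
    rewrite <- ln_1; apply ln_le; [lra|].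
    change 1 with (INR 1); now apply le_INR. }
  assert (K1 := resonance_kernel nu N L P w r s alpha cell Hnu HP).
  assert (K2 := kernel_expand N L P w (cell_norm nu cell r) (cell_norm nu cell s) alpha
                  w0 (cell_norm_ge0 _ _ _) (cell_norm_ge0 _ _ _)).
  cbv zeta in K2.
  set (D := fun d => csum (seq 1 N) (fun m => w m * cis (- (INR d * alpha m)))%C) in *.
  set (F := fun d => csum (seq 0 P) (fun c => cell_norm nu cell r c * cis (-1 * (INR d * (2 * PI * INR c / INR P))))%C) in *.
  set (S := fun d => csum (seq 0 P) (fun c => cell_norm nu cell s c * cis (1 * (INR d * (2 * PI * INR c / INR P))))%C) in *.
  set (Z := fun d => Cmod (D d) * Cmod (F d) * Cmod (S d)) in *.
  assert (Z0 : forall d, 0 <= Z d).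
  { intros; unfold Z; repeat apply Rmult_le_pos; apply Cmod_ge_0. }
  assert (K : INR L ^ 2 / 4 * sum_over (divisors nu) (fun n => s n ^ 2) <=
              INR L * (2 * sum_over (seq 0 L) Z)).
  { eapply Rle_trans; [|eapply Rle_trans; [apply K1|eapply Rle_trans; [exact K2|]]]; trivial.
    - right; f_equal; apply sum_over_ext; intros; unfold s; ring.
    - assert (Q := PI_4); rewrite EP; nra.
    - intros m n Hm Hn; unfold alpha; rewrite mult_INR, ln_mult; [ring| |];
        apply lt_0_INR; lia.
    - apply Rmult_le_compat_l; [lra|].
      replace L with (1 + (L - 1))%nat at 2 by lia; rewrite seq_app, sum_over_app.
      change (sum_over (seq 0 1) Z) with (Z 0%nat + 0); simpl (0 + 1)%nat.
      assert (Q := Z0 0%nat); lra. }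
  assert (F1 : forall d, Cmod (F d) <= sum_over (divisors nu) r).
  { intros d; eapply Rle_trans; [apply Cmod_csum_cis_le, cell_norm_ge0|].
    now apply sum_cell_norm_le. }
  assert (S1 : forall d, Cmod (S d) <= sum_over (divisors nu) s).
  { intros d; eapply Rle_trans; [apply Cmod_csum_cis_le, cell_norm_ge0|].
    now apply sum_cell_norm_le. }
  (* By positivity the sum over the [L] samples is extended to all [P] characters, where Parseval is
     exact. *)
  assert (FS : sum_over (seq 0 L) (fun d => Cmod (F d) * Cmod (S d)) <=
     INR P * (sqrt (sum_over (divisors nu) (fun n => r n ^ 2)) *
              sqrt (sum_over (divisors nu) (fun n => s n ^ 2)))).
  { eapply Rle_trans; [apply (sum_seq_mono L P); [unfold P; lia|]|].
    { intros; apply Rmult_le_pos; apply Cmod_ge_0. }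
    eapply Rle_trans; [apply Cauchy_Schwarz_sqrt|].
    unfold F, S; rewrite (parseval P _ (-1)), (parseval P _ 1) by tauto.
    rewrite !(sum_cell_norm_sq _ _ _ P C1).
    assert (P0 := pos_INR P).
    rewrite !sqrt_mult_alt by exact P0.
    rewrite <- (sqrt_def (INR P)) at 3 by exact P0; right; ring. }
  assert (ZZ : sum_over (seq 0 L) Z <= M * sum_over (seq 0 L) (fun d => Cmod (F d) * Cmod (S d)) +
     sum_over (seq 0 L) E * (sum_over (divisors nu) r * sum_over (divisors nu) s)).
  { rewrite <- sum_over_scal, <- sum_over_scal_r, <- sum_over_plus.
    apply sum_over_le; intros d Hd; apply in_seq in Hd; unfold Z.
    assert (H1 := HD d ltac:(lia)); fold (D d) in H1.
    assert (H2 := F1 d); assert (H3 := S1 d); assert (H4 := Cmod_ge_0 (F d)).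
    assert (H5 := Cmod_ge_0 (S d)); assert (H6 := E0 d).
    assert (H7 : 0 <= Cmod (F d) * Cmod (S d)) by (now apply Rmult_le_pos).
    assert (H8 : Cmod (F d) * Cmod (S d) <= sum_over (divisors nu) r * sum_over (divisors nu) s)
      by (now apply Rmult_le_compat).
    rewrite Rmult_assoc.
    apply Rle_trans with ((M + E d) * (Cmod (F d) * Cmod (S d))).
    - now apply Rmult_le_compat_r.
    - rewrite Rmult_plus_distr_r; apply Rplus_le_compat_l, Rmult_le_compat_l; assumption. }
  apply Rmult_le_reg_l with (INR L); [exact L0|].
  replace (INR L * (INR L / 4 * sum_over (divisors nu) (fun n => s n ^ 2))) with
   (INR L ^ 2 / 4 * sum_over (divisors nu) (fun n => s n ^ 2)) by field.
  eapply Rle_trans; [exact K|]; apply Rmult_le_compat_l; [lra|].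
  apply (Rmult_le_compat_l M) in FS; [|exact M0].
  rewrite EP in FS; lra.
Qed.

(** * Approximation of zeta by Dirichlet polynomials *)

Lemma Rpower_pos x a : 0 < Rpower x a.
Proof. apply exp_pos. Qed.

Lemma Rpower_telescope x b : 0 < x -> 0 < b ->
  Rpower (x + 1) (- 1 - b) <= / b * (Rpower x (- b) - Rpower (x + 1) (- b)).
Proof.
  intros Hx Hb.
  destruct (MVT_gen (fun y => Rpower y (- b)) x (x + 1) (fun y => - b * Rpower y (- b - 1)))
    as [c [Hc E]].
  - intros y Hy; rewrite Rmin_left, Rmax_right in Hy by lra.
    apply is_derive_Reals, derivable_pt_lim_power; lra.
  - intros y Hy; rewrite Rmin_left, Rmax_right in Hy by lra.
    apply derivable_continuous_pt; eexists; apply derivable_pt_lim_power; lra.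
  - rewrite Rmin_left, Rmax_right in Hc by lra.
    assert (D : Rpower (x + 1) (- 1 - b) <= Rpower c (- b - 1)).
    { replace (- 1 - b) with (- b - 1) by ring; apply Rpower_decr; lra. }
    replace (Rpower x (- b) - Rpower (x + 1) (- b)) with (b * Rpower c (- b - 1)) by lra.
    rewrite <- Rmult_assoc, Rinv_l by lra; lra.
Qed.

Lemma INR_pos n : (1 <= n)%nat -> 1 <= INR n.
Proof. intros H; change 1 with (INR 1); now apply le_INR. Qed.

Lemma sum_Rpower_seq a n b : (1 <= a)%nat -> 0 < b ->
  sum_over (seq (S a) n) (fun m => Rpower (INR m) (- 1 - b)) <= / b * Rpower (INR a) (- b).
Proof.
  intros Ha Hb.
  assert (H : sum_over (seq (S a) n) (fun m => Rpower (INR m) (- 1 - b)) <=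
    / b * (Rpower (INR a) (- b) - Rpower (INR (a + n)) (- b))).
  { revert a Ha; induction n as [|n IH]; intros a Ha.
    - rewrite Nat.add_0_r; unfold sum_over; simpl; lra.
    - change (seq (S a) (S n)) with (S a :: seq (S (S a)) n); rewrite sum_over_cons.
      specialize (IH (S a) ltac:(lia)).
      assert (T := Rpower_telescope (INR a) b ltac:(apply INR_pos in Ha; lra) Hb).
      replace (S a + n)%nat with (a + S n)%nat in IH by lia.
      rewrite S_INR in *; lra. }
  assert (P := Rpower_pos (INR (a + n)) (- b)).
  assert (I : 0 < / b) by (apply Rinv_0_lt_compat; exact Hb); nra.
Qed.

Definition dpoly (N : nat) (sig t : R) : C :=
  csum (seq 1 N) (fun m => Rpower (INR m) (- sig) * cis (- (t * ln (INR m))))%C.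

Lemma cpow_cis x sig t : cpow x (- (sig, t)) = (Rpower x (- sig) * cis (- (t * ln x)))%C.
Proof.
  unfold cpow, Cexp.
  replace (Re (- (sig, t) * RtoC (ln x))%C) with (- sig * ln x) by (unfold Re; simpl; ring).
  replace (Im (- (sig, t) * RtoC (ln x))%C) with (- (t * ln x)) by (unfold Im; simpl; ring).
  unfold cis, Rpower; apply injective_projections; simpl; ring.
Qed.

Lemma dpoly_S N sig t :
  dpoly (S N) sig t = (dpoly N sig t + cpow (INR (S N)) (- (sig, t)))%C.
Proof.
  unfold dpoly; rewrite seq_S.
  assert (A : forall l l' f, csum (l ++ l') f = (csum l f + csum l' f)%C).
  { intros; apply injective_projections; simpl; apply sum_over_app. }
  rewrite A, csum_cons, cpow_cis.
  assert (Z : forall f, csum nil f = RtoC 0) by reflexivity.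
  rewrite Z; change (1 + N)%nat with (S N); ring.
Qed.

(** The integrals in [zeta_term] telescope; their lower end contributes 1/(s - 1) and their upper
    end the value of [primitive]. *)
Lemma dpoly_terms N sig t : (sig, t) <> RtoC 1 ->
  dpoly (S N) sig t =
  (sum_n (G := C_AbelianMonoid) (fun n => zeta_term (sig, t) (INR (S n))) N +
   / ((sig, t) - 1) + primitive (sig, t) (INR (S (S N))))%C.
Proof.
  intros Hs.
  assert (N1 : (1 - (sig, t))%C <> 0) by (apply Cminus_neq; congruence).
  assert (N2 : ((sig, t) - 1)%C <> 0) by (apply Cminus_neq; congruence).
  induction N as [|N IH].
  - rewrite Csum_O, dpoly_S, zeta_termE by exact Hs.
    replace (dpoly 0 sig t) with (RtoC 0) by reflexivity.
    simpl (INR 1); rewrite cpow_1_l; unfold primitive; rewrite cpow_1_l.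
    change (INR 2) with (1 + 1).
    set (z := (sig, t)) in *; field; auto.
  - rewrite dpoly_S, IH, Csum_Sn, (zeta_termE _ (INR (S (S N)))) by exact Hs.
    rewrite <- (S_INR (S (S N))); ring.
Qed.

Lemma sum_n_Cmod_le (a : nat -> C) (b : nat -> R) k p :
  (forall n, Cmod (a n) <= b n) ->
  Cmod (sum_n (G := C_AbelianMonoid) a (k + p) - sum_n (G := C_AbelianMonoid) a k)%C <=
  sum_over (seq (S k) p) b.
Proof.
  intros H; induction p as [|p IH].
  - rewrite Nat.add_0_r.
    replace (_ - _)%C with (RtoC 0) by ring; rewrite Cmod_0; unfold sum_over; simpl; lra.
  - rewrite Nat.add_succ_r, Csum_Sn, seq_S, sum_over_app.
    match goal with |- Cmod ?z <= _ => replace z with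
      (sum_n (G := C_AbelianMonoid) a (k + p) - sum_n (G := C_AbelianMonoid) a k
         + a (S (k + p)))%C by ring end.
    eapply Rle_trans; [apply Cmod_triangle|].
    rewrite sum_over_cons; change (sum_over nil b) with 0.
    change (S k + p)%nat with (S (k + p)); specialize (H (S (k + p))); lra.
Qed.

Lemma Cseries_tail_le (a : nat -> C) (l : C) k B :
  is_Cseries a l ->
  (forall p, Cmod (sum_n (G := C_AbelianMonoid) a (k + p) - sum_n (G := C_AbelianMonoid) a k)%C <= B) ->
  Cmod (l - sum_n (G := C_AbelianMonoid) a k)%C <= B.
Proof.
  intros Hl HB; apply le_epsilon; intros eps He.
  assert (HS := Hl (fun y => Cmod (y - l)%C < eps)).
  destruct HS as [n0 Hn].
  (* A ball of [C] is a product of two real balls, hence a factor sqrt 2 in passing to the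
     modulus. *)
  { assert (E2 : 0 < eps / 2) by lra.
    exists (mkposreal _ E2); intros y Hy.
    assert (Q := C_NormedModule_mixin_compat2 _ _ _ Hy); simpl in Q.
    eapply Rlt_le_trans; [exact Q|].
    assert (sqrt 2 <= 2).
    { rewrite <- (sqrt_square 2) at 2 by lra; apply sqrt_le_1_alt; lra. }
    assert (sqrt 2 * (eps / 2) <= 2 * (eps / 2)) by (apply Rmult_le_compat_r; lra).
    lra. }
  specialize (Hn (k + n0)%nat ltac:(lia)).
  set (u := sum_n (G := C_AbelianMonoid) a (k + n0)) in *.
  set (v := sum_n (G := C_AbelianMonoid) a k) in *.
  replace (l - v)%C with (- (u - l) + (u - v))%C by ring.
  eapply Rle_trans; [apply Cmod_triangle|]; rewrite Cmod_opp.
  assert (K := HB n0); fold u v in K; change (Cmod (u - l)%C < eps) in Hn; lra.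
Qed.

Lemma zeta_term_sum_le sig t a n : (sig, t) <> RtoC 1 -> 0 < sig ->
  sum_over (seq (S a) n) (fun n => 4 * (Cmod (sig, t) * Rpower (INR (S n)) (- 1 - sig))) <=
  4 * Cmod (sig, t) * (/ sig * Rpower (INR (S a)) (- sig)).
Proof.
  intros Hs H0.
  assert (P := sum_Rpower_seq (S a) n sig ltac:(lia) H0).
  rewrite sum_over_scal, sum_over_scal, Rmult_assoc.
  rewrite <- (sum_over_map (seq (S a) n) S (fun m => Rpower (INR m) (- 1 - sig))).
  rewrite seq_shift.
  apply Rmult_le_compat_l; [lra|]; apply Rmult_le_compat_l; [apply Cmod_ge_0|exact P].
Qed.

Lemma zeta_term_Cmod sig t n : (sig, t) <> RtoC 1 -> 0 < sig ->
  Cmod (zeta_term (sig, t) (INR (S n))) <=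
  4 * (Cmod (sig, t) * Rpower (INR (S n)) (- 1 - sig)).
Proof. intros; apply zeta_term_bound; trivial; apply INR_S_ge_1. Qed.

Lemma zeta_approx N sig t : (1 <= N)%nat -> (sig, t) <> RtoC 1 -> 0 < sig ->
  Cmod (zeta (sig, t) - dpoly N sig t + primitive (sig, t) (INR (S N)))%C <=
  4 * Cmod (sig, t) * (/ sig * Rpower (INR N) (- sig)).
Proof.
  intros HN Hs H0; destruct N as [|k]; [lia|].
  rewrite dpoly_terms by exact Hs; unfold zeta.
  set (a := fun n => zeta_term (sig, t) (INR (S n))).
  match goal with |- Cmod ?z <= _ => replace z with
    (CSeries a - sum_n (G := C_AbelianMonoid) a k)%C by ring end.
  apply Cseries_tail_le; [apply zeta_series; trivial|].
  intros p; eapply Rle_trans; [apply sum_n_Cmod_le|].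
  - intros n; now apply zeta_term_Cmod.
  - now apply zeta_term_sum_le.
Qed.

Lemma Cmod_primitive x sig t : 0 < t -> Cmod (primitive (sig, t) x) <= Rpower x (1 - sig) / t.
Proof.
  intros Ht; unfold primitive.
  assert (H : t <= Cmod (1 - (sig, t))).
  { eapply Rle_trans; [|apply im_le_Cmod]; simpl.
    rewrite Rabs_left by lra; lra. }
  rewrite Cmod_div by (apply Cmod_gt_0; lra).
  rewrite Cmod_cpow; simpl Re; apply Rmult_le_compat_l; [left; apply Rpower_pos|].
  now apply Rinv_le_contravar.
Qed.

Lemma im_neq_1 sig t : 0 < t -> (sig, t) <> RtoC 1.
Proof. intros H E; apply (f_equal Im) in E; simpl in E; lra. Qed.

Lemma Cmod_pair_le sig t : 0 <= sig <= 1 -> 0 <= t -> Cmod (sig, t) <= 1 + t.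
Proof.
  intros; eapply Rle_trans; [apply Cmod_le_parts|]; simpl.
  rewrite !Rabs_right by lra; lra.
Qed.

(** The three terms are zeta itself, the trace of the pole in a partial sum of length [N], and the
    tail of the series; 8 bounds 4 / sig. *)
Lemma dpoly_le_far N sig t : (1 <= N)%nat -> 1 / 2 < sig <= 1 -> 0 < t ->
  Cmod (dpoly N sig t) <=
  Cmod (zeta (sig, t)) + Rpower (INR (S N)) (1 - sig) / t + 8 * (1 + t) * Rpower (INR N) (- sig).
Proof.
  intros HN Hs Ht.
  assert (Z := zeta_approx N sig t HN (im_neq_1 _ _ Ht) ltac:(lra)).
  assert (P := Cmod_primitive (INR (S N)) sig t Ht).
  assert (M := Cmod_pair_le sig t ltac:(lra) ltac:(lra)).
  set (z := zeta (sig, t)) in *; set (p := primitive (sig, t) (INR (S N))) in *.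
  replace (dpoly N sig t) with (z + p + - (z - dpoly N sig t + p))%C by ring.
  eapply Rle_trans; [apply Cmod_triangle|]; rewrite Cmod_opp.
  assert (T := Cmod_triangle z p).
  assert (4 * Cmod (sig, t) * (/ sig * Rpower (INR N) (- sig)) <=
          8 * (1 + t) * Rpower (INR N) (- sig)).
  { rewrite <- Rmult_assoc; apply Rmult_le_compat_r; [left; apply Rpower_pos|].
    assert (I : 0 < / sig <= 2).
    { split; [apply Rinv_0_lt_compat; lra|].
      replace 2 with (/ (1 / 2)) by field; apply Rinv_le_contravar; lra. }
    assert (0 <= Cmod (sig, t)) by apply Cmod_ge_0; nra. }
  lra.
Qed.

Lemma Rpower_ge1 x a : 1 <= x -> 0 <= a -> 1 <= Rpower x a.
Proof.
  intros Hx Ha; unfold Rpower; rewrite <- exp_0; apply exp_le_compat.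
  assert (0 <= ln x) by (rewrite <- ln_1; apply ln_le; lra); nra.
Qed.

(** Here zeta is not compared with anything: 1/(s - 1) is at most 1/t, the boundary term is at most
    the stated power over t, and the partial sum of the [zeta_term]s is at most 24. *)
Lemma dpoly_le_near N sig t : (1 <= N)%nat -> 1 / 2 < sig <= 1 -> 0 < t <= 1 ->
  Cmod (dpoly N sig t) <= 26 * Rpower (INR (S N)) (1 - sig) / t.
Proof.
  intros HN Hs Ht; destruct N as [|k]; [lia|].
  assert (Hs1 := im_neq_1 sig t ltac:(lra)).
  rewrite dpoly_terms by exact Hs1.
  set (Y := Rpower (INR (S (S k))) (1 - sig)).
  assert (Y1 : 1 <= Y) by (apply Rpower_ge1; [apply INR_S_ge_1|lra]).
  assert (P := Cmod_primitive (INR (S (S k))) sig t ltac:(lra)); fold Y in P.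
  assert (I : Cmod (/ ((sig, t) - 1)) <= 1 / t).
  { assert (H : t <= Cmod ((sig, t) - 1)%C).
    { eapply Rle_trans; [|apply im_le_Cmod]; simpl; rewrite Rabs_right; lra. }
    rewrite Cmod_inv by (apply Cmod_gt_0; lra).
    unfold Rdiv; rewrite Rmult_1_l; apply Rinv_le_contravar; lra. }
  set (a := fun n => zeta_term (sig, t) (INR (S n))) in *.
  assert (M := Cmod_pair_le sig t ltac:(lra) ltac:(lra)).
  (* The first term gives 8 and the others 16, as |s| <= 2 and 1 / sig <= 2. *)
  assert (S0 : Cmod (sum_n (G := C_AbelianMonoid) a k) <= 24).
  { assert (B0 := zeta_term_Cmod sig t 0 Hs1 ltac:(lra)); fold (a 0%nat) in B0.
    assert (B1 := sum_n_Cmod_le a _ 0 k (fun n => zeta_term_Cmod sig t n Hs1 ltac:(lra))).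
    assert (B2 := zeta_term_sum_le sig t 0 k Hs1 ltac:(lra)).
    rewrite Csum_O in B1; simpl (0 + k)%nat in B1.
    assert (O : forall c, Rpower (INR 1) c = 1).
    { intros; simpl; unfold Rpower; rewrite ln_1, Rmult_0_r; apply exp_0. }
    rewrite O in B0, B2.
    assert (Is : 0 < / sig <= 2).
    { split; [apply Rinv_0_lt_compat; lra|].
      replace 2 with (/ (1 / 2)) by field; apply Rinv_le_contravar; lra. }
    set (s := sum_n (G := C_AbelianMonoid) a k) in *.
    replace s with (a 0%nat + (s - a 0%nat))%C by ring.
    eapply Rle_trans; [apply Cmod_triangle|].
    assert (0 <= Cmod (sig, t)) by apply Cmod_ge_0; nra. }
  eapply Rle_trans; [apply Cmod_triangle|].
  eapply Rle_trans; [apply Rplus_le_compat_r, Cmod_triangle|].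
  assert (It : 1 <= / t) by (rewrite <- Rinv_1; apply Rinv_le_contravar; lra).
  unfold Rdiv in *; nra.
Qed.

Lemma harmonic_le n : (1 <= n)%nat -> sum_over (seq 1 n) (fun m => / INR m) <= 1 + ln (INR n).
Proof.
  intros Hn; induction n as [|n IH]; [lia|].
  destruct n as [|n].
  - unfold sum_over; simpl; rewrite Rinv_1, ln_1; lra.
  - rewrite seq_S, sum_over_app, sum_over_cons; change (sum_over nil _) with 0.
    replace (1 + S n)%nat with (S (S n)) by lia.
    specialize (IH ltac:(lia)).
    assert (H : / INR (S (S n)) <= ln (INR (S (S n))) - ln (INR (S n))).
    { assert (P1 := INR_S_ge_1 n); assert (P2 := INR_S_ge_1 (S n)).
      rewrite <- ln_div by lra.
      assert (E := exp_ineq1_le (- ln (INR (S (S n)) / INR (S n)))).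
      rewrite exp_Ropp, exp_ln in E by (apply Rdiv_lt_0_compat; lra).
      replace (/ (INR (S (S n)) / INR (S n))) with (1 - / INR (S (S n))) in E; [lra|].
      rewrite (S_INR (S n)) in *; field; lra. }
    lra.
Qed.

Lemma dpoly_le_0 N sig : (1 <= N)%nat -> sig <= 1 ->
  Cmod (dpoly N sig 0) <= Rpower (INR (S N)) (1 - sig) * (1 + ln (INR N)).
Proof.
  intros HN Hs; unfold dpoly; eapply Rle_trans; [apply Cmod_csum_le|].
  eapply Rle_trans; [|apply Rmult_le_compat_l; [left; apply Rpower_pos|apply (harmonic_le N HN)]].
  rewrite <- sum_over_scal; apply sum_over_le; intros m Hm; apply in_seq in Hm.
  assert (m1 := INR_pos m ltac:(lia)).
  rewrite Cmod_mult, Cmod_cis, Cmod_R, Rabs_right, Rmult_1_r by (left; apply Rpower_pos).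
  replace (Rpower (INR m) (- sig)) with (Rpower (INR m) (1 - sig) * / INR m).
  - apply Rmult_le_compat_r; [left; apply Rinv_0_lt_compat; lra|].
    apply Rle_Rpower_l; [lra|]; split; [lra|apply le_INR; lia].
  - rewrite <- (Rpower_1 (INR m)) at 2 by lra.
    rewrite <- Rpower_Ropp, <- Rpower_plus; f_equal; ring.
Qed.

(** * The convolution without cutoff, its l^1 and l^2 norms, and the resonance bound *)

Definition dconv (sig : R) (r : nat -> R) (n : nat) : R :=
  sum_over (divisors n) (fun m => Rpower (INR m) (- sig) * r (n / m)%nat).

Definition mass (nu : nat) (r : nat -> R) : R := sum_over (divisors nu) r.

Definition energy (nu : nat) (r : nat -> R) : R := sum_over (divisors nu) (fun n => r n ^ 2).

Lemma energy_ge0 nu r : 0 <= energy nu r.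
Proof. apply sum_over_ge0; intros; apply pow2_ge_0. Qed.

Lemma mass_ge0 nu r : (forall n, 0 <= r n) -> 0 <= mass nu r.
Proof. intros; apply sum_over_ge0; auto. Qed.

Lemma dconv_ge0 sig r n : (forall k, 0 <= r k) -> 0 <= dconv sig r n.
Proof.
  intros; apply sum_over_ge0; intros; apply Rmult_le_pos; [left; apply Rpower_pos|auto].
Qed.

Lemma dconv_ge_self sig r n : (forall k, 0 <= r k) -> (1 <= n)%nat -> r n <= dconv sig r n.
Proof.
  intros r0 Hn; unfold dconv.
  eapply Rle_trans; [|apply (sum_over_term_le _ _ 1%nat)].
  - cbv beta; rewrite Nat.div_1_r; simpl; unfold Rpower; rewrite ln_1, Rmult_0_r, exp_0; lra.
  - apply in_divisors; [exact Hn|apply Nat.divide_1_l].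
  - intros; apply Rmult_le_pos; [left; apply Rpower_pos|auto].
Qed.

Lemma sum_codivisors_le n f : (1 <= n)%nat -> (forall k, 0 <= f k) ->
  sum_over (divisors n) (fun m => f (n / m)%nat) <= sum_over (divisors n) f.
Proof.
  intros Hn f0; apply (sum_over_inj_le _ _ (fun m => n / m)%nat); auto.
  - apply NoDup_divisors.
  - intros x y Hx Hy E.
    assert (E1 := divisor_mul_div n x Hn Hx); assert (E2 := divisor_mul_div n y Hn Hy).
    rewrite <- E in E2; rewrite <- E1 in E2 at 2.
    destruct (n / x)%nat; [lia|]; nia.
  - intros x Hx; now apply in_divisors_div.
Qed.

(** A discarded term has m > N, so its weight is at most N^(-sig), and the values r(n/m) belong to
    distinct divisors of [nu]. *)
Lemma dconv_truncate nu N sig r n :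
  (1 <= nu)%nat -> (1 <= N)%nat -> 0 <= sig -> (forall k, 0 <= r k) -> In n (divisors nu) ->
  let h := conv N (fun m => Rpower (INR m) (- sig)) r n in
  h <= dconv sig r n <= h + Rpower (INR N) (- sig) * mass nu r.
Proof.
  intros Hnu HN Hs r0 Hn h; assert (n1 := divisors_pos _ _ Hn).
  unfold dconv; rewrite (sum_divisors_seq n (N + n)) by lia.
  rewrite seq_app, sum_over_app; fold (conv N (fun m => Rpower (INR m) (- sig)) r n); fold h.
  assert (A : forall m, 0 <= (if Nat.eqb (n mod m) 0 then Rpower (INR m) (- sig) * r (n / m)%nat else 0)).
  { intros m; destruct (Nat.eqb _ _); [apply Rmult_le_pos; [left; apply Rpower_pos|auto]|lra]. }
  assert (B : 0 <= sum_over (seq (1 + N) n) (fun m => if Nat.eqb (n mod m) 0 then Rpower (INR m) (- sig) * r (n / m)%nat else 0)).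
  { apply sum_over_ge0; auto. }
  split; [unfold h, conv in *; lra|apply Rplus_le_compat_l].
  apply Rle_trans with (Rpower (INR N) (- sig) *
    sum_over (seq (1 + N) n) (fun m => if Nat.eqb (n mod m) 0 then r (n / m)%nat else 0)).
  - rewrite <- sum_over_scal; apply sum_over_le; intros m Hm; apply in_seq in Hm.
    destruct (Nat.eqb _ _); [|lra]; apply Rmult_le_compat_r; [auto|].
    apply Rpower_decr; [apply INR_pos in HN; lra|apply le_INR; lia|lra].
  - apply Rmult_le_compat_l; [left; apply Rpower_pos|].
    apply Rle_trans with (sum_over (divisors n) (fun m => r (n / m)%nat)).
    + rewrite (sum_divisors_seq n (N + n)), seq_app, sum_over_app by lia.
      assert (0 <= sum_over (seq 1 N) (fun m => if Nat.eqb (n mod m) 0 then r (n / m)%nat else 0)).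
      { apply sum_over_ge0; intros m _; destruct (Nat.eqb _ _); [auto|lra]. }
      lra.
    + eapply Rle_trans; [apply sum_codivisors_le; auto|].
      apply sum_over_incl; [apply NoDup_divisors| |auto].
      apply incl_divisors; [exact Hnu|now apply in_divisors in Hn].
Qed.

Lemma ln_ge0 x : 1 <= x -> 0 <= ln x.
Proof. intros H; rewrite <- ln_1; apply ln_le; lra. Qed.

(* The contribution of the pole is at most [Y / A] pointwise for [t >= A]; for [t < A] it is
   estimated with the trivial bounds [|R| <= mass r] and [|S| <= mass h]. *)
Lemma resonance_bound nu N (r : nat -> R) (sig T A M : R) :
  (1 <= nu)%nat -> (1 <= N)%nat -> 1 / 2 < sig <= 1 -> 1 <= T -> 1 <= A -> 0 <= M ->
  (forall n, 0 <= r n) ->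
  (forall t, 1 <= t <= T -> Cmod (zeta (sig, t)) <= M) ->
  let R1 := mass nu r in let H1 := mass nu (dconv sig r) in
  let H2 := energy nu (dconv sig r) in
  let Y := Rpower (INR (S N)) (1 - sig) in
  Rpower (INR N) (- sig) * (R1 * H1) <= H2 / 4 ->
  Y / T * (27 + 26 * ln A + 26 * ln (1 + ln (INR N))) * (R1 * H1) <= H2 / 128 ->
  Y / A + 8 * (1 + T) * Rpower (INR N) (- sig) <= 1 / 1024 ->
  sqrt H2 <= 256 * M * sqrt (energy nu r).
Proof.
  intros Hnu HN Hs HT HA M0 r0 HM R1 H1 H2 Y C1 C2 C3.
  set (w := fun m => Rpower (INR m) (- sig)).
  set (g := conv N w r).
  set (eta := Y / A + 8 * (1 + T) * Rpower (INR N) (- sig)) in *.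
  assert (Y1 : 1 <= Y) by (apply Rpower_ge1; [apply INR_S_ge_1|lra]).
  assert (lN : 0 <= ln (INR N)) by (apply ln_ge0, INR_pos, HN).
  (* Samples are spaced by 1/B: the trivial bound Y B at t = 0 then has the size of Y/t at the first
     sample t = 1/B. *)
  set (B := 1 + ln (INR N)) in *; assert (B1 : 1 <= B) by (unfold B; lra).
  assert (PN := Rpower_pos (INR N) (- sig)).
  assert (w0 : forall m, 0 <= w m) by (intros; left; apply Rpower_pos).
  assert (TB0 : 0 <= T * B) by nra.
  destruct (nfloor_ex (T * B) TB0) as [l Hl].
  set (L := S l).
  assert (EL : INR L = INR l + 1) by apply S_INR.
  destruct (nfloor_ex (A * B) ltac:(nra)) as [j Hj].
  (* The index [d] stands for t = d/B, and d > j implies t >= A. Up to [j] the pole is charged to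
     [E], where 1/t = B/d; beyond [j] it is at most Y/A, which is part of [eta]. *)
  set (E := fun d => if Nat.eqb d 0 then Y * B else
                     if Nat.leb d j then 26 * Y * B * / INR d else 0).
  assert (E0 : forall d, 0 <= E d).
  { intros d; unfold E; destruct (Nat.eqb_spec d 0); [nra|].
    destruct (Nat.leb _ _); [|lra].
    assert (0 < / INR d) by (apply Rinv_0_lt_compat, lt_0_INR; lia);
    left; repeat apply Rmult_lt_0_compat; lra. }
  assert (eta0 : 0 <= eta).
  { unfold eta; assert (0 < Y / A) by (apply Rdiv_lt_0_compat; lra); nra. }
  assert (HD : forall d, (d < L)%nat ->
     Cmod (csum (seq 1 N) (fun m => w m * cis (- (INR d * (/ B * ln (INR m)))))%C) <= M + eta + E d).
  { intros d Hd.
    replace (csum _ _) with (dpoly N sig (INR d * / B)).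
    2:{ apply csum_ext; intros m; unfold w; now rewrite Rmult_assoc. }
    unfold E; destruct (Nat.eqb_spec d 0) as [->|d0].
    { simpl INR; rewrite Rmult_0_l.
      assert (Z := dpoly_le_0 N sig HN ltac:(lra)); fold Y B in Z; lra. }
    assert (d1 := INR_pos d ltac:(lia)).
    assert (Bi : 0 < / B) by (apply Rinv_0_lt_compat; lra).
    set (t := INR d * / B); assert (t0 : 0 < t) by (unfold t; nra).
    assert (Et : / t = B * / INR d) by (unfold t; field; lra).
    assert (tB : INR d = t * B) by (unfold t; field; lra).
    assert (id : 0 < / INR d) by (apply Rinv_0_lt_compat; lra).
    destruct (Rlt_le_dec t 1) as [t1|t1].
    - assert (Hdj : (d <= j)%nat).
      { apply INR_le; assert (INR d < INR j + 1) by nra.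
        rewrite <- S_INR in *; apply le_INR; apply INR_lt in H; lia. }
      rewrite (proj2 (Nat.leb_le _ _) Hdj).
      assert (Z := dpoly_le_near N sig t HN Hs ltac:(lra)); fold Y in Z.
      unfold Rdiv in Z; rewrite Et in Z; lra.
    - assert (tT : t <= T).
      { assert (INR d <= INR l) by (apply le_INR; unfold L in Hd; lia); nra. }
      assert (Z := dpoly_le_far N sig t HN Hs t0); fold Y in Z.
      assert (Zt := HM t ltac:(lra)).
      assert (Q : 8 * (1 + t) * Rpower (INR N) (- sig) <= 8 * (1 + T) * Rpower (INR N) (- sig)) by nra.
      assert (YA : 0 < Y / A) by (apply Rdiv_lt_0_compat; lra).
      destruct (Nat.leb_spec d j) as [H|H].
      + unfold Rdiv in Z at 1; rewrite Et in Z.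
        assert (0 < Y * B * / INR d) by (repeat apply Rmult_lt_0_compat; lra).
        unfold eta; lra.
      + assert (At : A <= t).
        { assert (INR j + 1 <= INR d) by (rewrite <- S_INR; apply le_INR; lia); nra. }
        assert (Y / t <= Y / A).
        { apply Rmult_le_compat_l; [lra|]; apply Rinv_le_contravar; lra. }
        unfold eta; lra. }
  assert (iB : 0 <= / B) by (left; apply Rinv_0_lt_compat; lra).
  assert (K := resonance_discrete nu N L w r (/ B) (M + eta) E Hnu ltac:(unfold L; lia) iB
                 ltac:(lra) w0 r0 E0 HD).
  fold g (mass nu r) (mass nu g) (energy nu r) (energy nu g) in K.
  set (G2 := energy nu g) in *; set (G1 := mass nu g) in *; fold R1 in K.
  assert (g0 : forall n, 0 <= g n) by (intros; now apply conv_ge0).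
  assert (TR : forall n, In n (divisors nu) ->
     g n <= dconv sig r n <= g n + Rpower (INR N) (- sig) * R1).
  { intros n Hn; exact (dconv_truncate nu N sig r n Hnu HN ltac:(lra) r0 Hn). }
  assert (G1H : G1 <= H1) by (apply sum_over_le; intros; now apply TR).
  assert (R10 : 0 <= R1) by (now apply mass_ge0).
  assert (G10 : 0 <= G1) by (now apply mass_ge0).
  (* With h = [dconv] and g its truncation, h^2 <= 2 g^2 + 2 (h - g)^2 and (h - g)^2 <= N^(-sig) R1
     h; by [C1] the second part totals at most H2 / 2. *)
  assert (H24 : H2 <= 4 * G2).
  { assert (H2 <= 2 * G2 + 2 * (Rpower (INR N) (- sig) * (R1 * H1))).
    { unfold H2, G2, H1, energy, mass.
      rewrite <- Rmult_assoc, <- !sum_over_scal, <- sum_over_plus.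
      apply sum_over_le; intros n Hn; destruct (TR n Hn) as [T1 T2].
      specialize (g0 n).
      assert ((dconv sig r n - g n) ^ 2 <= Rpower (INR N) (- sig) * R1 * dconv sig r n).
      { simpl; rewrite Rmult_1_r; apply Rmult_le_compat; lra. }
      assert (0 <= (dconv sig r n - 2 * g n) ^ 2) by apply pow2_ge_0.
      nra. }
    lra. }
  assert (lA : 0 <= ln A) by (now apply ln_ge0).
  (* One from d = 0, and 26 times the harmonic sum 1 + ln j with j <= A B. *)
  assert (SE : sum_over (seq 0 L) E <= Y * B * (27 + 26 * ln A + 26 * ln B)).
  { unfold L; change (seq 0 (S l)) with (0%nat :: seq 1 l); rewrite sum_over_cons.
    assert (j1 : (1 <= j)%nat).
    { apply INR_le; assert (1 < INR j + 1) by nra; rewrite <- S_INR in H.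
      change 1 with (INR 1) in H; apply INR_lt in H; apply le_INR; lia. }
    assert (jH : ln (INR j) <= ln A + ln B).
    { rewrite <- ln_mult by lra; apply ln_le; [apply INR_pos in j1; lra|lra]. }
    assert (HH := harmonic_le j j1).
    assert (S1 : sum_over (seq 1 l) E <= 26 * Y * B * sum_over (seq 1 j) (fun d => / INR d)).
    { rewrite <- sum_over_scal.
      apply Rle_trans with (sum_over (filter (fun d => Nat.leb d j) (seq 1 l))
         (fun d => 26 * Y * B * / INR d)).
      - rewrite sum_over_filter; apply sum_over_le; intros d Hd; apply in_seq in Hd.
        unfold E; destruct (Nat.eqb_spec d 0); [lia|right; reflexivity].
      - apply sum_over_incl; [apply NoDup_filter, seq_NoDup| |].
        + intros d; rewrite filter_In, !in_seq, Nat.leb_le; lia.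
        + intros d Hd; apply in_seq in Hd.
          assert (0 < / INR d) by (apply Rinv_0_lt_compat, lt_0_INR; lia);
    left; repeat apply Rmult_lt_0_compat; lra. }
    assert (YB : 0 <= Y * B) by nra.
    assert (E00 : E 0%nat = Y * B) by reflexivity.
    assert (26 * (Y * B) * sum_over (seq 1 j) (fun d => / INR d) <= 26 * (Y * B) * (1 + (ln A + ln B))).
    { apply Rmult_le_compat_l; lra. }
    lra. }
  assert (H10 : 0 <= H1) by lra.
  assert (ER : 2 * sum_over (seq 0 L) E * (R1 * G1) <= INR L * (H2 / 64)).
  { assert (RH : 0 <= R1 * H1) by nra.
    assert (H20 : 0 <= H2) by apply energy_ge0.
    apply Rle_trans with (2 * (Y * B * (27 + 26 * ln A + 26 * ln B)) * (R1 * H1)).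
    - assert (0 <= sum_over (seq 0 L) E) by (apply sum_over_ge0; auto).
      apply Rmult_le_compat; [lra|nra|lra|nra].
    - apply Rle_trans with (T * B * (H2 / 64)).
      + apply (Rmult_le_compat_l (2 * (T * B))) in C2; [|lra].
        replace (2 * (Y * B * (27 + 26 * ln A + 26 * ln B)) * (R1 * H1)) with
          (2 * (T * B) * (Y / T * (27 + 26 * ln A + 26 * ln B) * (R1 * H1))) by (field; lra).
        lra.
      + apply Rmult_le_compat_r; lra. }
  set (a := sqrt (energy nu r)) in *; set (b := sqrt G2) in *.
  assert (a0 : 0 <= a) by apply sqrt_pos; assert (b0 : 0 <= b) by apply sqrt_pos.
  assert (Eb : G2 = b * b) by (unfold b; rewrite sqrt_def; [reflexivity|apply energy_ge0]).
  assert (L0 : 0 < INR L) by (assert (Z := pos_INR l); lra).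
  (* The pole costs at most H2 / 64 <= G2 / 16 out of the main term G2 / 4. *)
  assert (K2 : 3 / 16 * (b * b) <= 16 * (M + eta) * (a * b)).
  { apply Rmult_le_reg_l with (INR L); [exact L0|]; rewrite Eb in *; nra. }
  assert (K3 : b <= 256 / 3 * (M + eta) * a).
  { destruct (Req_dec b 0) as [Z|Z].
    - rewrite Z; apply Rmult_le_pos; [lra|exact a0].
    - apply Rmult_le_reg_r with b; lra. }
  assert (K4 : sqrt H2 <= 2 * b).
  { rewrite <- (sqrt_pow2 (2 * b)) by lra; apply sqrt_le_1_alt; rewrite Eb in H24; simpl; lra. }
  (* Since h >= r pointwise, the term with [eta] is absorbed on the left: it amounts to at most a
     sixth of sqrt H2. *)
  assert (K5 : a <= sqrt H2).
  { apply sqrt_le_1_alt, sum_over_le; intros n Hn; apply divisors_pos in Hn.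
    apply pow_incr; split; [apply r0|now apply dconv_ge_self]. }
  assert (eta * a <= 1 / 1024 * sqrt H2) by (apply Rmult_le_compat; lra).
  assert (0 <= M * a) by (now apply Rmult_le_pos).
  lra.
Qed.

(** * Powers against logarithms, and the choice of the length in terms of T *)

Lemma ln_le_Rpower x a : 0 < a -> 1 <= x -> ln x <= / a * Rpower x a.
Proof.
  intros Ha Hx; apply Rmult_le_reg_l with a; [exact Ha|].
  rewrite <- Rmult_assoc, Rinv_r, Rmult_1_l by lra.
  unfold Rpower; assert (H := exp_ineq1_le (a * ln x)); lra.
Qed.

Lemma Rpower_le_exp x a b : 1 <= x -> a <= b -> Rpower x a <= Rpower x b.
Proof.
  intros Hx H; unfold Rpower; apply exp_le_compat.
  assert (Z := ln_ge0 x Hx); nra.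
Qed.

Lemma Rpower_eventually_ge a K : 0 < a -> exists x0, 1 <= x0 /\ forall x, x0 <= x -> K <= Rpower x a.
Proof.
  intros Ha; set (k := Rmax 1 K); exists (Rpower k (/ a)).
  assert (k1 : 1 <= k) by apply Rmax_l; assert (Kk : K <= k) by apply Rmax_r.
  assert (H1 : 1 <= Rpower k (/ a)).
  { apply Rpower_ge1; [exact k1|left; now apply Rinv_0_lt_compat]. }
  split; [exact H1|]; intros x Hx; apply Rle_trans with k; [exact Kk|].
  rewrite <- (Rpower_1 k) by lra; rewrite <- (Rinv_l a) by lra; rewrite <- Rpower_mult.
  apply Rle_Rpower_l; [lra|split; [apply Rpower_pos|exact Hx]].
Qed.

Lemma log_Rpower_small a c eta : 0 < a -> 0 < eta -> 0 <= c ->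
  exists x0, 1 <= x0 /\ forall x, x0 <= x -> c * (1 + ln x) * Rpower x (- a) <= eta.
Proof.
  intros Ha He Hc.
  destruct (Rpower_eventually_ge (a / 2) (c * (1 + 2 / a) / eta) ltac:(lra)) as [x0 [H1 H2]].
  exists x0; split; [exact H1|]; intros x Hx; specialize (H2 x Hx).
  assert (L := ln_le_Rpower x (a / 2) ltac:(lra) ltac:(lra)).
  assert (P1 := Rpower_ge1 x (a / 2) ltac:(lra) ltac:(lra)).
  set (p := Rpower x (a / 2)) in *.
  assert (E : Rpower x (- a) = / (p * p)).
  { unfold p; rewrite <- Rpower_plus, Rpower_Ropp; f_equal; f_equal; field. }
  replace (/ (a / 2)) with (2 / a) in L by (field; lra).
  assert (A0 : 0 < 2 / a) by (apply Rdiv_lt_0_compat; lra).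
  rewrite E; apply Rmult_le_reg_r with (p * p); [nra|].
  rewrite Rmult_assoc, Rinv_l, Rmult_1_r by nra.
  apply Rle_trans with (c * ((1 + 2 / a) * p)); [apply Rmult_le_compat_l; nra|].
  apply (Rmult_le_compat_r eta) in H2; [|lra].
  unfold Rdiv at 1 in H2; rewrite Rmult_assoc, Rinv_l, Rmult_1_r in H2 by lra; nra.
Qed.

Lemma exists_length T xi : 1 <= T -> 0 <= xi ->
  exists N, (1 <= N)%nat /\ Rpower T xi <= INR N /\ INR (S N) <= 3 * Rpower T xi.
Proof.
  intros HT Hx; assert (P := Rpower_ge1 T xi HT Hx).
  destruct (nfloor_ex (Rpower T xi) ltac:(lra)) as [n Hn].
  exists (S n); split; [lia|]; rewrite !S_INR; lra.
Qed.

(* With [N] of size [T ^ (1 + 1/(2 sig))], the error terms are smaller than the main term by a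
   power of [T]. *)
Lemma resonance_bound_strip sig : 1 / 2 < sig < 1 ->
  exists T0, 1 <= T0 /\ forall T M nu r,
  T0 <= T -> 0 <= M -> (1 <= nu)%nat -> (forall n, 0 <= r n) ->
  (forall t, 1 <= t <= T -> Cmod (zeta (sig, t)) <= M) ->
  mass nu r * mass nu (dconv sig r) <=
    Rpower T (2 * sig - 1 + (1 - sig) * (2 * sig - 1) / (4 * sig)) * energy nu (dconv sig r) ->
  sqrt (energy nu (dconv sig r)) <= 256 * M * sqrt (energy nu r).
Proof.
  intros Hs.
  (* For N of size T^xi the pole term is of size T^(xi (1 - sig) - 1) = T^(1 - 2 sig - 2k), up to
     logarithms. Half of the spare exponent 2k is granted to the hypothesis on the masses, the other
     half beats the logarithms. *)
  set (k := (1 - sig) * (2 * sig - 1) / (4 * sig)).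
  assert (k0 : 0 < k) by (unfold k; apply Rdiv_lt_0_compat; nra).
  assert (Ek : 4 * sig * k = (1 - sig) * (2 * sig - 1)) by (unfold k; field; lra).
  assert (k1 : k <= 1 / 8) by nra.
  set (xi := 1 + 1 / (2 * sig)).
  assert (Ex : 2 * sig * xi = 2 * sig + 1) by (unfold xi; field; lra).
  assert (Hxi : 0 <= xi <= 2) by nra.
  assert (Ea : xi * (1 - sig) - 1 + (2 * sig - 1 + k) = - k) by nra.
  (* The thresholds serve the pole, the truncation and the tail, in this order. The 3 comes from N +
     1 <= 3 T^xi, and 19 is 3 for Y/T plus 16 for the tail. *)
  destruct (log_Rpower_small k (3 * 131) (1 / 128) k0 ltac:(lra) ltac:(lra)) as [Ta [Ta1 HTa]].
  destruct (log_Rpower_small (1 / 4) 1 (1 / 4) ltac:(lra) ltac:(lra) ltac:(lra)) as [Tb [Tb1 HTb]].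
  destruct (log_Rpower_small (sig - 1 / 2) 19 (1 / 1024) ltac:(lra) ltac:(lra) ltac:(lra)) as [Tc [Tc1 HTc]].
  exists (Ta + Tb + Tc); split; [lra|]; intros T M nu r HT M0 Hnu r0 HM HB.
  specialize (HTa T ltac:(lra)); specialize (HTb T ltac:(lra)); specialize (HTc T ltac:(lra)).
  assert (T1 : 1 <= T) by lra.
  assert (lT := ln_ge0 T T1).
  destruct (exists_length T xi T1 ltac:(lra)) as [N [N1 [N2 N3]]].
  assert (NR := INR_pos N N1).
  set (Y := Rpower (INR (S N)) (1 - sig)).
  assert (HY : Y <= 3 * Rpower T (xi * (1 - sig))).
  { unfold Y; apply Rle_trans with (Rpower (3 * Rpower T xi) (1 - sig)).
    - apply Rle_Rpower_l; [lra|split; [apply lt_0_INR; lia|exact N3]].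
    - rewrite <- Rpower_mult_distr by (lra || apply Rpower_pos).
      rewrite Rpower_mult; apply Rmult_le_compat_r; [left; apply Rpower_pos|].
      rewrite <- (Rpower_1 3) at 2 by lra; apply Rpower_le_exp; lra. }
  assert (HN : Rpower (INR N) (- sig) <= Rpower T (- sig - 1 / 2)).
  { apply Rle_trans with (Rpower (Rpower T xi) (- sig)).
    - apply Rpower_decr; [apply Rpower_pos|exact N2|lra].
    - rewrite Rpower_mult; right; f_equal; nra. }
  assert (lN : ln (INR N) <= 2 + 2 * ln T).
  { apply Rle_trans with (ln (3 * Rpower T xi)).
    - apply ln_le; [lra|]; rewrite S_INR in N3; lra.
    - rewrite ln_mult by (lra || apply Rpower_pos); unfold Rpower; rewrite ln_exp.
      assert (ln 3 <= 2) by (assert (Z := exp_ineq1_le (ln 3)); rewrite exp_ln in Z; lra).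
      nra. }
  assert (lN0 := ln_ge0 _ NR).
  assert (llN : ln (1 + ln (INR N)) <= ln (INR N)).
  { assert (Z := exp_ineq1_le (ln (INR N))).
    rewrite <- (ln_exp (ln (INR N))) at 2; apply ln_le; lra. }
  assert (H20 := energy_ge0 nu (dconv sig r)).
  set (H2 := energy nu (dconv sig r)) in *.
  set (B := mass nu r * mass nu (dconv sig r)) in *.
  assert (B0 : 0 <= B).
  { apply Rmult_le_pos; apply mass_ge0; trivial; intros; now apply dconv_ge0. }
  assert (PN := Rpower_pos (INR N) (- sig)).
  assert (PY : 0 < Y) by apply Rpower_pos.
  (* With A = T the whole pole term is treated as exceptional; the resulting ln T is affordable
     because a power of T is to spare. *)
  apply resonance_bound with (N := N) (T := T) (A := T) (sig := sig); trivial; try lra.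
  - fold B H2.
    apply Rle_trans with (Rpower T (- sig - 1 / 2) * (Rpower T (2 * sig - 1 + k) * H2)).
    + apply Rmult_le_compat; lra.
    + rewrite <- Rmult_assoc, <- Rpower_plus.
      apply Rle_trans with (1 / 4 * H2); [|lra]; apply Rmult_le_compat_r; [exact H20|].
      apply Rle_trans with (Rpower T (- (1 / 4))); [apply Rpower_le_exp; lra|].
      assert (Z := Rpower_pos T (- (1 / 4))); nra.
  - fold Y B H2.
    assert (LB : 27 + 26 * ln T + 26 * ln (1 + ln (INR N)) <= 131 * (1 + ln T)) by lra.
    assert (LB0 : 0 <= 27 + 26 * ln T + 26 * ln (1 + ln (INR N))).
    { assert (0 <= ln (1 + ln (INR N))) by (apply ln_ge0; lra); lra. }
    apply Rle_trans with (3 * Rpower T (xi * (1 - sig)) / T * (131 * (1 + ln T)) *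
       (Rpower T (2 * sig - 1 + k) * H2)).
    + apply Rmult_le_compat; [|exact B0| |exact HB].
      * apply Rmult_le_pos; [|exact LB0]; left; apply Rdiv_lt_0_compat; lra.
      * apply Rmult_le_compat; [left; apply Rdiv_lt_0_compat; lra|exact LB0| |exact LB].
        apply Rmult_le_compat_r; [left; apply Rinv_0_lt_compat; lra|exact HY].
    + replace (/ T) with (Rpower T (- (1))) by (rewrite Rpower_Ropp, Rpower_1; lra).
      unfold Rdiv; rewrite <- (Rpower_1 T) at 2 by lra; rewrite <- Rpower_Ropp.
      replace (3 * Rpower T (xi * (1 - sig)) * Rpower T (- (1)) * (131 * (1 + ln T)) *
        (Rpower T (2 * sig - 1 + k) * H2)) with
        (3 * 131 * (1 + ln T) * (Rpower T (xi * (1 - sig)) * Rpower T (- (1)) *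
           Rpower T (2 * sig - 1 + k)) * H2) by ring.
      rewrite <- !Rpower_plus.
      replace (xi * (1 - sig) + - (1) + (2 * sig - 1 + k)) with (- k) by lra.
      rewrite (Rmult_comm H2); apply Rmult_le_compat_r; lra.
  - fold Y.
    assert (YT : Y / T <= 3 * Rpower T (- (sig - 1 / 2))).
    { apply Rle_trans with (3 * Rpower T (xi * (1 - sig)) * Rpower T (- (1))).
      - rewrite Rpower_Ropp, Rpower_1 by lra.
        apply Rmult_le_compat_r; [left; apply Rinv_0_lt_compat; lra|exact HY].
      - rewrite Rmult_assoc, <- Rpower_plus; apply Rmult_le_compat_l; [lra|].
        apply Rpower_le_exp; [exact T1|nra]. }
    assert (TN : 8 * (1 + T) * Rpower (INR N) (- sig) <= 16 * Rpower T (- (sig - 1 / 2))).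
    { apply Rle_trans with (16 * T * Rpower T (- sig - 1 / 2)).
      - apply Rmult_le_compat; lra.
      - rewrite <- (Rpower_1 T) at 1 by lra; rewrite Rmult_assoc, <- Rpower_plus.
        right; do 2 f_equal; lra. }
    assert (Z := Rpower_pos T (- (sig - 1 / 2))); nra.
Qed.

(** At s = 1 the power N^(1-s) is 1, so the pole contributes 1/A beyond [A]. The constant A = 2048
    uses half of the allowed 1/1024, and only ln (1 + ln T) remains of the logarithms. *)
Lemma resonance_bound_one :
  exists T0 c, 1 <= T0 /\ 0 < c /\ forall T M nu r,
  T0 <= T -> 0 <= M -> (1 <= nu)%nat -> (forall n, 0 <= r n) ->
  (forall t, 1 <= t <= T -> Cmod (zeta (1, t)) <= M) ->
  mass nu r * mass nu (dconv 1 r) * (1 + ln (1 + ln T)) <= c * T * energy nu (dconv 1 r) ->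
  sqrt (energy nu (dconv 1 r)) <= 256 * M * sqrt (energy nu r).
Proof.
  set (K := 27 + 26 * ln 2048 + 26 * 4).
  assert (l2048 : 0 <= ln 2048) by (apply ln_ge0; lra).
  destruct (log_Rpower_small (1 / 2) 16 (1 / 2048) ltac:(lra) ltac:(lra) ltac:(lra)) as [Tc [Tc1 HTc]].
  exists Tc, (/ (128 * K)).
  assert (K0 : 27 <= K) by (unfold K; lra).
  assert (c0 : 0 < / (128 * K)) by (apply Rinv_0_lt_compat; lra).
  assert (c1 : / (128 * K) <= 1 / 4).
  { replace (1 / 4) with (/ 4) by field; apply Rinv_le_contravar; lra. }
  split; [exact Tc1|split; [exact c0|]]; intros T M nu r HT M0 Hnu r0 HM HB.
  specialize (HTc T HT).
  assert (T1 : 1 <= T) by lra.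
  assert (lT := ln_ge0 T T1).
  assert (llT : 0 <= ln (1 + ln T)) by (apply ln_ge0; lra).
  destruct (exists_length T (3 / 2) T1 ltac:(lra)) as [N [N1 [N2 N3]]].
  assert (NR := INR_pos N N1).
  assert (HY : Rpower (INR (S N)) (1 - 1) = 1) by (rewrite Rminus_diag; apply Rpower_O, lt_0_INR; lia).
  assert (HN : Rpower (INR N) (- (1)) <= Rpower T (- (3 / 2))).
  { apply Rle_trans with (Rpower (Rpower T (3 / 2)) (- (1))).
    - apply Rpower_decr; [apply Rpower_pos|exact N2|lra].
    - rewrite Rpower_mult; right; f_equal; lra. }
  assert (lN : ln (INR N) <= 2 + 2 * ln T).
  { apply Rle_trans with (ln (3 * Rpower T (3 / 2))).
    - apply ln_le; [lra|]; rewrite S_INR in N3; lra.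
    - rewrite ln_mult by (lra || apply Rpower_pos); unfold Rpower; rewrite ln_exp.
      assert (ln 3 <= 2) by (assert (Z := exp_ineq1_le (ln 3)); rewrite exp_ln in Z; lra).
      nra. }
  assert (lN0 := ln_ge0 _ NR).
  assert (llN : ln (1 + ln (INR N)) <= 2 + ln (1 + ln T)).
  { apply Rle_trans with (ln (3 * (1 + ln T))); [apply ln_le; lra|].
    rewrite ln_mult by lra.
    assert (ln 3 <= 2) by (assert (Z := exp_ineq1_le (ln 3)); rewrite exp_ln in Z; lra). lra. }
  assert (llN0 : 0 <= ln (1 + ln (INR N))) by (apply ln_ge0; lra).
  assert (H20 := energy_ge0 nu (dconv 1 r)).
  set (H2 := energy nu (dconv 1 r)) in *.
  set (B := mass nu r * mass nu (dconv 1 r)) in *.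
  assert (B0 : 0 <= B).
  { apply Rmult_le_pos; apply mass_ge0; trivial; intros; now apply dconv_ge0. }
  assert (PN := Rpower_pos (INR N) (- (1))).
  assert (BT : B <= / (128 * K) * T * H2) by nra.
  apply resonance_bound with (N := N) (T := T) (A := 2048) (sig := 1); trivial; try lra.
  - fold B H2.
    apply Rle_trans with (/ T * (/ (128 * K) * T * H2)).
    + apply Rmult_le_compat; try lra.
      eapply Rle_trans; [exact HN|].
      rewrite <- (Rpower_1 T) at 2 by lra; rewrite <- Rpower_Ropp; apply Rpower_le_exp; lra.
    + replace (/ T * (/ (128 * K) * T * H2)) with (/ (128 * K) * H2) by (field; lra); nra.
  - rewrite HY; fold B H2.
    assert (LB : 27 + 26 * ln 2048 + 26 * ln (1 + ln (INR N)) <= K * (1 + ln (1 + ln T))).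
    { unfold K in *; nra. }
    apply Rle_trans with (/ T * (K * (B * (1 + ln (1 + ln T))))).
    + unfold Rdiv; rewrite Rmult_1_l, Rmult_assoc; apply Rmult_le_compat_l.
      { left; apply Rinv_0_lt_compat; lra. }
      replace (K * (B * (1 + ln (1 + ln T)))) with (K * (1 + ln (1 + ln T)) * B) by ring.
      apply Rmult_le_compat_r; assumption.
    + apply Rle_trans with (/ T * (K * (/ (128 * K) * T * H2))).
      * apply Rmult_le_compat_l; [left; apply Rinv_0_lt_compat; lra|].
        apply Rmult_le_compat_l; lra.
      * right; field; lra.
  - rewrite HY.
    assert (TN : 8 * (1 + T) * Rpower (INR N) (- (1)) <= 16 * Rpower T (- (1 / 2))).
    { apply Rle_trans with (16 * T * Rpower T (- (3 / 2))).
      - apply Rmult_le_compat; lra.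
      - rewrite <- (Rpower_1 T) at 1 by lra; rewrite Rmult_assoc, <- Rpower_plus.
        right; do 2 f_equal; lra. }
    assert (Z := Rpower_pos T (- (1 / 2))); nra.
Qed.

(** * Divisor sums *)

(** The left side runs over the pairs (m, k) with m k dividing [nu], the right side over all pairs
    of divisors. *)
Lemma sum_conv_le nu f g : (1 <= nu)%nat -> (forall m, 0 <= f m) -> (forall k, 0 <= g k) ->
  sum_over (divisors nu) (fun n => sum_over (divisors n) (fun m => f m * g (n / m)%nat)) <=
  sum_over (divisors nu) f * sum_over (divisors nu) g.
Proof.
  intros Hnu f0 g0.
  rewrite (sum_over_ext _ _ (fun n => sum_over (seq 1 nu) (fun m =>
     f m * (if Nat.eqb (n mod m) 0 then g (n / m)%nat else 0)))).
  2:{ intros n Hn; assert (n1 := divisors_pos _ _ Hn).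
      apply in_divisors, Nat.divide_pos_le in Hn; [|lia|exact Hnu].
      rewrite (sum_divisors_seq n nu) by lia; apply sum_over_ext; intros m _.
      destruct (Nat.eqb _ _); ring. }
  rewrite sum_over_swap, (sum_divisors_seq nu nu f), <- sum_over_scal_r by lia.
  apply sum_over_le; intros m Hm; apply in_seq in Hm; rewrite sum_over_scal.
  rewrite <- sum_over_filter.
  destruct (Nat.eqb_spec (nu mod m) 0) as [Hd|Hd].
  - apply Rmult_le_compat_l; [apply f0|].
    apply (sum_over_inj_le _ _ (fun n => n / m)%nat); [apply NoDup_filter, NoDup_divisors| | |auto].
    + intros x y; rewrite !filter_In, !Nat.eqb_eq; intros [_ Hx] [_ Hy] E.
      rewrite (Nat.div_mod_eq x m), (Nat.div_mod_eq y m), Hx, Hy, E; reflexivity.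
    + intros x; rewrite filter_In, Nat.eqb_eq; intros [Hx Ex].
      assert (E := Nat.div_mod_eq x m); rewrite Ex in E.
      rewrite in_divisors in * by exact Hnu.
      apply Nat.divide_trans with x; [exists m; lia|exact Hx].
  - rewrite (sum_over_eq0 (filter _ _)); [rewrite Rmult_0_r, Rmult_0_l; right; reflexivity|].
    intros n; rewrite filter_In, Nat.eqb_eq; intros [Hn En]; exfalso; apply Hd.
    apply in_divisors in Hn; [|exact Hnu].
    apply Nat.mod_divide; [lia|]; apply Nat.divide_trans with n; [|exact Hn].
    apply Nat.mod_divide; [lia|exact En].
Qed.

Lemma mass_dconv_le nu sig r : (1 <= nu)%nat -> (forall n, 0 <= r n) ->
  mass nu (dconv sig r) <= divisor_sigma (- sig) nu * mass nu r.
Proof.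
  intros Hnu r0; apply (sum_conv_le nu (fun m => Rpower (INR m) (- sig)) r); trivial.
  intros; left; apply Rpower_pos.
Qed.

(** Cauchy-Schwarz with the weights r(n/m) moves the exponent to 2 sig > 1, where the divisor sum is
    bounded by zeta. It limits how small the left side of the condition on T can be. *)
Lemma energy_dconv_le_mass nu sig r : (1 <= nu)%nat -> (forall n, 0 <= r n) ->
  energy nu (dconv sig r) <= divisor_sigma (- (2 * sig)) nu * mass nu r ^ 2.
Proof.
  intros Hnu r0; unfold energy.
  assert (R0 := mass_ge0 nu r r0).
  apply Rle_trans with (sum_over (divisors nu) (fun n => mass nu r *
     sum_over (divisors n) (fun m => Rpower (INR m) (- (2 * sig)) * r (n / m)%nat))).
  - apply sum_over_le; intros n Hn; assert (n1 := divisors_pos _ _ Hn).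
    assert (CS := Cauchy_Schwarz_sum (divisors n)
      (fun m => sqrt (r (n / m)%nat)) (fun m => Rpower (INR m) (- sig) * sqrt (r (n / m)%nat))).
    cbv beta in CS.
    rewrite (sum_over_ext _ _ (fun m => Rpower (INR m) (- sig) * r (n / m)%nat)) in CS.
    2:{ intros m _; rewrite <- (sqrt_def (r (n / m)%nat)) at 3 by auto; ring. }
    eapply Rle_trans; [exact CS|]; apply Rmult_le_compat.
    + apply sum_over_ge0; intros; apply pow2_ge_0.
    + apply sum_over_ge0; intros; apply pow2_ge_0.
    + rewrite (sum_over_ext _ _ (fun m => r (n / m)%nat)) by (intros; apply pow2_sqrt; auto).
      eapply Rle_trans; [apply sum_codivisors_le; auto|].
      apply sum_over_incl; [apply NoDup_divisors| |auto].
      apply incl_divisors; [exact Hnu|now apply in_divisors in Hn].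
    + right; apply sum_over_ext; intros m _.
      rewrite Rpow_mult_distr, pow2_sqrt by auto; f_equal.
      simpl; rewrite Rmult_1_r, <- Rpower_plus; f_equal; ring.
  - rewrite sum_over_scal.
    assert (SC := sum_conv_le nu (fun m => Rpower (INR m) (- (2 * sig))) r Hnu
      (fun m => Rlt_le _ _ (Rpower_pos _ _)) r0).
    fold (mass nu r) in SC; unfold divisor_sigma; simpl; nra.
Qed.

(** Young's inequality, by Cauchy-Schwarz with the weights m^(-sig); it is useful for sig > 1, where
    their sum is bounded by zeta(sig). *)
Lemma energy_dconv_le_energy nu sig r : (1 <= nu)%nat -> (forall n, 0 <= r n) ->
  energy nu (dconv sig r) <= divisor_sigma (- sig) nu ^ 2 * energy nu r.
Proof.
  intros Hnu r0; unfold energy.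
  set (D := divisor_sigma (- sig) nu).
  assert (D0 : 0 <= D) by (apply sum_over_ge0; intros; left; apply Rpower_pos).
  apply Rle_trans with (sum_over (divisors nu) (fun n => D *
     sum_over (divisors n) (fun m => Rpower (INR m) (- sig) * r (n / m)%nat ^ 2))).
  - apply sum_over_le; intros n Hn; assert (n1 := divisors_pos _ _ Hn).
    assert (CS := Cauchy_Schwarz_sum (divisors n)
      (fun m => sqrt (Rpower (INR m) (- sig)))
      (fun m => sqrt (Rpower (INR m) (- sig)) * r (n / m)%nat)).
    cbv beta in CS.
    assert (P : forall m, 0 <= Rpower (INR m) (- sig)) by (intros; left; apply Rpower_pos).
    rewrite (sum_over_ext _ _ (fun m => Rpower (INR m) (- sig) * r (n / m)%nat)) in CS.
    2:{ intros m _; rewrite <- (sqrt_def (Rpower (INR m) (- sig))) at 3 by auto; ring. }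
    eapply Rle_trans; [exact CS|]; apply Rmult_le_compat.
    + apply sum_over_ge0; intros; apply pow2_ge_0.
    + apply sum_over_ge0; intros; apply pow2_ge_0.
    + rewrite (sum_over_ext _ _ (fun m => Rpower (INR m) (- sig))) by (intros; apply pow2_sqrt; auto).
      apply sum_over_incl; [apply NoDup_divisors| |auto].
      apply incl_divisors; [exact Hnu|now apply in_divisors in Hn].
    + right; apply sum_over_ext; intros m _.
      rewrite Rpow_mult_distr, pow2_sqrt by auto; reflexivity.
  - rewrite sum_over_scal.
    assert (SC := sum_conv_le nu (fun m => Rpower (INR m) (- sig)) (fun k => r k ^ 2) Hnu
      (fun m => Rlt_le _ _ (Rpower_pos _ _)) (fun k => pow2_ge_0 _)).
    fold (divisor_sigma (- sig) nu) in SC; fold D in SC; simpl in *; nra.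
Qed.

(** The weight is completely multiplicative, so r(n/m) = r(n) m^e. *)
Lemma dconv_power sig e n : (1 <= n)%nat ->
  dconv sig (fun k => Rpower (INR k) (- e)) n =
  Rpower (INR n) (- e) * divisor_sigma (- sig + e) n.
Proof.
  intros Hn; unfold dconv, divisor_sigma; rewrite <- sum_over_scal.
  apply sum_over_ext; intros m Hm; assert (m1 := INR_pos m (divisors_pos _ _ Hm)).
  assert (E := divisor_mul_div n m Hn Hm).
  assert (k1 : (1 <= n / m)%nat) by (destruct (n / m)%nat; lia).
  apply INR_pos in k1; rewrite <- E at 2; rewrite mult_INR, <- Rpower_mult_distr by lra.
  rewrite Rpower_plus.
  replace (Rpower (INR m) (- e) * Rpower (INR (n / m)) (- e) * (Rpower (INR m) (- sig) * Rpower (INR m) e))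
   with (Rpower (INR m) (- sig) * Rpower (INR (n / m)) (- e) * (Rpower (INR m) (- e) * Rpower (INR m) e)) by ring.
  rewrite <- (Rpower_plus (- e) e), Rplus_opp_l, Rpower_O by lra; ring.
Qed.

Lemma resonance_sum_energy s e nu :
  resonance_sum s e nu = energy nu (dconv s (fun n => Rpower (INR n) (- e))).
Proof.
  apply sum_over_ext; intros n Hn; apply divisors_pos in Hn.
  rewrite dconv_power, Rpow_mult_distr by exact Hn.
  unfold Rdiv; rewrite <- Rpower_Ropp, Rmult_comm; f_equal.
  simpl; rewrite Rmult_1_r, <- Rpower_plus; f_equal; ring.
Qed.

Lemma divisor_sigma_energy e nu :
  divisor_sigma (- (2 * e)) nu = energy nu (fun n => Rpower (INR n) (- e)).
Proof.
  apply sum_over_ext; intros n Hn; simpl; rewrite Rmult_1_r, <- Rpower_plus; f_equal; ring.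
Qed.

Lemma divisor_sigma_le u v nu : u <= v -> divisor_sigma u nu <= divisor_sigma v nu.
Proof.
  intros H; apply sum_over_le; intros n Hn; apply divisors_pos, INR_pos in Hn.
  now apply Rpower_le_exp.
Qed.

Lemma divisor_sigma_ge_term u nu d : In d (divisors nu) -> Rpower (INR d) u <= divisor_sigma u nu.
Proof.
  intros H; apply (sum_over_term_le _ (fun d => Rpower (INR d) u) d H).
  intros; left; apply Rpower_pos.
Qed.

Lemma divisor_sigma_ge1 u nu : (1 <= nu)%nat -> 1 <= divisor_sigma u nu.
Proof.
  intros H; apply Rle_trans with (Rpower (INR 1) u).
  - simpl; unfold Rpower; rewrite ln_1, Rmult_0_r, exp_0; lra.
  - apply divisor_sigma_ge_term, in_divisors; [exact H|apply Nat.divide_1_l].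
Qed.

Lemma divisor_sigma_incl u nu nu' : (1 <= nu)%nat -> Nat.divide nu' nu ->
  divisor_sigma u nu' <= divisor_sigma u nu.
Proof.
  intros H D; apply sum_over_incl; [apply NoDup_divisors|now apply incl_divisors|].
  intros; left; apply Rpower_pos.
Qed.

(* For [a <= b] the first summand dominates, otherwise the second. *)
Lemma divisor_sigma_product s e nu : s <= 1 -> e <= 1 ->
  divisor_sigma (- s) nu * divisor_sigma (- e) nu <=
  2 * (divisor_sigma (- (1)) nu * divisor_sigma (1 - s - e) nu).
Proof.
  intros Hs He.
  replace (2 * _) with (divisor_sigma (- (1)) nu * divisor_sigma (1 - s - e) nu +
    divisor_sigma (1 - s - e) nu * divisor_sigma (- (1)) nu) by ring.
  unfold divisor_sigma; rewrite !sum_over_mult, <- sum_over_plus.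
  apply sum_over_le; intros a Ha; rewrite <- sum_over_plus.
  apply sum_over_le; intros b Hb.
  apply divisors_pos, INR_pos in Ha; apply divisors_pos, INR_pos in Hb.
  set (x := INR a) in *; set (y := INR b) in *.
  assert (Px := fun c => Rpower_pos x c); assert (Py := fun c => Rpower_pos y c).
  destruct (Rle_dec x y) as [H|H].
  - replace (- s) with (- (1) + (1 - s)) by ring; rewrite Rpower_plus.
    replace (1 - s - e) with ((1 - s) + - e) by ring; rewrite (Rpower_plus (1 - s) (- e) y).
    assert (Rpower x (1 - s) <= Rpower y (1 - s)) by (apply Rle_Rpower_l; lra).
    assert (K : Rpower x (- (1)) * Rpower x (1 - s) * Rpower y (- e) <=
            Rpower x (- (1)) * (Rpower y (1 - s) * Rpower y (- e))).
    { rewrite Rmult_assoc; apply Rmult_le_compat_l; [left; apply Px|].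
      apply Rmult_le_compat_r; [left; apply Py|assumption]. }
    assert (0 < Rpower x (1 - s + - e) * Rpower y (- (1))) by (apply Rmult_lt_0_compat; auto).
    lra.
  - replace (- e) with (- (1) + (1 - e)) at 1 by ring; rewrite (Rpower_plus (- (1)) (1 - e) y).
    replace (1 - s - e) with ((1 - e) + - s) by ring; rewrite (Rpower_plus (1 - e) (- s) x).
    assert (Rpower y (1 - e) <= Rpower x (1 - e)) by (apply Rle_Rpower_l; lra).
    assert (K : Rpower x (- s) * (Rpower y (- (1)) * Rpower y (1 - e)) <=
            Rpower x (1 - e) * Rpower x (- s) * Rpower y (- (1))).
    { replace (Rpower x (- s) * (Rpower y (- (1)) * Rpower y (1 - e))) with
        (Rpower x (- s) * Rpower y (- (1)) * Rpower y (1 - e)) by ring.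
      replace (Rpower x (1 - e) * Rpower x (- s) * Rpower y (- (1))) with
        (Rpower x (- s) * Rpower y (- (1)) * Rpower x (1 - e)) by ring.
      apply Rmult_le_compat_l; [|assumption].
      left; apply Rmult_lt_0_compat; auto. }
    assert (0 < Rpower x (- (1)) * Rpower y (1 - e + - s)) by (apply Rmult_lt_0_compat; auto).
    lra.
Qed.

(** * Divisor sums compared with zeta on the real axis *)

Lemma sum_over_sum_n f N : sum_over (seq 1 (S N)) f = sum_n (fun n => f (S n)) N.
Proof.
  induction N as [|N IH]; [rewrite sum_O; unfold sum_over; simpl; ring|].
  rewrite seq_S, sum_over_app, IH, sum_Sn.
  rewrite sum_over_cons; change (sum_over nil f) with 0; unfold plus; simpl; ring.
Qed.

Lemma is_Cseries_Re (a : nat -> C) (l : C) : is_Cseries a l -> is_series (fun n => Re (a n)) (Re l).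
Proof.
  intros H; eapply filterlim_ext; [intros n; symmetry; apply sum_n_Re|].
  eapply filterlim_comp; [exact H|]; intros P [e He]; exists e; intros y Hy.
  apply He, Hy.
Qed.

Lemma zeta_real_series x : 1 < x ->
  is_series (fun n => Rpower (INR (S n)) (- x)) (Re (zeta (RtoC x))).
Proof.
  intros Hx; assert (H := is_Cseries_Re _ _ (zeta_dirichlet (RtoC x) Hx)).
  eapply is_series_ext; [|exact H]; intros n; cbv beta.
  rewrite <- RtoC_opp, cpow_RtoC; reflexivity.
Qed.

Lemma partial_sum_le_series (a : nat -> R) l N :
  (forall n, 0 <= a n) -> is_series a l -> sum_n a N <= l.
Proof.
  intros a0 H; apply (is_lim_seq_incr_compare (sum_n a)); [exact H|].
  intros n; rewrite sum_Sn; unfold plus; simpl; specialize (a0 (S n)); lra.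
Qed.

Lemma sum_power_le_zeta x N : 1 < x ->
  sum_over (seq 1 N) (fun m => Rpower (INR m) (- x)) <= Re (zeta (RtoC x)).
Proof.
  intros Hx.
  apply Rle_trans with (sum_over (seq 1 (S N)) (fun m => Rpower (INR m) (- x))).
  - apply sum_over_incl; [apply seq_NoDup| |intros; left; apply Rpower_pos].
    intros m; rewrite !in_seq; lia.
  - rewrite sum_over_sum_n; apply partial_sum_le_series; [intros; left; apply Rpower_pos|].
    now apply zeta_real_series.
Qed.

Lemma divisor_sigma_le_zeta x nu : 1 < x -> divisor_sigma (- x) nu <= Re (zeta (RtoC x)).
Proof.
  intros Hx; eapply Rle_trans; [|apply (sum_power_le_zeta x nu Hx)].
  apply sum_over_incl; [apply NoDup_divisors| |intros; left; apply Rpower_pos].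
  intros d Hd; unfold divisors in Hd; now apply filter_In in Hd.
Qed.

Lemma zeta_ge1 x : 1 < x -> 1 <= Re (zeta (RtoC x)).
Proof.
  intros Hx; eapply Rle_trans; [|apply (divisor_sigma_le_zeta x 1 Hx)].
  now apply divisor_sigma_ge1.
Qed.

Lemma zeta_le x : 1 < x -> Re (zeta (RtoC x)) <= 1 + / (x - 1).
Proof.
  intros Hx; assert (H := zeta_real_series x Hx).
  assert (I : 0 < / (x - 1)) by (apply Rinv_0_lt_compat; lra).
  apply (is_lim_seq_le (sum_n (fun n => Rpower (INR (S n)) (- x))) (fun _ => 1 + / (x - 1))
           (Finite (Re (zeta (RtoC x)))) (Finite (1 + / (x - 1)))); [|exact H|apply is_lim_seq_const].
  intros n; rewrite <- (sum_over_sum_n (fun m => Rpower (INR m) (- x))).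
  change (seq 1 (S n)) with (1%nat :: seq 2 n); rewrite sum_over_cons.
  assert (O : forall c, Rpower (INR 1) c = 1).
  { intros; simpl; unfold Rpower; rewrite ln_1, Rmult_0_r; apply exp_0. }
  assert (S := sum_Rpower_seq 1 n (x - 1) ltac:(lia) ltac:(lra)).
  replace (- 1 - (x - 1)) with (- x) in S by ring.
  rewrite O in *; lra.
Qed.

(** * Divisors and powers of a prime *)

Lemma nat_prime_mul q a b : nat_prime q -> Nat.divide q (a * b) -> Nat.divide q a \/ Nat.divide q b.
Proof.
  intros [q2 Hq] H; destruct (Hq (Nat.gcd q a) (Nat.gcd_divide_l q a)) as [E|E].
  - right; apply Nat.gauss with a; assumption.
  - left; rewrite <- E; apply Nat.gcd_divide_r.
Qed.

Lemma nat_prime_pow_divide q k d x : nat_prime q -> ~ Nat.divide q x ->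
  Nat.divide (q ^ k) (d * x) -> Nat.divide (q ^ k) d.
Proof.
  intros Hq Hx; assert (q2 := proj1 Hq).
  revert d; induction k as [|k IH]; intros d H; [apply Nat.divide_1_l|].
  rewrite Nat.pow_succ_r' in *.
  destruct (nat_prime_mul q d x Hq) as [[d' ->]|]; [|rewrite (Nat.mul_comm d' q)|contradiction].
  - eapply Nat.divide_trans; [apply Nat.divide_factor_l|exact H].
  - apply Nat.mul_divide_mono_l, IH.
    apply Nat.mul_divide_cancel_l with q; [lia|].
    replace (q * (d' * x))%nat with (d' * q * x)%nat by ring; exact H.
Qed.

Lemma pow_ge1 q k : (1 <= q)%nat -> (1 <= q ^ k)%nat.
Proof. intros; assert (q ^ k <> 0)%nat by (apply Nat.pow_nonzero; lia); lia. Qed.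

(** This permits induction on the exponent of [q]: a new divisor contains q^(a+1) exactly, times a
    divisor of [n]. *)
Lemma divisors_prime_pow q a n : nat_prime q -> (1 <= n)%nat -> ~ Nat.divide q n ->
  Permutation (divisors (q ^ S a * n))
              (divisors (q ^ a * n) ++ map (Nat.mul (q ^ S a)) (divisors n)).
Proof.
  intros Hq Hn Hqn; assert (q2 := proj1 Hq).
  assert (P1 := pow_ge1 q a ltac:(lia)); assert (P2 := pow_ge1 q (S a) ltac:(lia)).
  assert (Q1 : (1 <= q ^ a * n)%nat) by nia; assert (Q2 : (1 <= q ^ S a * n)%nat) by nia.
  apply NoDup_Permutation; [apply NoDup_divisors| |].
  - apply NoDup_app; [apply NoDup_divisors| |].
    + apply FinFun.Injective_map_NoDup; [|apply NoDup_divisors].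
      intros x y E; nia.
    + intros d Hd Hd'; apply in_map_iff in Hd'; destruct Hd' as [e [<- He]].
      apply in_divisors in Hd; [|exact Q1]; apply Hqn.
      rewrite Nat.pow_succ_r' in Hd.
      assert (H : Nat.divide (q ^ a * (q * e)) (q ^ a * n)).
      { replace (q ^ a * (q * e))%nat with (q * q ^ a * e)%nat by ring; exact Hd. }
      apply Nat.mul_divide_cancel_l in H; [|lia].
      eapply Nat.divide_trans; [apply Nat.divide_factor_l|exact H].
  - intros d; rewrite in_app_iff, in_map_iff, !in_divisors by assumption; split.
    + intros H; assert (H' := H); destruct H as [x E].
      destruct (classic (Nat.divide q x)) as [[y ->]|Nx].
      * left; exists y; rewrite Nat.pow_succ_r' in E; nia.
      * right; destruct (nat_prime_pow_divide q (S a) d x Hq Nx) as [e Ee].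
        { exists n; nia. }
        exists e; split; [lia|]; apply in_divisors; [exact Hn|].
        rewrite Ee in H'; apply Nat.mul_divide_cancel_l with (q ^ S a)%nat; [lia|].
        rewrite Nat.mul_comm; exact H'.
    + intros [H|[e [<- He]]].
      * apply Nat.divide_trans with (q ^ a * n)%nat; [exact H|].
        rewrite Nat.pow_succ_r'; exists q; ring.
      * apply in_divisors in He; [|exact Hn]; now apply Nat.mul_divide_mono_l.
Qed.

Lemma sum_divisors_prime_pow q a n f : nat_prime q -> (1 <= n)%nat -> ~ Nat.divide q n ->
  sum_over (divisors (q ^ S a * n)) f =
  sum_over (divisors (q ^ a * n)) f + sum_over (divisors n) (fun d => f (q ^ S a * d)%nat).
Proof.
  intros Hq Hn Hqn.
  rewrite (sum_over_Permutation _ _ f (divisors_prime_pow q a n Hq Hn Hqn)).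
  now rewrite sum_over_app, sum_over_map.
Qed.

Lemma divisor_sigma_prime_pow u q a n : nat_prime q -> (1 <= n)%nat -> ~ Nat.divide q n ->
  divisor_sigma u (q ^ S a * n) =
  divisor_sigma u (q ^ a * n) + Rpower (INR (q ^ S a)) u * divisor_sigma u n.
Proof.
  intros Hq Hn Hqn; unfold divisor_sigma.
  rewrite (sum_divisors_prime_pow q a n _ Hq Hn Hqn); f_equal.
  rewrite <- sum_over_scal; apply sum_over_ext; intros d Hd; apply divisors_pos in Hd.
  rewrite mult_INR, Rpower_mult_distr; [reflexivity| |]; apply lt_0_INR; [|lia].
  apply pow_ge1; destruct Hq; lia.
Qed.

Lemma prime_split q n : nat_prime q -> (1 <= n)%nat ->
  exists a n', n = (q ^ a * n')%nat /\ (1 <= n')%nat /\ ~ Nat.divide q n'.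
Proof.
  intros Hq; assert (q2 := proj1 Hq).
  induction n as [n IH] using (well_founded_induction Wf_nat.lt_wf); intros Hn.
  destruct (classic (Nat.divide q n)) as [[k E]|N].
  - destruct (IH k) as [a [n' [Ek [H1 H2]]]]; [nia|nia|].
    exists (S a), n'; split; [|tauto].
    rewrite E, Ek, Nat.pow_succ_r'; ring.
  - exists 0%nat, n; simpl; rewrite Nat.add_0_r; tauto.
Qed.

Lemma exists_prime_divisor n : (2 <= n)%nat -> exists p, nat_prime p /\ Nat.divide p n.
Proof.
  induction n as [n IH] using (well_founded_induction Wf_nat.lt_wf); intros Hn.
  destruct (classic (nat_prime n)) as [P|P]; [exists n; split; [exact P|apply Nat.divide_refl]|].
  destruct (classic (exists d, Nat.divide d n /\ d <> 1%nat /\ d <> n)) as [[d [Hd [d1 dn]]]|N].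
  - assert (d <= n)%nat by (apply Nat.divide_pos_le; [lia|exact Hd]).
    assert (d <> 0%nat) by (intros ->; destruct Hd; lia).
    destruct (IH d) as [p [Pp Hp]]; [lia|lia|].
    exists p; split; [exact Pp|now apply Nat.divide_trans with d].
  - exfalso; apply P; split; [exact Hn|]; intros d Hd.
    destruct (Nat.eq_dec d 1); [now left|]; destruct (Nat.eq_dec d n); [now right|].
    exfalso; apply N; now exists d.
Qed.

(** * The sum of the reciprocals of the divisors *)

(** The Euler factor 1 + 1/q + ... + q^(-a) is below q/(q - 1); the exact value, with q - q^(-a) in
    place of q, goes through the induction. *)
Lemma inverse_sigma_prime_pow q a n : nat_prime q -> (1 <= n)%nat -> ~ Nat.divide q n ->
  (INR q - 1) * divisor_sigma (- (1)) (q ^ a * n) <= INR q * divisor_sigma (- (1)) n.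
Proof.
  intros Hq Hn Hqn; assert (q2 : 2 <= INR q) by (change 2 with (INR 2); apply le_INR, Hq).
  assert (E : (INR q - 1) * divisor_sigma (- (1)) (q ^ a * n) =
              (INR q - / INR (q ^ a)) * divisor_sigma (- (1)) n).
  { induction a as [|a IH].
    - rewrite Nat.mul_1_l; simpl; rewrite Rinv_1; reflexivity.
    - rewrite divisor_sigma_prime_pow, Rmult_plus_distr_l, IH by assumption.
      assert (P : 0 < INR (q ^ a)) by (apply lt_0_INR, pow_ge1; destruct Hq; lia).
      rewrite Nat.pow_succ_r', mult_INR, Rpower_Ropp, Rpower_1 by nra; field; lra. }
  rewrite E; apply Rmult_le_compat_r.
  - assert (Z := divisor_sigma_ge1 (- (1)) n Hn); lra.
  - assert (0 < / INR (q ^ a)) by (apply Rinv_0_lt_compat, lt_0_INR, pow_ge1; destruct Hq; lia).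
    lra.
Qed.

(** An Euler factor satisfies (q/(q - 1))^2 <= q/(q - 2), and the product of q/(q - 2) over all odd
    q from 3 to 2k + 1, prime or not, telescopes to 2k + 1. *)
Lemma inverse_sigma_smooth k n : (1 <= n)%nat -> ~ Nat.divide 2 n ->
  (forall p, nat_prime p -> Nat.divide p n -> (p <= 2 * k + 1)%nat) ->
  divisor_sigma (- (1)) n ^ 2 <= INR (2 * k + 1).
Proof.
  revert n; induction k as [|k IH]; intros n Hn Odd Hp.
  - destruct (Nat.eq_dec n 1) as [->|N].
    + unfold divisor_sigma, divisors; simpl; unfold sum_over; simpl.
      unfold Rpower; rewrite ln_1, Rmult_0_r, exp_0; lra.
    + destruct (exists_prime_divisor n ltac:(lia)) as [p [Pp Hd]].
      specialize (Hp p Pp Hd); destruct Pp; lia.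
  - assert (K : INR (2 * S k + 1) = INR (2 * k + 1) + 2).
    { replace (2 * S k + 1)%nat with (2 * k + 1 + 2)%nat by lia; rewrite plus_INR; reflexivity. }
    assert (x1 : 1 <= INR (2 * k + 1)) by (apply INR_pos; lia).
    destruct (classic (nat_prime (2 * S k + 1) /\ Nat.divide (2 * S k + 1) n)) as [[Pq Hq]|N].
    + set (q := (2 * S k + 1)%nat) in *.
      destruct (prime_split q n Pq Hn) as [a [m [E [Hm Nm]]]].
      assert (Odd' : ~ Nat.divide 2 m).
      { intros D; apply Odd; rewrite E; apply Nat.divide_trans with m; [exact D|].
        apply Nat.divide_factor_r. }
      assert (H := IH m Hm Odd').
      assert (Q := inverse_sigma_prime_pow q a m Pq Hm Nm); rewrite <- E in Q.
      assert (Hs : divisor_sigma (- (1)) m ^ 2 <= INR (2 * k + 1)).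
      { apply H; intros p Pp Dp.
        assert (D : Nat.divide p n).
        { rewrite E; apply Nat.divide_trans with m; [exact Dp|apply Nat.divide_factor_r]. }
        assert (B := Hp p Pp D); fold q in B.
        assert (p <> q) by (intros ->; contradiction).
        assert (p <> 2 * k + 2)%nat; [|lia].
        intros ->; apply Odd'; apply Nat.divide_trans with (2 * k + 2)%nat; [|exact Dp].
        exists (k + 1)%nat; lia. }
      assert (Fm := divisor_sigma_ge1 (- (1)) m Hm); assert (Fn := divisor_sigma_ge1 (- (1)) n Hn).
      set (x := INR (2 * k + 1)) in *; rewrite K in *.
      set (f := divisor_sigma (- (1)) n) in *; set (g := divisor_sigma (- (1)) m) in *.
      assert (S : (x + 1) ^ 2 * f ^ 2 <= (x + 2) ^ 2 * g ^ 2).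
      { rewrite <- !Rpow_mult_distr; apply pow_incr; split; nra. }
      assert ((x + 2) ^ 2 * g ^ 2 <= (x + 2) ^ 2 * x) by (apply Rmult_le_compat_l; [apply pow2_ge_0|exact Hs]).
      apply Rmult_le_reg_l with ((x + 1) ^ 2); [nra|]; nra.
    + apply Rle_trans with (INR (2 * k + 1)); [|lra]; apply IH; trivial.
      intros p Pp Dp; assert (B := Hp p Pp Dp).
      assert (p <> 2 * S k + 1)%nat by (intros ->; tauto).
      assert (p <> 2 * k + 2)%nat; [|lia].
      intros ->; apply Odd, Nat.divide_trans with (2 * k + 2)%nat; [|exact Dp].
      exists (k + 1)%nat; lia.
Qed.

Lemma ln_2_ge_half : 1 / 2 <= ln 2.
Proof. assert (H := ln_lt_2); lra. Qed.

(** With K = 2k + 1, a prime beyond K multiplies the square by at most exp(2/K), and dividing it out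
    lowers ln n by at least ln 2 >= 1/2; hence the 4 in the exponent. *)
Lemma inverse_sigma_odd k n : (1 <= n)%nat -> ~ Nat.divide 2 n ->
  divisor_sigma (- (1)) n ^ 2 <= INR (2 * k + 1) * exp (4 * ln (INR n) / INR (2 * k + 1)).
Proof.
  set (K := INR (2 * k + 1)); assert (K1 : 1 <= K) by (apply INR_pos; lia).
  induction n as [n IH] using (well_founded_induction Wf_nat.lt_wf); intros Hn Odd.
  assert (ln0 : 0 <= ln (INR n)) by (apply ln_ge0, INR_pos, Hn).
  destruct (classic (exists p, nat_prime p /\ Nat.divide p n /\ (2 * k + 1 < p)%nat))
    as [[p [Pp [Dp Lp]]]|N].
  - destruct (prime_split p n Pp Hn) as [a [m [E [Hm Nm]]]].
    assert (a1 : a <> 0%nat) by (intros ->; rewrite Nat.mul_1_l in E; subst m; contradiction).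
    assert (Odd' : ~ Nat.divide 2 m).
    { intros D; apply Odd; rewrite E; apply Nat.divide_trans with m; [exact D|].
      apply Nat.divide_factor_r. }
    assert (P2 : (2 <= p ^ a)%nat).
    { destruct a; [lia|]; rewrite Nat.pow_succ_r'.
      assert (1 <= p ^ a)%nat by (apply pow_ge1; lia); destruct Pp; nia. }
    assert (H := IH m ltac:(nia) Hm Odd').
    assert (Q := inverse_sigma_prime_pow p a m Pp Hm Nm); rewrite <- E in Q.
    assert (Fm := divisor_sigma_ge1 (- (1)) m Hm); assert (Fn := divisor_sigma_ge1 (- (1)) n Hn).
    set (f := divisor_sigma (- (1)) n) in *; set (g := divisor_sigma (- (1)) m) in *.
    assert (Kp : K + 1 <= INR p) by (unfold K; rewrite <- S_INR; apply le_INR; lia).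
    assert (iK : 0 < / K) by (apply Rinv_0_lt_compat; lra).
    assert (EX := exp_ineq1_le (/ K)).
    assert (fg : f <= exp (/ K) * g).
    { assert (f <= (1 + / K) * g); [|nra].
      apply Rmult_le_reg_l with (INR p - 1); [lra|].
      eapply Rle_trans; [exact Q|].
      replace ((INR p - 1) * ((1 + / K) * g)) with ((INR p - 1 + (INR p - 1) * / K) * g) by ring.
      apply Rmult_le_compat_r; [lra|].
      assert (1 <= (INR p - 1) * / K); [|lra].
      apply Rmult_le_reg_r with K; [lra|]; rewrite Rmult_assoc, Rinv_l by lra; lra. }
    assert (f2 : f ^ 2 <= exp (2 * / K) * g ^ 2).
    { replace (exp (2 * / K)) with (exp (/ K) ^ 2).
      - rewrite <- Rpow_mult_distr; apply pow_incr; split; [lra|exact fg].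
      - simpl; rewrite Rmult_1_r, <- exp_plus; f_equal; ring. }
    apply Rle_trans with (exp (2 * / K) * (K * exp (4 * ln (INR m) / K))).
    + eapply Rle_trans; [exact f2|]; apply Rmult_le_compat_l; [left; apply exp_pos|exact H].
    + replace (exp (2 * / K) * (K * exp (4 * ln (INR m) / K))) with
        (K * exp (2 * / K + 4 * ln (INR m) / K)) by (rewrite exp_plus; ring).
      apply Rmult_le_compat_l; [lra|]; apply exp_le_compat.
      assert (Hm0 := INR_pos m Hm).
      assert (L : 1 / 2 + ln (INR m) <= ln (INR n)).
      { apply Rle_trans with (ln 2 + ln (INR m)); [assert (Z := ln_2_ge_half); lra|].
        rewrite <- ln_mult by lra; apply ln_le; [lra|].
        change 2 with (INR 2); rewrite <- mult_INR; apply le_INR; nia. }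
      unfold Rdiv; nra.
  - apply Rle_trans with K.
    + apply inverse_sigma_smooth; trivial.
      intros p Pp Dp; destruct (Nat.le_gt_cases p (2 * k + 1)); trivial.
      exfalso; apply N; now exists p.
    + assert (1 <= exp (4 * ln (INR n) / K)); [|nra].
      rewrite <- exp_0; apply exp_le_compat.
      apply Rmult_le_pos; [lra|left; apply Rinv_0_lt_compat; lra].
Qed.

(* All primes but one being odd, the product of [p / (p - 1)] over [k] primes is [O (sqrt k)], and
   [n] has [O (ln n)] prime factors. *)
Lemma inverse_sigma_bound : exists K, 0 < K /\ forall n, (1 <= n)%nat ->
  divisor_sigma (- (1)) n <= K * sqrt (1 + ln (INR n)).
Proof.
  exists (2 * sqrt (3 * exp 4)).
  assert (E4 := exp_pos 4).
  assert (P := sqrt_lt_R0 (3 * exp 4) ltac:(lra)); split; [lra|]; intros n Hn.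
  assert (P2 : nat_prime 2).
  { split; [lia|]; intros d Hd; assert (d <= 2)%nat by (apply Nat.divide_pos_le; [lia|exact Hd]).
    destruct d as [|[|[|]]]; [destruct Hd; lia|now left|now right|lia]. }
  destruct (prime_split 2 n P2 Hn) as [a [m [E [Hm Nm]]]].
  assert (Q := inverse_sigma_prime_pow 2 a m P2 Hm Nm); rewrite <- E in Q; simpl INR in Q.
  assert (l0 := ln_ge0 _ (INR_pos n Hn)).
  assert (lm : 0 <= ln (INR m) <= ln (INR n)).
  { split; [apply ln_ge0, INR_pos, Hm|apply ln_le; [apply INR_pos in Hm; lra|]].
    apply le_INR; rewrite E; assert (1 <= 2 ^ a)%nat by (apply pow_ge1; lia); nia. }
  (* The cutoff [K] then lies between 1 + ln n and 3 + ln n, so the exponential is bounded while [K]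
     itself is O(1 + ln n). *)
  destruct (nfloor_ex (ln (INR n) / 2) ltac:(lra)) as [k Hk].
  assert (B := inverse_sigma_odd (S k) m Hm Nm).
  set (K := INR (2 * S k + 1)) in *.
  assert (EK : K = 2 * INR k + 3).
  { unfold K; replace (2 * S k + 1)%nat with (k + k + 3)%nat by lia; rewrite !plus_INR; simpl (INR 3); ring. }
  assert (H : exp (4 * ln (INR m) / K) <= exp 4).
  { apply exp_le_compat; apply Rmult_le_reg_r with K; [lra|].
    unfold Rdiv; rewrite Rmult_assoc, Rinv_l by lra; lra. }
  assert (S : divisor_sigma (- (1)) m <= sqrt (3 * exp 4) * sqrt (1 + ln (INR n))).
  { rewrite <- sqrt_mult_alt by lra.
    rewrite <- (sqrt_pow2 (divisor_sigma (- (1)) m)).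
    2:{ assert (Z := divisor_sigma_ge1 (- (1)) m Hm); lra. }
    apply sqrt_le_1_alt; eapply Rle_trans; [exact B|].
    apply Rle_trans with (K * exp 4); [apply Rmult_le_compat_l; lra|]; nra. }
  lra.
Qed.

(** * Simultaneous approximation, and the half-plane of absolute convergence *)

(** The point [x] is within [eta] of a multiple of 2 pi; two natural numbers stand for the integer
    factor. *)
Definition near_period (eta x : R) : Prop :=
  exists p q : nat, Rabs (x + 2 * INR p * PI - 2 * INR q * PI) <= eta.

(** Dirichlet's pigeonhole: two of the first q + 1 multiples of [alpha] share one of the [q] cells,
    and j is their difference. *)
Lemma pigeonhole_period alpha q : 0 <= alpha -> (1 <= q)%nat ->
  exists j, (1 <= j <= q)%nat /\ near_period (2 * PI / INR q) (INR j * alpha).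
Proof.
  intros Ha Hq.
  destruct (exists_cells (fun n => INR n * alpha) q Hq) as [cell [C1 C2]].
  { intros; apply Rmult_le_pos; [apply pos_INR|exact Ha]. }
  destruct (classic (exists a b, (1 <= a < b)%nat /\ (b <= S q)%nat /\ cell a = cell b))
    as [[a [b [H1 [H2 E]]]]|N].
  - exists (b - a)%nat; split; [lia|].
    destruct (C2 a ltac:(lia)) as [p [d [Hd Ea]]]; destruct (C2 b ltac:(lia)) as [p' [d' [Hd' Eb]]].
    exists p, p'; rewrite minus_INR by lia; rewrite <- E in Eb; apply Rabs_le; lra.
  - exfalso.
    assert (ND : NoDup (map cell (seq 1 (S q)))).
    { apply NoDup_map_NoDup_ForallPairs; [|apply seq_NoDup].
      intros x y Hx Hy E; apply in_seq in Hx; apply in_seq in Hy.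
      destruct (Nat.lt_trichotomy x y) as [L|[L|L]]; trivial; exfalso; apply N.
      - exists x, y; repeat split; auto; lia.
      - exists y, x; repeat split; auto; lia. }
    assert (I : incl (map cell (seq 1 (S q))) (seq 0 q)).
    { intros c Hc; apply in_map_iff in Hc; destruct Hc as [x [<- _]]; apply in_seq.
      specialize (C1 x); lia. }
    assert (Z := NoDup_incl_length ND I); rewrite length_map, !length_seq in Z; lia.
Qed.

(** The tail is approximated first, to precision eta/q, so that the multiplier j <= q found for the
    head spoils it to [eta] at most. *)
Lemma simultaneous_period (l : list R) eta : 0 < eta -> (forall x, In x l -> 0 <= x) ->
  exists t : nat, (1 <= t)%nat /\ forall x, In x l -> near_period eta (INR t * x).
Proof.
  revert eta; induction l as [|a l IH]; intros eta He Hl.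
  - exists 1%nat; split; [lia|intros x []].
  - assert (PI0 := PI_RGT_0).
    destruct (nfloor_ex (2 * PI / eta)) as [k Hk].
    { apply Rmult_le_pos; [lra|left; now apply Rinv_0_lt_compat]. }
    set (q := S k); assert (Q : INR q = INR k + 1) by apply S_INR.
    assert (q0 : 0 < INR q) by (apply lt_0_INR; lia).
    assert (Qe : 2 * PI / INR q <= eta).
    { apply Rmult_le_reg_r with (INR q); [exact q0|].
      unfold Rdiv; rewrite Rmult_assoc, Rinv_l, Rmult_1_r by lra.
      replace (2 * PI) with (2 * PI / eta * eta) by (field; lra).
      rewrite (Rmult_comm eta); apply Rmult_le_compat_r; lra. }
    destruct (IH (eta / INR q)) as [t [t1 Ht]].
    { now apply Rdiv_lt_0_compat. }
    { intros; apply Hl; now right. }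
    destruct (pigeonhole_period (INR t * a) q) as [j [Hj [p [p' Hp]]]].
    { apply Rmult_le_pos; [apply pos_INR|apply Hl, in_eq]. }
    { unfold q; lia. }
    exists (j * t)%nat; split; [nia|]; intros x [<-|Hx].
    + exists p, p'; rewrite mult_INR, Rmult_assoc; lra.
    + destruct (Ht x Hx) as [r [r' Hr]].
      exists (j * r)%nat, (j * r')%nat; rewrite !mult_INR.
      replace (INR j * INR t * x + 2 * (INR j * INR r) * PI - 2 * (INR j * INR r') * PI) with
        (INR j * (INR t * x + 2 * INR r * PI - 2 * INR r' * PI)) by ring.
      rewrite Rabs_mult, (Rabs_right (INR j)) by (apply Rle_ge, pos_INR).
      apply Rle_trans with (INR q * (eta / INR q)).
      * apply Rmult_le_compat; [apply pos_INR|apply Rabs_pos|apply le_INR; lia|exact Hr].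
      * right; field; lra.
Qed.

Lemma cos_near_period x : near_period 1 x -> 1 / 2 <= cos x.
Proof.
  intros [p [q H]].
  set (y := x + 2 * INR p * PI - 2 * INR q * PI) in *.
  rewrite <- (cos_period x p).
  replace (x + 2 * INR p * PI) with (y + 2 * INR q * PI) by (unfold y; ring).
  rewrite cos_period; now apply cos_ge_half.
Qed.

Lemma sum_n_le_range (f g : nat -> R) N :
  (forall n, (n <= N)%nat -> f n <= g n) -> sum_n f N <= sum_n g N.
Proof.
  induction N as [|N IH]; intros H; [rewrite !sum_O; now apply H|].
  rewrite !sum_Sn; unfold plus; simpl; apply Rplus_le_compat; [apply IH|]; auto.
Qed.

(** The first N + 1 terms carry 5/6 of the sum Z = zeta(s), and some t >= 1 makes their cosines at
    least 1/2. Adding Z makes every term nonnegative, so that Re zeta(s + it) + Z >= (3/2)(5/6) Z =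
    (5/4) Z. *)
Lemma zeta_recurrence s : 1 < s ->
  exists t, 1 <= t /\ Re (zeta (RtoC s)) / 4 <= Cmod (zeta (s, t)).
Proof.
  intros Hs.
  set (b := fun n => Rpower (INR (S n)) (- s)).
  assert (Hb := zeta_real_series s Hs); fold b in Hb.
  set (Z := Re (zeta (RtoC s))) in *; assert (Z1 : 1 <= Z) by (now apply zeta_ge1).
  destruct (Hb (fun y => 5 / 6 * Z < y)) as [N HN].
  { assert (E : 0 < Z / 6) by lra; exists (mkposreal _ E); intros y Hy.
    apply Rabs_def2 in Hy; unfold minus, plus, opp in Hy; simpl in Hy; lra. }
  specialize (HN N (Nat.le_refl N)).
  destruct (simultaneous_period (map (fun n => ln (INR (S n))) (seq 0 (S N))) 1 ltac:(lra))
    as [t [t1 Ht]].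
  { intros x Hx; apply in_map_iff in Hx; destruct Hx as [n [<- _]].
    apply ln_ge0, INR_S_ge_1. }
  exists (INR t); split; [now apply INR_pos|].
  assert (Ha := is_Cseries_Re _ _ (zeta_dirichlet (s, INR t) Hs)).
  set (a := fun n => Re (cpow (INR (S n)) (- (s, INR t)))) in *.
  assert (Ea : forall n, a n = b n * cos (INR t * ln (INR (S n)))).
  { intros n; unfold a; rewrite cpow_cis, re_scal_l; unfold cis; simpl Re; now rewrite cos_neg. }
  assert (Pb : forall n, 0 < b n) by (intros; apply Rpower_pos).
  assert (Hab := is_series_plus a b _ _ Ha Hb).
  assert (P : sum_n (fun n => plus (a n) (b n)) N <= plus (Re (zeta (s, INR t))) Z).
  { apply partial_sum_le_series; [|exact Hab]; intros n; rewrite Ea.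
    specialize (Pb n); assert (B := COS_bound (INR t * ln (INR (S n)))).
    set (c := cos _) in *; change (0 <= b n * c + b n); nra. }
  assert (Q : sum_n (fun n => 3 / 2 * b n) N <= sum_n (fun n => plus (a n) (b n)) N).
  { apply sum_n_le_range; intros n Hn; rewrite Ea; specialize (Pb n).
    assert (B : 1 / 2 <= cos (INR t * ln (INR (S n)))).
    { apply cos_near_period, Ht, in_map_iff; exists n; split; [reflexivity|].
      apply in_seq; lia. }
    set (c := cos _) in *; change (3 / 2 * b n <= b n * c + b n); nra. }
  assert (F : sum_n (fun n => 3 / 2 * b n) N = 3 / 2 * sum_n b N).
  { exact (sum_n_mult_l (K := R_AbsRing) (3 / 2) b N). }
  change (plus (Re (zeta (s, INR t))) Z) with (Re (zeta (s, INR t)) + Z) in P.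
  assert (W : 3 / 2 * sum_n b N <= Re (zeta (s, INR t)) + Z).
  { rewrite <- F; exact (Rle_trans _ _ _ Q P). }
  assert (V : 3 / 2 * (5 / 6 * Z) <= 3 / 2 * sum_n b N).
  { apply Rmult_le_compat_l; [lra|left; exact HN]. }
  eapply Rle_trans; [|apply re_le_Cmod]; eapply Rle_trans; [|apply Rle_abs]; lra.
Qed.

(** * Changing the primes of the resonator *)

Lemma sum_divisors_prime_mul q n f : nat_prime q -> (1 <= n)%nat -> ~ Nat.divide q n ->
  sum_over (divisors (q * n)) f =
  sum_over (divisors n) f + sum_over (divisors n) (fun d => f (q * d)%nat).
Proof.
  intros Hq Hn Hqn; assert (E := sum_divisors_prime_pow q 0 n f Hq Hn Hqn).
  rewrite Nat.pow_1_r, Nat.pow_0_r, Nat.mul_1_l in E; exact E.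
Qed.

(** The extension of [r] from the divisors of nu to those of q nu with r(q n) = r(n), used for
    primes [q] not dividing nu. The weight 1 at [q] lets the Euler factor of [q] act with full
    strength on the convolution. *)
Definition adjoin (q : nat) (r : nat -> R) (n : nat) : R :=
  if Nat.eqb (n mod q) 0 then r (n / q)%nat else r n.

Lemma adjoin_mul q r n : (1 <= q)%nat -> adjoin q r (q * n) = r n.
Proof.
  intros Hq; unfold adjoin; rewrite Nat.mul_comm, Nat.Div0.mod_mul, Nat.div_mul by lia.
  reflexivity.
Qed.

Lemma adjoin_coprime q r n : (1 <= q)%nat -> ~ Nat.divide q n -> adjoin q r n = r n.
Proof.
  intros Hq H; unfold adjoin; destruct (Nat.eqb_spec (n mod q) 0) as [E|]; [|reflexivity].
  exfalso; apply H, Nat.mod_divide; [lia|exact E].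
Qed.

Lemma dconv_adjoin sig q r n : nat_prime q -> (1 <= n)%nat -> ~ Nat.divide q n ->
  dconv sig (adjoin q r) n = dconv sig r n /\
  dconv sig (adjoin q r) (q * n) = (1 + Rpower (INR q) (- sig)) * dconv sig r n.
Proof.
  intros Hq Hn Hqn; assert (q2 := proj1 Hq).
  split.
  - apply sum_over_ext; intros m Hm; rewrite adjoin_coprime; [reflexivity|lia|].
    intros D; apply Hqn; eapply Nat.divide_trans; [exact D|].
    apply in_divisors; [exact Hn|now apply in_divisors_div].
  - unfold dconv at 1; rewrite sum_divisors_prime_mul by assumption.
    unfold dconv; rewrite Rmult_plus_distr_r, Rmult_1_l, <- sum_over_scal.
    f_equal; apply sum_over_ext; intros m Hm; assert (m1 := divisors_pos _ _ Hm).
    + assert (E := divisor_mul_div n m Hn Hm).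
      replace (q * n / m)%nat with (q * (n / m))%nat.
      * rewrite adjoin_mul by lia; reflexivity.
      * rewrite <- E at 2; replace (q * (m * (n / m)))%nat with (q * (n / m) * m)%nat by ring.
        now rewrite Nat.div_mul by lia.
    + rewrite Nat.Div0.div_mul_cancel_l by lia.
      rewrite adjoin_coprime by (lia || (intros D; apply Hqn; eapply Nat.divide_trans;
        [exact D|apply in_divisors; [exact Hn|now apply in_divisors_div]])).
      rewrite mult_INR, <- Rpower_mult_distr by (apply lt_0_INR; lia); ring.
Qed.

(** With x = q^(-sig), the convolution is multiplied by 1 at n and by 1 + x at q n. Thus its mass
    gains 2 + x <= 3 and its energy 1 + (1 + x)^2 >= 2 (1 + x), whereas the energy of the weight
    only doubles: the quotient of energies gains 1 + x. *)
Lemma adjoin_prime sig q nu r : nat_prime q -> (1 <= nu)%nat -> ~ Nat.divide q nu ->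
  (forall n, 0 <= r n) -> 0 <= sig ->
  mass (q * nu) (adjoin q r) = 2 * mass nu r /\
  energy (q * nu) (adjoin q r) = 2 * energy nu r /\
  mass (q * nu) (dconv sig (adjoin q r)) <= 3 * mass nu (dconv sig r) /\
  2 * (1 + Rpower (INR q) (- sig)) * energy nu (dconv sig r) <=
    energy (q * nu) (dconv sig (adjoin q r)).
Proof.
  intros Hq Hnu Hqn r0 Hs; assert (q2 := proj1 Hq).
  assert (ND : forall n, In n (divisors nu) -> (1 <= n)%nat /\ ~ Nat.divide q n).
  { intros n Hn; split; [now apply divisors_pos in Hn|]; intros D; apply Hqn.
    apply in_divisors in Hn; [|exact Hnu]; now apply Nat.divide_trans with n. }
  set (x := Rpower (INR q) (- sig)).
  assert (x0 : 0 < x) by apply Rpower_pos.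
  assert (x1 : x <= 1).
  { unfold x; rewrite <- (Rpower_O (INR q)) by (apply lt_0_INR; lia).
    apply Rpower_le_exp; [apply INR_pos; lia|lra]. }
  assert (A : forall n, In n (divisors nu) -> adjoin q r n = r n).
  { intros n Hn; apply adjoin_coprime; [lia|now apply ND]. }
  assert (B : forall n, adjoin q r (q * n) = r n) by (intros; apply adjoin_mul; lia).
  assert (D : forall n, In n (divisors nu) -> dconv sig (adjoin q r) n = dconv sig r n /\
      dconv sig (adjoin q r) (q * n) = (1 + x) * dconv sig r n).
  { intros n Hn; apply dconv_adjoin; trivial; now apply ND. }
  unfold mass, energy; rewrite !sum_divisors_prime_mul by assumption.
  rewrite (sum_over_ext _ (adjoin q r) r A).
  rewrite (sum_over_ext _ (fun d => adjoin q r (q * d)%nat) r) by (intros; apply B).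
  rewrite (sum_over_ext _ (fun n => adjoin q r n ^ 2) (fun n => r n ^ 2)) by (intros; now rewrite A).
  rewrite (sum_over_ext _ (fun d => adjoin q r (q * d)%nat ^ 2) (fun n => r n ^ 2)) by (intros; now rewrite B).
  rewrite (sum_over_ext _ (dconv sig (adjoin q r)) (dconv sig r)) by (intros; now apply D).
  rewrite (sum_over_ext _ (fun d => dconv sig (adjoin q r) (q * d)%nat)
    (fun d => (1 + x) * dconv sig r d)) by (intros; now apply D).
  rewrite (sum_over_ext _ (fun n => dconv sig (adjoin q r) n ^ 2) (fun n => dconv sig r n ^ 2))
    by (intros n Hn; now rewrite (proj1 (D n Hn))).
  rewrite (sum_over_ext _ (fun d => dconv sig (adjoin q r) (q * d)%nat ^ 2)
    (fun d => (1 + x) ^ 2 * dconv sig r d ^ 2))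
    by (intros n Hn; rewrite (proj2 (D n Hn)); ring).
  rewrite !sum_over_scal.
  assert (M0 := mass_ge0 nu (dconv sig r) (fun n => dconv_ge0 sig r n r0)).
  assert (E0 := energy_ge0 nu (dconv sig r)); unfold mass, energy in M0, E0.
  repeat split; nra.
Qed.

(** The gains 1 + q^(-sig) multiply to at least 1 + sum q^(-sig). The cost is a factor 6 = 2 * 3 per
    prime in the product of masses. *)
Lemma adjoin_primes sig (Q : list nat) nu r :
  NoDup Q -> (forall q, In q Q -> nat_prime q /\ ~ Nat.divide q nu) ->
  (1 <= nu)%nat -> (forall n, 0 <= r n) -> 0 <= sig ->
  exists nu' r', (1 <= nu')%nat /\ (forall n, 0 <= r' n) /\
  (forall p, nat_prime p -> Nat.divide p nu' -> Nat.divide p nu \/ In p Q) /\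
  energy nu' r' = 2 ^ length Q * energy nu r /\
  mass nu' r' * mass nu' (dconv sig r') <=
    6 ^ length Q * (mass nu r * mass nu (dconv sig r)) /\
  2 ^ length Q * (1 + sum_over Q (fun q => Rpower (INR q) (- sig))) * energy nu (dconv sig r) <=
    energy nu' (dconv sig r').
Proof.
  intros ND HQ Hnu r0 Hs; induction Q as [|q Q IH].
  - exists nu, r; repeat split; trivial; try tauto; unfold sum_over; simpl; lra.
  - inversion ND as [|? ? Hq ND']; subst.
    destruct (IH ND') as [nu' [r' [H1 [H2 [H3 [H4 [H5 H6]]]]]]].
    { intros; apply HQ; now right. }
    destruct (HQ q (in_eq _ _)) as [Pq Nq].
    assert (Nq' : ~ Nat.divide q nu') by (intros D; destruct (H3 q Pq D); contradiction).
    destruct (adjoin_prime sig q nu' r' Pq H1 Nq' H2 Hs) as [A1 [A2 [A3 A4]]].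
    assert (q2 := proj1 Pq).
    exists (q * nu')%nat, (adjoin q r'); split; [nia|split; [|split; [|split; [|split]]]].
    + intros n; unfold adjoin; destruct (Nat.eqb _ _); apply H2.
    + intros p Pp D; destruct (nat_prime_mul p q nu' Pp D) as [D'|D'].
      * destruct (proj2 Pq p D') as [-> | ->]; [destruct Pp; lia|right; apply in_eq].
      * destruct (H3 p Pp D'); [now left|right; now right].
    + rewrite A2, H4; simpl; ring.
    + rewrite A1; change (length (q :: Q)) with (S (length Q)).
      assert (M0 := mass_ge0 nu' r' H2).
      apply Rle_trans with (2 * mass nu' r' * (3 * mass nu' (dconv sig r'))).
      * apply Rmult_le_compat_l; [lra|exact A3].
      * simpl pow; lra.
    + rewrite sum_over_cons; change (length (q :: Q)) with (S (length Q)).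
      set (x := Rpower (INR q) (- sig)) in *.
      assert (x0 : 0 < x) by apply Rpower_pos.
      set (S := sum_over Q _) in *.
      assert (S0 : 0 <= S) by (apply sum_over_ge0; intros; left; apply Rpower_pos).
      assert (E0 := energy_ge0 nu (dconv sig r)).
      assert (P0 : 0 < 2 ^ length Q) by (apply pow_lt; lra).
      set (P := 2 ^ length Q) in *.
      apply (Rmult_le_compat_l (2 * (1 + x))) in H6; [|lra].
      apply Rle_trans with (2 * (1 + x) * (P * (1 + S) * energy nu (dconv sig r))).
      * replace (2 ^ Datatypes.S (length Q)) with (2 * P) by reflexivity.
        replace (2 * (1 + x) * (P * (1 + S) * energy nu (dconv sig r))) with
          (2 * P * energy nu (dconv sig r) * ((1 + x) * (1 + S))) by ring.
        replace (2 * P * (1 + (x + S)) * energy nu (dconv sig r)) with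
          (2 * P * energy nu (dconv sig r) * (1 + (x + S))) by ring.
        apply Rmult_le_compat_l; [|nra].
        apply Rmult_le_pos; [lra|exact E0].
      * eapply Rle_trans; [exact H6|exact A4].
Qed.

Lemma divisor_sigma_prime_pow_le u q j n : nat_prime q -> (1 <= n)%nat -> ~ Nat.divide q n ->
  u <= 0 -> divisor_sigma u (q ^ j * n) <= 2 ^ j * divisor_sigma u n.
Proof.
  intros Hq Hn Hqn Hu.
  assert (D1 := divisor_sigma_ge1 u n Hn).
  assert (H : divisor_sigma u (q ^ j * n) <= INR (S j) * divisor_sigma u n).
  { induction j as [|j IH]; [rewrite Nat.pow_0_r, Nat.mul_1_l; simpl; lra|].
    rewrite divisor_sigma_prime_pow by assumption; rewrite (S_INR (S j)).
    assert (Rpower (INR (q ^ S j)) u <= 1).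
    { assert (K := pow_ge1 q (S j) ltac:(destruct Hq; lia)); apply INR_pos in K.
      rewrite <- (Rpower_O (INR (q ^ S j))) by lra; now apply Rpower_le_exp. }
    nra. }
  eapply Rle_trans; [exact H|]; apply Rmult_le_compat_r; [lra|].
  replace 2 with (INR 2) by reflexivity; rewrite <- pow_INR; apply le_INR.
  clear; induction j as [|j IH]; [simpl; lia|rewrite Nat.pow_succ_r'; lia].
Qed.

(** With x = q^(-2e), passing from d to q^j d multiplies the squared convolution by at most (4x)^j:
    x^j comes from the weight and 4^j from squaring the growth 2^j of the divisor sum. As 4x <= 1/2,
    the geometric series is at most 1 + 8x. *)
Lemma energy_remove_prime s e q nu : nat_prime q -> (1 <= nu)%nat -> 0 <= e <= s ->
  Rpower (INR q) (- (2 * e)) <= 1 / 8 ->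
  let r := fun n => Rpower (INR n) (- e) in
  exists nu', (1 <= nu')%nat /\ Nat.divide nu' nu /\ ~ Nat.divide q nu' /\
  energy nu (dconv s r) <=
    exp (8 * Rpower (INR q) (- (2 * e))) * energy nu' (dconv s r).
Proof.
  intros Hq Hnu He Hx r.
  destruct (prime_split q nu Hq Hnu) as [a [n [E [Hn Nn]]]].
  assert (q2 := proj1 Hq).
  exists n; split; [exact Hn|split; [exists (q ^ a)%nat; exact E|split; [exact Nn|]]].
  set (x := Rpower (INR q) (- (2 * e))) in *; assert (x0 : 0 < x) by apply Rpower_pos.
  assert (E0 := energy_ge0 n (dconv s r)).
  assert (ST : forall j, energy (q ^ S j * n) (dconv s r) <=
     energy (q ^ j * n) (dconv s r) + (4 * x) ^ S j * energy n (dconv s r)).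
  { intros j; unfold energy at 1; rewrite sum_divisors_prime_pow by assumption.
    apply Rplus_le_compat_l; unfold energy; rewrite <- sum_over_scal.
    apply sum_over_le; intros d Hd; assert (d1 := divisors_pos _ _ Hd).
    assert (Nd : ~ Nat.divide q d).
    { intros D; apply Nn; apply in_divisors in Hd; [|exact Hn]; now apply Nat.divide_trans with d. }
    assert (P1 := pow_ge1 q (S j) ltac:(lia)).
    unfold r; rewrite !dconv_power by nia.
    rewrite mult_INR, <- Rpower_mult_distr by (apply lt_0_INR; lia).
    assert (Q := divisor_sigma_prime_pow_le (- s + e) q (S j) d Hq d1 Nd ltac:(lra)).
    assert (Q0 := divisor_sigma_ge1 (- s + e) (q ^ S j * d) ltac:(nia)).
    set (A := divisor_sigma (- s + e) (q ^ S j * d)) in *.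
    set (B := divisor_sigma (- s + e) d) in *.
    set (u := Rpower (INR (q ^ S j)) (- e)); set (v := Rpower (INR d) (- e)).
    assert (u0 : 0 < u) by apply Rpower_pos; assert (v0 : 0 < v) by apply Rpower_pos.
    assert (Eu : u ^ 2 = x ^ S j).
    { unfold u, x; rewrite pow_INR, <- !Rpower_pow by (apply Rpower_pos || (apply lt_0_INR; lia)).
      rewrite !Rpower_mult; f_equal; simpl (INR 2); ring. }
    assert (A2 : A ^ 2 <= (2 ^ S j * B) ^ 2) by (apply pow_incr; lra).
    replace ((4 * x) ^ S j * (v * B) ^ 2) with (u ^ 2 * v ^ 2 * (2 ^ S j * B) ^ 2).
    - replace ((u * v * A) ^ 2) with (u ^ 2 * v ^ 2 * A ^ 2) by ring.
      apply Rmult_le_compat_l; [|exact A2].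
      apply Rmult_le_pos; apply pow2_ge_0.
    - rewrite Eu, !Rpow_mult_distr, <- pow_mult, (Nat.mul_comm (S j) 2), pow_mult.
      replace (2 ^ 2) with 4 by ring; ring. }
  assert (SM : (1 - 4 * x) * energy (q ^ a * n) (dconv s r) <=
     (1 - (4 * x) ^ S a) * energy n (dconv s r)).
  { clear E; induction a as [|a IH]; [rewrite Nat.pow_0_r, Nat.mul_1_l, pow_1; lra|].
    assert (S1 := ST a).
    apply Rle_trans with ((1 - 4 * x) * energy (q ^ a * n) (dconv s r) +
      (1 - 4 * x) * ((4 * x) ^ S a * energy n (dconv s r))).
    - rewrite <- Rmult_plus_distr_l; apply Rmult_le_compat_l; lra.
    - replace ((4 * x) ^ S (S a)) with (4 * x * (4 * x) ^ S a) by reflexivity; lra. }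
  rewrite <- E in SM.
  assert (P0 : 0 < (4 * x) ^ S a) by (apply pow_lt; lra).
  assert (EX := exp_ineq1_le (8 * x)).
  apply Rle_trans with ((1 + 8 * x) * energy n (dconv s r)).
  - apply Rmult_le_reg_l with (1 - 4 * x); [lra|].
    eapply Rle_trans; [exact SM|].
    rewrite <- Rmult_assoc; apply Rmult_le_compat_r; [exact E0|]; nra.
  - apply Rmult_le_compat_r; lra.
Qed.

Lemma energy_remove_primes s e (Q : list nat) nu :
  (forall q, In q Q -> nat_prime q /\ Rpower (INR q) (- (2 * e)) <= 1 / 8) ->
  (1 <= nu)%nat -> 0 <= e <= s ->
  let r := fun n => Rpower (INR n) (- e) in
  exists nu', (1 <= nu')%nat /\ Nat.divide nu' nu /\ (forall q, In q Q -> ~ Nat.divide q nu') /\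
  energy nu (dconv s r) <=
    exp (8 * sum_over Q (fun q => Rpower (INR q) (- (2 * e)))) * energy nu' (dconv s r).
Proof.
  intros HQ Hnu He r; revert nu Hnu; induction Q as [|q Q IH]; intros nu Hnu.
  - exists nu; repeat split; [exact Hnu|apply Nat.divide_refl|intros q []|].
    unfold sum_over; simpl; rewrite Rmult_0_r, exp_0; lra.
  - destruct (HQ q (in_eq _ _)) as [Pq Xq].
    destruct (energy_remove_prime s e q nu Pq Hnu He Xq) as [n1 [H1 [H2 [H3 H4]]]].
    destruct (IH ltac:(intros; apply HQ; now right) n1 H1) as [n2 [K1 [K2 [K3 K4]]]].
    exists n2; split; [exact K1|split; [now apply Nat.divide_trans with n1|split]].
    + intros p [<-|Hp]; [|now apply K3].
      intros D; apply H3; now apply Nat.divide_trans with n2.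
    + rewrite sum_over_cons, Rmult_plus_distr_l, exp_plus, Rmult_assoc.
      eapply Rle_trans; [exact H4|]; apply Rmult_le_compat_l; [left; apply exp_pos|exact K4].
Qed.

(** * A supply of primes *)

(** Primality is a proposition here, so lists are filtered by excluded middle. *)
Lemma classical_filter (P : nat -> Prop) (l : list nat) :
  NoDup l -> exists l', NoDup l' /\ forall x, In x l' <-> In x l /\ P x.
Proof.
  induction 1 as [|a l Ha ND [l' [N I]]].
  - exists nil; split; [constructor|simpl; tauto].
  - destruct (classic (P a)) as [Pa|Pa].
    + exists (a :: l'); split.
      * constructor; [rewrite I; tauto|exact N].
      * intros x; simpl; rewrite I; split; [intros [<-|]; tauto|tauto].
    + exists l'; split; [exact N|]; intros x; simpl; rewrite I; split; [tauto|].
      intros [[<-|] ?]; tauto.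
Qed.

Lemma prime_divisors_length l nu : NoDup l -> (1 <= nu)%nat ->
  (forall p, In p l -> nat_prime p /\ Nat.divide p nu) -> (2 ^ length l <= nu)%nat.
Proof.
  revert nu; induction l as [|p l IH]; intros nu ND Hnu H; [simpl; exact Hnu|].
  inversion ND as [|? ? Hp ND']; subst.
  destruct (H p (in_eq _ _)) as [Pp [m ->]].
  assert (K : (2 ^ length l <= m)%nat).
  { apply IH; [exact ND'|nia|]; intros q Hq; destruct (H q (in_cons _ _ _ Hq)) as [Pq Dq].
    split; [exact Pq|]; destruct (nat_prime_mul q m p Pq Dq) as [|D]; [assumption|].
    destruct (proj2 Pp q D) as [-> | ->]; [destruct Pq; lia|contradiction]. }
  simpl length; rewrite Nat.pow_succ_r'; destruct Pp; nia.
Qed.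

Lemma exists_prime_divisors nu : (1 <= nu)%nat ->
  exists l, INR (length l) <= 2 * ln (INR nu) /\
  forall p, nat_prime p -> Nat.divide p nu -> In p l.
Proof.
  intros Hnu; destruct (classical_filter nat_prime (divisors nu) (NoDup_divisors nu)) as [l [N I]].
  exists l; split.
  - assert (H := prime_divisors_length l nu N Hnu).
    assert (K : (2 ^ length l <= nu)%nat).
    { apply H; intros p Hp; apply I in Hp; destruct Hp as [D P].
      split; [exact P|now apply in_divisors in D]. }
    apply le_INR in K; rewrite pow_INR in K; change (INR 2) with 2 in K.
    apply ln_le in K; [|apply pow_lt; lra].
    rewrite ln_pow in K by lra; assert (L := ln_2_ge_half).
    assert (L0 := pos_INR (length l)); nra.
  - intros p Pp D; apply I; split; [now apply in_divisors|exact Pp].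
Qed.

(** The primes must be small enough for o(L) of them to reach the sum [K], yet large enough for
    their powers q^(-4/5) to be negligible in total. Primes between L^(9/8) and L^(3/2) do both:
    there are more than any multiple of [L] of them, and about K L^(3s/2) <= K L^(39/50) suffice, by
    s < 13/25. *)
Lemma prime_supply s K C k : 1 / 2 < s < 13 / 25 -> 0 < K -> 0 <= C -> 0 < k ->
  exists L0, 1 <= L0 /\ forall L (bad : list nat), L0 <= L -> INR (length bad) <= C * L ->
  exists Q, NoDup Q /\ (forall q, In q Q -> nat_prime q /\ ~ In q bad) /\
  K <= sum_over Q (fun q => Rpower (INR q) (- s)) /\
  INR (length Q) <= k * L /\
  forall q, In q Q -> 16 * INR (length Q) * Rpower (INR q) (- (4 / 5)) <= 1.
Proof.
  intros Hs HK HC Hk.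
  destruct (log_Rpower_small (1 / 10) (16 * (K + 1)) 1 ltac:(lra) ltac:(lra) ltac:(lra)) as [Lb [Lb1 HLb]].
  destruct (log_Rpower_small (1 / 10) (K + 1) k ltac:(lra) Hk ltac:(lra)) as [Lc [Lc1 HLc]].
  destruct (log_Rpower_small (3 / 8) (12 * (C + K + 4)) 1 ltac:(lra) ltac:(lra) ltac:(lra)) as [La [La1 HLa]].
  exists (La + Lb + Lc + 4); split; [lra|]; intros L bad HL Hbad.
  specialize (HLa L ltac:(lra)); specialize (HLb L ltac:(lra)); specialize (HLc L ltac:(lra)).
  assert (l0 : 0 <= ln L) by (apply ln_ge0; lra).
  set (z := Rpower L (3 / 2)).
  assert (Ez : forall c, Rpower z c = Rpower L (3 / 2 * c)) by (intros; apply Rpower_mult).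
  assert (z4 : 4 <= z).
  { apply Rle_trans with L; [lra|]; rewrite <- (Rpower_1 L) at 1 by lra.
    apply Rpower_le_exp; lra. }
  destruct (nfloor_ex (z / 2) ltac:(lra)) as [m Hm].
  assert (m1 : (1 <= m)%nat).
  { apply INR_le; simpl; assert (1 < INR (S m)) by (rewrite S_INR; lra).
    change 1 with (INR 1) in H |- *; apply INR_lt in H; apply le_INR; lia. }
  destruct (CentralBinomial.many_primes m m1) as [l [NDl [Pl Cl]]].
  assert (lz : ln (INR (2 * m)) <= 3 / 2 * ln L).
  { apply Rle_trans with (ln z).
    - apply ln_le; [apply lt_0_INR; lia|]; rewrite mult_INR; simpl (INR 2); lra.
    - unfold z, Rpower; rewrite ln_exp; lra. }
  assert (Cnt : z <= 12 * (1 + ln L) * INR (length l)).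
  { apply le_INR in Cl; rewrite !pow_INR in Cl.
    apply ln_le in Cl; [|apply pow_lt, lt_0_INR; lia].
    rewrite !ln_pow in Cl by (apply lt_0_INR; lia).
    assert (L2 := ln_2_ge_half); change (INR 2) with 2 in Cl.
    assert (m0 := pos_INR m); assert (len0 := pos_INR (length l)).
    assert (INR m * (1 / 2) <= INR (length l) * (3 / 2 * ln L)) by nra.
    assert (1 <= INR m) by (now apply INR_pos).
    nra. }
  (* Primes beyond L^(9/8) satisfy q^(-4/5) <= L^(-9/10), which outweighs their number,
     O(L^(39/50)). *)
  destruct (nfloor_ex (Rpower L (9 / 8)) ltac:(left; apply Rpower_pos)) as [j Hj].
  destruct (nfloor_ex (K * Rpower z s)) as [n0 Hn0].
  { apply Rmult_le_pos; [lra|left; apply Rpower_pos]. }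
  set (n := S n0); assert (En : INR n = INR n0 + 1) by apply S_INR.
  destruct (classical_filter (fun q => ~ In q bad /\ ~ In q (seq 0 (S j))) l NDl) as [g [NDg Ig]].
  assert (P98 := Rpower_pos L (9 / 8)).
  assert (L98 : L <= Rpower L (9 / 8)).
  { rewrite <- (Rpower_1 L) at 1 by lra; apply Rpower_le_exp; lra. }
  assert (zs : Rpower z s <= Rpower L (39 / 50)).
  { rewrite Ez; apply Rpower_le_exp; lra. }
  assert (zs1 : 1 <= Rpower L (39 / 50)) by (apply Rpower_ge1; lra).
  assert (nL : INR n <= (K + 1) * Rpower L (39 / 50)) by nra.
  assert (L3998 : Rpower L (39 / 50) <= Rpower L (9 / 8)) by (apply Rpower_le_exp; lra).
  assert (Lg : (length l <= length g + (length bad + S j))%nat).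
  { replace (S j) with (length (seq 0 (S j))) by apply length_seq; rewrite <- !length_app.
    apply NoDup_incl_length; [exact NDl|]; intros q Hq; rewrite !in_app_iff, Ig.
    destruct (classic (In q bad)), (classic (In q (seq 0 (S j)))); tauto. }
  assert (ng : (n <= length g)%nat).
  { apply INR_le; apply le_INR in Lg; rewrite !plus_INR, S_INR in Lg.
    assert (CL : (C + K + 4) * Rpower L (9 / 8) <= INR (length l)).
    { apply Rmult_le_reg_l with (12 * (1 + ln L)); [lra|].
      apply Rle_trans with z; [|lra].
      replace z with (Rpower L (3 / 8) * Rpower L (9 / 8)).
      2:{ unfold z; rewrite <- Rpower_plus; f_equal; lra. }
      rewrite <- Rmult_assoc; apply Rmult_le_compat_r; [lra|].
      rewrite Rpower_Ropp in HLa.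
      assert (P := Rpower_pos L (3 / 8)).
      apply (Rmult_le_compat_r (Rpower L (3 / 8))) in HLa; [|lra].
      rewrite Rmult_assoc, Rinv_l in HLa by lra; lra. }
    assert (C * L <= C * Rpower L (9 / 8)) by (now apply Rmult_le_compat_l).
    assert ((K + 1) * Rpower L (39 / 50) <= (K + 1) * Rpower L (9 / 8)) by (apply Rmult_le_compat_l; lra).
    nra. }
  set (Q := firstn n g).
  assert (LQ : length Q = n) by (apply firstn_length_le, ng).
  assert (IQ : forall q, In q Q -> In q g).
  { intros q Hq; rewrite <- (firstn_skipn n g); apply in_app_iff; now left. }
  assert (PQ : forall q, In q Q -> nat_prime q /\ ~ In q bad /\ (S j <= q)%nat /\ INR q <= z).
  { intros q Hq; apply IQ, Ig in Hq; destruct Hq as [Hq [N1 N2]].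
    destruct (Pl q Hq) as [Pq Bq]; repeat split; trivial; try apply Pq.
    - rewrite in_seq in N2; lia.
    - apply le_INR in Bq; rewrite mult_INR in Bq; simpl (INR 2) in Bq; lra. }
  assert (SP : Rpower L (39 / 50) <= Rpower L (9 / 10) * Rpower L (- (1 / 10))).
  { rewrite <- Rpower_plus; apply Rpower_le_exp; lra. }
  exists Q; split; [|split; [|split; [|split]]].
  - assert (NDa := NDg); rewrite <- (firstn_skipn n g) in NDa.
    now apply NoDup_app_remove_r in NDa.
  - intros q Hq; split; now apply PQ.
  - apply Rle_trans with (sum_over Q (fun _ => Rpower z (- s))).
    + rewrite sum_over_const, LQ, Rpower_Ropp.
      apply Rmult_le_reg_r with (Rpower z s); [apply Rpower_pos|].
      rewrite Rmult_assoc, Rinv_l, Rmult_1_r by (assert (Z := Rpower_pos z s); lra); lra.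
    + apply sum_over_le; intros q Hq; destruct (PQ q Hq) as [_ [_ [H1 H2]]].
      apply Rpower_decr; [apply lt_0_INR; lia|exact H2|lra].
  - rewrite LQ; eapply Rle_trans; [exact nL|].
    assert (P := Rpower_pos L (- (1 / 10))); assert (P' := Rpower_pos L (9 / 10)).
    assert (L9 : Rpower L (9 / 10) <= L).
    { rewrite <- (Rpower_1 L) at 2 by lra; apply Rpower_le_exp; lra. }
    apply Rle_trans with ((K + 1) * (Rpower L (9 / 10) * Rpower L (- (1 / 10)))).
    + apply Rmult_le_compat_l; lra.
    + assert ((K + 1) * Rpower L (- (1 / 10)) <= k) by nra.
      assert ((K + 1) * Rpower L (- (1 / 10)) * Rpower L (9 / 10) <= k * L).
      { apply Rmult_le_compat; nra. }
      lra.
  - intros q Hq; destruct (PQ q Hq) as [_ [_ [H1 _]]]; rewrite LQ.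
    assert (B : Rpower (INR q) (- (4 / 5)) <= Rpower L (- (9 / 10))).
    { apply Rle_trans with (Rpower (Rpower L (9 / 8)) (- (4 / 5))).
      - apply Rpower_decr; [exact P98| |lra].
        apply le_INR in H1; rewrite S_INR in H1; lra.
      - rewrite Rpower_mult; right; f_equal; lra. }
    assert (P := Rpower_pos L (- (1 / 10))).
    assert (PB := Rpower_pos (INR q) (- (4 / 5))).
    apply Rle_trans with (16 * ((K + 1) * Rpower L (39 / 50)) * Rpower L (- (9 / 10))).
    + assert (n1 := pos_INR n); apply Rmult_le_compat; lra.
    + replace (16 * ((K + 1) * Rpower L (39 / 50)) * Rpower L (- (9 / 10))) with
        (16 * (K + 1) * (Rpower L (39 / 50) * Rpower L (- (9 / 10)))) by ring.
      rewrite <- Rpower_plus.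
      apply Rle_trans with (16 * (K + 1) * Rpower L (- (1 / 10))); [|nra].
      apply Rmult_le_compat_l; [lra|apply Rpower_le_exp; lra].
Qed.

(** * The lower bound *)

Definition zeta_2s (s : R) : R := Re (zeta (RtoC (2 * s))).

Definition budget (s e : R) (nu : nat) (T : R) : Prop :=
  divisor_sigma (- e) nu * divisor_sigma (1 - s - e) nu * ln (INR nu * T)
      / resonance_sum s e nu <= sqrt (zeta_2s s) / 4 * Rpower T (2 * s - 1).

(** [M] is any upper bound, which separates the estimate from the existence of the maximum; the
    hypothesis on k and l is replaced by one on [nu]. *)
Definition lower_bound_at (s c : R) : Prop :=
  exists cs, 0 < cs /\ forall nu e T M,
  (2 <= nu)%nat -> cs <= INR nu -> 0 <= e < s -> 1 <= T -> budget s e nu T ->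
  (forall t, 1 <= t <= T -> Cmod (zeta (s, t)) <= M) ->
  c * sqrt (1 / divisor_sigma (- (2 * e)) nu * resonance_sum s e nu) <= M.

Notation weight e := (fun n => Rpower (INR n) (- e)).

Lemma resonance_sum_ge1 s e nu : (1 <= nu)%nat -> 1 <= resonance_sum s e nu.
Proof.
  intros Hnu; rewrite resonance_sum_energy.
  eapply Rle_trans; [apply (divisor_sigma_ge1 (- (2 * e)) nu Hnu)|].
  rewrite divisor_sigma_energy; apply sum_over_le; intros n Hn; apply divisors_pos in Hn.
  assert (P : forall k, 0 <= weight e k) by (intros; left; apply Rpower_pos).
  apply pow_incr; split; [apply P|].
  now apply (dconv_ge_self s (weight e) n P).
Qed.

Lemma budget_mul s e nu T : (1 <= nu)%nat -> budget s e nu T ->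
  divisor_sigma (- e) nu * divisor_sigma (1 - s - e) nu * ln (INR nu * T) <=
  sqrt (zeta_2s s) / 4 * Rpower T (2 * s - 1) * resonance_sum s e nu.
Proof.
  intros Hnu H; assert (R1 := resonance_sum_ge1 s e nu Hnu).
  apply (Rmult_le_compat_r (resonance_sum s e nu)) in H; [|lra].
  unfold Rdiv in H at 1; rewrite Rmult_assoc, Rinv_l, Rmult_1_r in H by lra; exact H.
Qed.

Lemma lower_bound_of_energy s e nu c k M : (1 <= nu)%nat -> 0 <= c -> 0 <= k -> c * k <= 1 -> 0 <= M ->
  sqrt (energy nu (dconv s (weight e))) <= k * M * sqrt (energy nu (weight e)) ->
  c * sqrt (1 / divisor_sigma (- (2 * e)) nu * resonance_sum s e nu) <= M.
Proof.
  intros Hnu Hc Hk Hck HM H.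
  rewrite divisor_sigma_energy, resonance_sum_energy.
  assert (E1 := divisor_sigma_ge1 (- (2 * e)) nu Hnu); rewrite divisor_sigma_energy in E1.
  set (E := energy nu (weight e)) in *; set (F := energy nu (dconv s (weight e))) in *.
  assert (iE : 0 < / E) by (apply Rinv_0_lt_compat; lra).
  replace (1 / E * F) with (/ E * F) by (field; lra).
  rewrite sqrt_mult_alt by lra.
  assert (Q : sqrt (/ E) * sqrt E = 1).
  { rewrite <- sqrt_mult_alt, Rinv_l, sqrt_1 by lra; reflexivity. }
  assert (S0 := sqrt_pos (/ E)).
  apply Rle_trans with (c * (sqrt (/ E) * (k * M * sqrt E))).
  - apply Rmult_le_compat_l; [exact Hc|]; now apply Rmult_le_compat_l.
  - replace (c * (sqrt (/ E) * (k * M * sqrt E))) with (c * k * M * (sqrt (/ E) * sqrt E)) by ring.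
    rewrite Q, Rmult_1_r; nra.
Qed.

(** This is the use of c_sigma. If the resonance sum is at most [K] times the two divisor sums, the
    condition bounds ln (nu T) by a multiple of T^(2s-1); were T below [T0], this would bound
    [nu]. *)
Lemma budget_large_T s K T0 : 1 / 2 < s -> 0 <= K -> 1 <= T0 ->
  exists cs, 0 < cs /\ forall nu e T, (2 <= nu)%nat -> cs <= INR nu -> 1 <= T ->
  resonance_sum s e nu <= K * (divisor_sigma (- e) nu * divisor_sigma (1 - s - e) nu) ->
  budget s e nu T -> T0 <= T.
Proof.
  intros Hs HK HT0.
  set (B := K * (sqrt (zeta_2s s) / 4 * Rpower T0 (2 * s - 1))).
  exists (exp (B + 1)); split; [apply exp_pos|]; intros nu e T Hnu Hcs HT HR HB.
  destruct (Rle_lt_dec T0 T) as [|HlT]; [assumption|exfalso].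
  assert (nu1 : (1 <= nu)%nat) by lia.
  assert (H := budget_mul s e nu T nu1 HB).
  assert (D1 := divisor_sigma_ge1 (- e) nu nu1); assert (D2 := divisor_sigma_ge1 (1 - s - e) nu nu1).
  set (D := divisor_sigma (- e) nu * divisor_sigma (1 - s - e) nu) in *.
  assert (D0 : 0 < D) by (apply Rmult_lt_0_compat; lra).
  assert (Sz := sqrt_pos (zeta_2s s)).
  assert (PT := Rpower_pos T (2 * s - 1)).
  assert (PP : Rpower T (2 * s - 1) <= Rpower T0 (2 * s - 1)) by (apply Rle_Rpower_l; lra).
  assert (L : ln (INR nu * T) <= B).
  { apply Rmult_le_reg_l with D; [exact D0|].
    eapply Rle_trans; [exact H|].
    apply Rle_trans with (sqrt (zeta_2s s) / 4 * Rpower T0 (2 * s - 1) * (K * D)).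
    - apply Rmult_le_compat; [nra|assert (Z := resonance_sum_ge1 s e nu nu1); lra|nra|exact HR].
    - unfold B; right; ring. }
  assert (B + 1 <= ln (INR nu * T)); [|lra].
  rewrite <- (ln_exp (B + 1)); apply ln_le; [apply exp_pos|].
  assert (P := exp_pos (B + 1)); nra.
Qed.

Lemma resonance_sum_le_sigma s e nu : 1 / 2 < s <= 1 -> (1 <= nu)%nat ->
  resonance_sum s e nu <=
  zeta_2s s * (divisor_sigma (- e) nu * divisor_sigma (1 - s - e) nu).
Proof.
  intros Hs Hnu; rewrite resonance_sum_energy.
  assert (P : forall k, 0 <= weight e k) by (intros; left; apply Rpower_pos).
  eapply Rle_trans; [apply (energy_dconv_le_mass nu s (weight e) Hnu P)|].
  assert (Z := divisor_sigma_le_zeta (2 * s) nu ltac:(lra)); fold (zeta_2s s) in Z.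
  change (mass nu (weight e)) with (divisor_sigma (- e) nu).
  assert (D1 := divisor_sigma_ge1 (- e) nu Hnu).
  assert (D2 := divisor_sigma_le (- e) (1 - s - e) nu ltac:(lra)).
  assert (D3 := divisor_sigma_ge1 (- (2 * s)) nu Hnu).
  apply Rmult_le_compat; [lra|apply pow2_ge_0|exact Z|simpl; nra].
Qed.

(** No resonator is involved: the right side is at most c zeta(s) by Young's inequality, and |zeta|
    reaches zeta(s)/4 at a point [t] depending only on [s], which lies in [1, T] as soon as T >=
    t. *)
Lemma lower_bound_gt1 s c : 1 < s -> 0 <= c <= 1 / 4 -> lower_bound_at s c.
Proof.
  intros Hs Hc; destruct (zeta_recurrence s Hs) as [t [t1 Ht]].
  set (Z := Re (zeta (RtoC s))) in *; assert (Z1 : 1 <= Z) by (now apply zeta_ge1).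
  destruct (budget_large_T s (Z ^ 2) t ltac:(lra) ltac:(nra) t1) as [cs [cs0 H]].
  exists cs; split; [exact cs0|]; intros nu e T M Hnu Hcs He HT HB HM.
  assert (nu1 : (1 <= nu)%nat) by lia.
  assert (P : forall k, 0 <= weight e k) by (intros; left; apply Rpower_pos).
  assert (Y := energy_dconv_le_energy nu s (weight e) nu1 P).
  assert (D1 := divisor_sigma_ge1 (- s) nu nu1).
  assert (D2 := divisor_sigma_le_zeta s nu Hs); fold Z in D2.
  assert (E0 := energy_ge0 nu (weight e)).
  assert (Y' : energy nu (dconv s (weight e)) <= Z ^ 2 * energy nu (weight e)).
  { eapply Rle_trans; [exact Y|]; apply Rmult_le_compat_r; [exact E0|].
    apply pow_incr; lra. }
  assert (tT : t <= T).
  { apply (H nu e T Hnu Hcs HT); [|exact HB].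
    rewrite resonance_sum_energy; eapply Rle_trans; [exact Y'|].
    apply Rmult_le_compat_l; [nra|].
    rewrite <- divisor_sigma_energy.
    assert (A1 := divisor_sigma_ge1 (1 - s - e) nu nu1).
    assert (A2 := divisor_sigma_ge1 (- e) nu nu1).
    assert (A3 := divisor_sigma_le (- (2 * e)) (- e) nu ltac:(lra)); nra. }
  assert (M0 : Z / 4 <= M) by (eapply Rle_trans; [exact Ht|apply HM; lra]).
  apply lower_bound_of_energy with (k := 4); trivial; try lra.
  apply Rle_trans with (Z * sqrt (energy nu (weight e))).
  - rewrite <- (sqrt_pow2 Z) at 1 by lra; rewrite <- sqrt_mult_alt by (apply pow2_ge_0).
    now apply sqrt_le_1_alt.
  - apply Rmult_le_compat_r; [apply sqrt_pos|lra].
Qed.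

Lemma sup_ge0 s T M : 1 <= T -> (forall t, 1 <= t <= T -> Cmod (zeta (s, t)) <= M) -> 0 <= M.
Proof. intros HT HM; eapply Rle_trans; [apply Cmod_ge_0|apply (HM 1); lra]. Qed.

(** The masses produce sigma_(-s) sigma_(-e)^2; trading one pair of factors by
    [divisor_sigma_product] yields the product occurring in the condition, at the price of
    sigma_(-1). *)
Lemma mass_product_le s e nu : 1 / 2 < s <= 1 -> 0 <= e <= 1 -> (1 <= nu)%nat ->
  mass nu (weight e) * mass nu (dconv s (weight e)) <=
  2 * divisor_sigma (- (1)) nu * (divisor_sigma (- e) nu * divisor_sigma (1 - s - e) nu).
Proof.
  intros Hs He Hnu.
  assert (P : forall k, 0 <= weight e k) by (intros; left; apply Rpower_pos).
  assert (H := mass_dconv_le nu s (weight e) Hnu P).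
  assert (K := divisor_sigma_product s e nu ltac:(lra) ltac:(lra)).
  change (mass nu (weight e)) with (divisor_sigma (- e) nu) in *.
  assert (D1 := divisor_sigma_ge1 (- e) nu Hnu).
  replace (2 * divisor_sigma (- (1)) nu * (divisor_sigma (- e) nu * divisor_sigma (1 - s - e) nu)) with
   (divisor_sigma (- e) nu * (2 * (divisor_sigma (- (1)) nu * divisor_sigma (1 - s - e) nu))) by ring.
  apply Rmult_le_compat_l; lra.
Qed.

Lemma ln_product_ge_half nu T : (2 <= nu)%nat -> 1 <= T ->
  1 / 2 <= ln (INR nu * T) /\ ln (INR nu) <= ln (INR nu * T) /\ ln T <= ln (INR nu * T).
Proof.
  intros Hnu HT; assert (n2 : 2 <= INR nu) by (change 2 with (INR 2); now apply le_INR).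
  rewrite ln_mult by lra; assert (Z := ln_ge0 T HT); assert (W := ln_2_ge_half).
  assert (ln 2 <= ln (INR nu)) by (apply ln_le; lra); lra.
Qed.

(* For [s = 1] there is no power of [T] to spare; the bound of [sigma_(-1)(nu)] by
   [O (sqrt (ln nu))] makes up for the [ln (ln T)] lost near the pole. *)
Lemma lower_bound_one c : 0 <= c <= 1 / 256 -> lower_bound_at 1 c.
Proof.
  intros Hc.
  destruct resonance_bound_one as [T0 [c1 [T01 [c10 RB]]]].
  destruct inverse_sigma_bound as [K [K0 HK]].
  set (z := zeta_2s 1).
  assert (z1 : 1 <= z) by (apply zeta_ge1; lra).
  destruct (budget_large_T 1 z T0 ltac:(lra) ltac:(lra) T01) as [cs [cs0 H]].
  assert (Sz : 0 <= sqrt z) by apply sqrt_pos.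
  destruct (log_Rpower_small (1 / 2) (3 * (K * (sqrt z / 2))) c1 ltac:(lra) c10 ltac:(nra))
    as [x0 [x01 Hx]].
  exists (cs + exp (x0 + 1)); split; [assert (Z := exp_pos (x0 + 1)); lra|].
  intros nu e T M Hnu Hcs He HT HB HM.
  assert (nu1 : (1 <= nu)%nat) by lia.
  assert (EP := exp_pos (x0 + 1)).
  assert (TT : T0 <= T).
  { apply (H nu e T Hnu ltac:(lra) HT); [|exact HB].
    apply resonance_sum_le_sigma; [lra|exact nu1]. }
  assert (M0 := sup_ge0 1 T M HT HM).
  assert (P : forall k, 0 <= weight e k) by (intros; left; apply Rpower_pos).
  apply lower_bound_of_energy with (k := 256); trivial; try lra.
  apply (RB T M nu (weight e) TT M0 nu1 P HM).
  destruct (ln_product_ge_half nu T Hnu HT) as [l1 [l2 l3]].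
  assert (lT := ln_ge0 T HT).
  assert (ln0 := ln_ge0 _ (INR_pos nu nu1)).
  (* In terms of [x] the losses are sqrt x from sigma_(-1)(nu) and 1 + ln x from the pole; the
     logarithm in the condition gains x/3 and outweighs both for x >= x0. *)
  set (x := 1 + ln (INR nu * T)) in *.
  assert (xx : x0 <= x).
  { assert (x0 + 1 <= ln (INR nu)); [|unfold x; lra].
    rewrite <- (ln_exp (x0 + 1)); apply ln_le; lra. }
  specialize (Hx x xx).
  assert (BM := budget_mul 1 e nu T nu1 HB); fold z in BM.
  replace (2 * 1 - 1) with 1 in BM by ring; rewrite Rpower_1 in BM by lra.
  rewrite <- resonance_sum_energy.
  assert (MP := mass_product_le 1 e nu ltac:(lra) ltac:(lra) nu1).
  assert (R1 := resonance_sum_ge1 1 e nu nu1).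
  set (B := mass nu (weight e) * mass nu (dconv 1 (weight e))) in *.
  set (D := divisor_sigma (- e) nu * divisor_sigma (1 - 1 - e) nu) in *.
  set (R := resonance_sum 1 e nu) in *.
  assert (D0 : 0 <= D).
  { unfold D; assert (Z := divisor_sigma_ge1 (- e) nu nu1).
    assert (Y := divisor_sigma_ge1 (1 - 1 - e) nu nu1); nra. }
  assert (S1 : divisor_sigma (- (1)) nu <= K * sqrt x).
  { eapply Rle_trans; [apply HK, nu1|]; apply Rmult_le_compat_l; [lra|].
    apply sqrt_le_1_alt; unfold x; lra. }
  assert (L1 : 0 <= 1 + ln (1 + ln T) <= 1 + ln x).
  { assert (0 <= ln (1 + ln T)) by (apply ln_ge0; lra).
    assert (ln (1 + ln T) <= ln x) by (apply ln_le; unfold x; lra); lra. }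
  assert (Sx : 0 <= sqrt x) by apply sqrt_pos.
  assert (S2 : sqrt x * Rpower x (- (1 / 2)) = 1).
  { replace (1 / 2) with (/ 2) by field; rewrite Rpower_Ropp, Rpower_sqrt by lra.
    apply Rinv_r; assert (Z := sqrt_lt_R0 x ltac:(lra)); lra. }
  assert (xL : x <= 3 * ln (INR nu * T)) by (unfold x; lra).
  assert (H1 : 3 * (K * (sqrt z / 2)) * (1 + ln x) * sqrt x <= c1 * x).
  { apply (Rmult_le_compat_r x) in Hx; [|lra].
    assert (Ex : x = sqrt x * sqrt x) by (symmetry; apply sqrt_def; lra).
    replace (3 * (K * (sqrt z / 2)) * (1 + ln x) * sqrt x) with
      (3 * (K * (sqrt z / 2)) * (1 + ln x) * sqrt x * (sqrt x * Rpower x (- (1 / 2)))) by (rewrite S2; ring).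
    rewrite Ex in Hx at 3; lra. }
  apply Rmult_le_reg_r with x; [lra|].
  apply Rle_trans with (2 * (K * sqrt x) * D * (1 + ln x) * (3 * ln (INR nu * T))).
  - apply Rmult_le_compat; [|lra| |exact xL].
    + apply Rmult_le_pos; [|apply L1].
      apply Rmult_le_pos; apply mass_ge0; trivial; intros; now apply dconv_ge0.
    + apply Rmult_le_compat; [|apply L1| |apply L1].
      * apply Rmult_le_pos; apply mass_ge0; trivial; intros; now apply dconv_ge0.
      * eapply Rle_trans; [exact MP|]; apply Rmult_le_compat_r; [exact D0|].
        apply Rmult_le_compat_l; lra.
  - apply Rle_trans with (6 * (K * sqrt x) * (1 + ln x) * (sqrt z / 4 * T * R)).
    + replace (2 * (K * sqrt x) * D * (1 + ln x) * (3 * ln (INR nu * T))) with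
        (6 * (K * sqrt x) * (1 + ln x) * (D * ln (INR nu * T))) by ring.
      apply Rmult_le_compat_l; [|exact BM].
      apply Rmult_le_pos; [|lra]; apply Rmult_le_pos; [lra|]; apply Rmult_le_pos; lra.
    + replace (6 * (K * sqrt x) * (1 + ln x) * (sqrt z / 4 * T * R)) with
        (3 * (K * (sqrt z / 2)) * (1 + ln x) * sqrt x * (T * R)) by field.
      replace (c1 * T * R * x) with (c1 * x * (T * R)) by ring.
      apply Rmult_le_compat_r; [nra|exact H1].
Qed.

(** The factor ln (nu T) of the condition absorbs sigma_(-1)(nu), which is O(1 + ln nu). What is
    left is a constant [B] depending on [s]. *)
Lemma budget_mass s : 1 / 2 < s < 1 -> exists B, 0 < B /\ forall nu e T,
  (2 <= nu)%nat -> 0 <= e < s -> 1 <= T -> budget s e nu T ->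
  2 * divisor_sigma (- (1)) nu * (divisor_sigma (- e) nu * divisor_sigma (1 - s - e) nu) <=
  B * Rpower T (2 * s - 1) * resonance_sum s e nu.
Proof.
  intros Hs; destruct inverse_sigma_bound as [K [K0 HK]].
  set (z := zeta_2s s); assert (z1 : 1 <= z) by (apply zeta_ge1; lra).
  assert (Sz : 0 < sqrt z) by (apply sqrt_lt_R0; lra).
  exists (3 / 2 * K * sqrt z); split; [nra|]; intros nu e T Hnu He HT HB.
  assert (nu1 : (1 <= nu)%nat) by lia.
  assert (BM := budget_mul s e nu T nu1 HB); fold z in BM.
  destruct (ln_product_ge_half nu T Hnu HT) as [l1 [l2 _]].
  assert (ln0 := ln_ge0 _ (INR_pos nu nu1)).
  set (D := divisor_sigma (- e) nu * divisor_sigma (1 - s - e) nu) in *.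
  assert (D0 : 0 <= D).
  { unfold D; assert (Z := divisor_sigma_ge1 (- e) nu nu1).
    assert (Y := divisor_sigma_ge1 (1 - s - e) nu nu1); nra. }
  assert (S1 : divisor_sigma (- (1)) nu <= 3 * K * ln (INR nu * T)).
  { eapply Rle_trans; [apply HK, nu1|].
    apply Rle_trans with (K * (1 + ln (INR nu))); [|nra].
    apply Rmult_le_compat_l; [lra|].
    rewrite <- (sqrt_square (1 + ln (INR nu))) at 2 by lra; apply sqrt_le_1_alt; nra. }
  apply Rle_trans with (6 * K * (D * ln (INR nu * T))).
  - replace (6 * K * (D * ln (INR nu * T))) with (2 * (3 * K * ln (INR nu * T)) * D) by ring.
    apply Rmult_le_compat_r; [exact D0|lra].
  - replace (3 / 2 * K * sqrt z * Rpower T (2 * s - 1) * resonance_sum s e nu) with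
      (6 * K * (sqrt z / 4 * Rpower T (2 * s - 1) * resonance_sum s e nu)) by field.
    apply Rmult_le_compat_l; lra.
Qed.

(** Once T is large, its spare power T^k in [resonance_bound_strip] exceeds the constant [B] of
    [budget_mass]. *)
Lemma lower_bound_strip s c : 1 / 2 < s < 1 -> 0 <= c <= 1 / 256 -> lower_bound_at s c.
Proof.
  intros Hs Hc.
  destruct (resonance_bound_strip s Hs) as [T0 [T01 RB]].
  destruct (budget_mass s Hs) as [B [B0 HBm]].
  set (k := (1 - s) * (2 * s - 1) / (4 * s)) in *.
  assert (k0 : 0 < k) by (unfold k; apply Rdiv_lt_0_compat; nra).
  destruct (Rpower_eventually_ge k B k0) as [Ta [Ta1 HTa]].
  assert (z1 : 1 <= zeta_2s s) by (apply zeta_ge1; lra).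
  destruct (budget_large_T s (zeta_2s s) (T0 + Ta) ltac:(lra) ltac:(lra) ltac:(lra)) as [cs [cs0 H]].
  exists cs; split; [exact cs0|]; intros nu e T M Hnu Hcs He HT HB HM.
  assert (nu1 : (1 <= nu)%nat) by lia.
  assert (TT : T0 + Ta <= T).
  { apply (H nu e T Hnu Hcs HT); [|exact HB].
    apply resonance_sum_le_sigma; [lra|exact nu1]. }
  assert (M0 := sup_ge0 s T M HT HM).
  assert (P : forall k, 0 <= weight e k) by (intros; left; apply Rpower_pos).
  apply lower_bound_of_energy with (k := 256); trivial; try lra.
  apply (RB T M nu (weight e) ltac:(lra) M0 nu1 P HM).
  rewrite <- resonance_sum_energy.
  eapply Rle_trans; [apply mass_product_le; [lra|lra|exact nu1]|].
  eapply Rle_trans; [apply (HBm nu e T Hnu He HT HB)|].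
  apply Rmult_le_compat_r; [assert (Z := resonance_sum_ge1 s e nu nu1); lra|].
  rewrite Rpower_plus, Rmult_comm; apply Rmult_le_compat_l; [left; apply Rpower_pos|].
  apply HTa; lra.
Qed.

(* The divisors [d] and [nu / d] together contribute at least [2 nu ^ (u / 2)]. *)
Lemma divisor_sigma_symmetric u nu : (1 <= nu)%nat ->
  INR (length (divisors nu)) * Rpower (INR nu) (u / 2) <= divisor_sigma u nu.
Proof.
  intros Hnu; rewrite <- sum_over_const.
  assert (H := sum_codivisors_le nu (fun d => Rpower (INR d) u) Hnu
                 (fun d => Rlt_le _ _ (Rpower_pos _ _))).
  fold (divisor_sigma u nu) in H.
  apply Rmult_le_reg_l with 2; [lra|].
  apply Rle_trans with (sum_over (divisors nu) (fun d => Rpower (INR d) u + Rpower (INR (nu / d)) u)).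
  - rewrite <- sum_over_scal; apply sum_over_le; intros d Hd.
    assert (E := divisor_mul_div nu d Hnu Hd); assert (d1 := divisors_pos _ _ Hd).
    assert (k1 : (1 <= nu / d)%nat) by (destruct (nu / d)%nat; lia).
    apply INR_pos in d1; apply INR_pos in k1.
    assert (F : forall x, 0 < x -> Rpower x u = Rpower x (u / 2) ^ 2).
    { intros x Hx; simpl; rewrite Rmult_1_r, <- Rpower_plus; f_equal; field. }
    rewrite <- E at 1; rewrite mult_INR, <- Rpower_mult_distr, !F by lra.
    set (a := Rpower (INR d) (u / 2)); set (b := Rpower (INR (nu / d)) (u / 2)).
    assert (Z := pow2_ge_0 (a - b)); simpl in *; lra.
  - rewrite sum_over_plus; fold (divisor_sigma u nu); lra.
Qed.

(** In this range u = 1 - s - e exceeds 2/25, so sigma_u(nu) is at least nu^(1/25) times the number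
    of divisors, and the condition bounds nu by a power of T. The 25 is the inverse of that
    exponent. *)
Lemma budget_ln_nu s : 1 / 2 < s < 13 / 25 -> exists C, 0 <= C /\ forall nu e T,
  (2 <= nu)%nat -> 0 <= e <= 2 / 5 -> 1 <= T -> budget s e nu T ->
  ln (INR nu) <= C * (1 + ln T).
Proof.
  intros Hs; set (z := zeta_2s s); assert (z1 : 1 <= z) by (apply zeta_ge1; lra).
  assert (Sz : 0 < sqrt z) by (apply sqrt_lt_R0; lra).
  set (A := z * sqrt z); assert (A0 : 0 < A) by (unfold A; nra).
  assert (lA := Rabs_pos (ln A)).
  exists (25 * (Rabs (ln A) + 1)); split; [lra|].
  intros nu e T Hnu He HT HB.
  assert (nu1 : (1 <= nu)%nat) by lia.
  assert (BM := budget_mul s e nu T nu1 HB); fold z in BM.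
  destruct (ln_product_ge_half nu T Hnu HT) as [l1 _].
  assert (lT := ln_ge0 T HT).
  assert (ln0 := ln_ge0 _ (INR_pos nu nu1)).
  set (u := 1 - s - e) in *.
  assert (P : forall k, 0 <= weight e k) by (intros; left; apply Rpower_pos).
  assert (Y := energy_dconv_le_mass nu s (weight e) nu1 P).
  rewrite <- resonance_sum_energy in Y.
  change (mass nu (weight e)) with (divisor_sigma (- e) nu) in Y.
  assert (D := divisor_sigma_le_zeta (2 * s) nu ltac:(lra)); fold (zeta_2s s) z in D.
  assert (D1 := divisor_sigma_ge1 (- e) nu nu1).
  assert (SY := divisor_sigma_symmetric u nu nu1).
  set (R := divisor_sigma (- e) nu) in *.
  (* As e >= 0. The number of divisors in the symmetric bound thus supplies the second factor [R],
     which cancels the square in the bound of the resonance sum. *)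
  assert (RL : R <= INR (length (divisors nu))).
  { rewrite <- (Rmult_1_r (INR _)), <- sum_over_const; apply sum_over_le; intros d Hd.
    apply divisors_pos, INR_pos in Hd.
    rewrite <- (Rpower_O (INR d)) by lra; apply Rpower_le_exp; lra. }
  set (V := Rpower (INR nu) (u / 2)) in *; assert (V0 : 0 < V) by apply Rpower_pos.
  assert (RV : R * V <= divisor_sigma u nu).
  { eapply Rle_trans; [|exact SY]; apply Rmult_le_compat_r; lra. }
  set (W := Rpower T (2 * s - 1)) in *; assert (W0 : 0 < W) by apply Rpower_pos.
  assert (RR : resonance_sum s e nu <= z * R ^ 2).
  { eapply Rle_trans; [exact Y|]; apply Rmult_le_compat_r; [apply pow2_ge_0|exact D]. }
  assert (VW : V <= A * W).
  { assert (Q1 : R * (R * V) * (1 / 2) <= R * divisor_sigma u nu * ln (INR nu * T)).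
    { apply Rmult_le_compat; [nra|lra| |exact l1]; apply Rmult_le_compat_l; lra. }
    assert (Q2 : sqrt z / 4 * W * resonance_sum s e nu <= sqrt z / 4 * W * (z * R ^ 2)).
    { apply Rmult_le_compat_l; [nra|exact RR]. }
    apply Rmult_le_reg_l with (R ^ 2 / 2); [simpl; nra|].
    replace (R ^ 2 / 2 * V) with (R * (R * V) * (1 / 2)) by field.
    apply Rle_trans with (sqrt z / 4 * W * (z * R ^ 2)); [lra|].
    unfold A; assert (0 <= R ^ 2 * (z * sqrt z * W)).
    { apply Rmult_le_pos; [apply pow2_ge_0|]; left; repeat apply Rmult_lt_0_compat; lra. }
    lra. }
  apply ln_le in VW; [|exact V0].
  rewrite ln_mult in VW by assumption; unfold V, W, Rpower in VW; rewrite !ln_exp in VW.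
  assert (QA := Rle_abs (ln A)).
  unfold u in VW; nra.
Qed.

Lemma exp_half_le_2 : exp (1 / 2) <= 2.
Proof.
  assert (H : exp (1 / 2) * exp (1 / 2) <= 3).
  { rewrite <- exp_plus; replace (1 / 2 + 1 / 2) with 1 by field; apply exp_le_3. }
  assert (P := exp_pos (1 / 2)); nra.
Qed.

(* When [e <= 2/5], the budget leaves room for primes not dividing [nu]; otherwise the primes of [Q]
   contribute a bounded factor to the resonance sum of [nu] and can be discarded first. *)
Lemma coprime_primes s K k : 1 / 2 < s < 13 / 25 -> 0 < K -> 0 < k ->
  exists T0, 1 <= T0 /\ forall nu e T, (2 <= nu)%nat -> 0 <= e < s -> T0 <= T ->
  budget s e nu T ->
  exists nu' Q, (1 <= nu')%nat /\ Nat.divide nu' nu /\ NoDup Q /\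
  (forall q, In q Q -> nat_prime q /\ ~ Nat.divide q nu') /\
  K <= sum_over Q (fun q => Rpower (INR q) (- s)) /\
  6 ^ length Q <= Rpower T k /\
  energy nu (dconv s (weight e)) <= 2 * energy nu' (dconv s (weight e)).
Proof.
  intros Hs HK Hk.
  destruct (budget_ln_nu s Hs) as [C [C0 HC]].
  (* [nu] has at most 2 ln nu <= 2 C (1 + ln T) prime factors. With k/10, the bounds ln 6 <= 5 and 1
     + ln T <= 2 ln T give 6^|Q| <= T^k. *)
  destruct (prime_supply s K (2 * C) (k / 10) Hs HK ltac:(lra) ltac:(lra)) as [L0 [L01 PS]].
  exists (exp L0); split.
  { assert (Z := exp_ineq1_le L0); lra. }
  intros nu e T Hnu He HT HB.
  assert (nu1 : (1 <= nu)%nat) by lia.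
  assert (T1 : 1 <= T) by (assert (Z := exp_ineq1_le L0); lra).
  assert (LT : L0 <= ln T) by (rewrite <- (ln_exp L0); apply ln_le; [apply exp_pos|exact HT]).
  assert (S6 : forall n, INR n <= k / 10 * (1 + ln T) -> 6 ^ n <= Rpower T k).
  { intros n Hn; rewrite <- Rpower_pow by lra; unfold Rpower; apply exp_le_compat.
    assert (ln 6 <= 5) by (assert (Z := exp_ineq1_le (ln 6)); rewrite exp_ln in Z; lra).
    assert (0 <= ln 6) by (apply ln_ge0; lra).
    assert (n0 := pos_INR n); nra. }
  assert (E0 := fun n => energy_ge0 n (dconv s (weight e))).
  destruct (Rle_lt_dec e (2 / 5)) as [He'|He'].
  - destruct (exists_prime_divisors nu nu1) as [bad [B1 B2]].
    destruct (PS (1 + ln T) bad ltac:(lra)) as [Q [Q1 [Q2 [Q3 [Q4 _]]]]].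
    { assert (Z := HC nu e T Hnu ltac:(lra) T1 HB); lra. }
    exists nu, Q; split; [exact nu1|split; [apply Nat.divide_refl|split; [exact Q1|
      split; [|split; [exact Q3|split; [now apply S6|specialize (E0 nu); lra]]]]]].
    intros q Hq; destruct (Q2 q Hq) as [Pq Nq]; split; [exact Pq|].
    intros D; apply Nq; now apply B2.
  - destruct (PS (1 + ln T) nil ltac:(lra)) as [Q [Q1 [Q2 [Q3 [Q4 Q5]]]]].
    { simpl; apply Rmult_le_pos; lra. }
    assert (X : forall q, In q Q -> 0 < INR (length Q) /\
                Rpower (INR q) (- (2 * e)) <= / (16 * INR (length Q)) /\ 1 <= INR (length Q)).
    { intros q Hq; assert (n1 : 1 <= INR (length Q)).
      { apply INR_pos; destruct Q; [destruct Hq|simpl; lia]. }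
      specialize (Q5 q Hq); repeat split; [lra| |exact n1].
      assert (q2 : 1 <= INR q) by (apply INR_pos; destruct (Q2 q Hq) as [[Z _] _]; lia).
      apply Rle_trans with (Rpower (INR q) (- (4 / 5))); [apply Rpower_le_exp; lra|].
      apply Rmult_le_reg_l with (16 * INR (length Q)); [lra|]; rewrite Rinv_r by lra; exact Q5. }
    destruct (energy_remove_primes s e Q nu) as [nu' [N1 [N2 [N3 N4]]]]; [|exact nu1|lra|].
    { intros q Hq; split; [now apply Q2|]; destruct (X q Hq) as [X1 [X2 X3]].
      eapply Rle_trans; [exact X2|].
      replace (1 / 8) with (/ 8) by field; apply Rinv_le_contravar; lra. }
    exists nu', Q; split; [exact N1|split; [exact N2|split; [exact Q1|
      split; [|split; [exact Q3|split; [now apply S6|]]]]]].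
    + intros q Hq; split; [now apply Q2|now apply N3].
    + eapply Rle_trans; [exact N4|]; apply Rmult_le_compat_r; [apply E0|].
      eapply Rle_trans; [|exact exp_half_le_2]; apply exp_le_compat.
      (* Each of the |Q| terms is at most 1/(16 |Q|), since 2e > 4/5; the removal then costs
         exp(8/16) <= 2. *)
      assert (sum_over Q (fun q => Rpower (INR q) (- (2 * e))) <= 1 / 16); [|lra].
      apply Rle_trans with (sum_over Q (fun _ => / (16 * INR (length Q)))).
      * apply sum_over_le; intros q Hq; now apply X.
      * rewrite sum_over_const; destruct Q as [|q Q']; [simpl; lra|].
        destruct (X q (in_eq _ _)) as [X1 _]; right; field; lra.
Qed.

(** [c] is arbitrary here, as required by a factor zeta(2s) that is unbounded near 1/2: the adjoined
    primes raise the quotient of the energies by any prescribed amount. *)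
Lemma lower_bound_near_half s c : 1 / 2 < s < 13 / 25 -> 0 < c -> lower_bound_at s c.
Proof.
  intros Hs Hc.
  destruct (resonance_bound_strip s ltac:(lra)) as [T0 [T01 RB]].
  destruct (budget_mass s ltac:(lra)) as [B [B0 HBm]].
  set (k := (1 - s) * (2 * s - 1) / (4 * s)) in *.
  assert (k0 : 0 < k) by (unfold k; apply Rdiv_lt_0_compat; nra).
  (* The quotient of energies must gain (256 c)^2 to turn the constant 1/256 into [c]; the 2 pays
     for the primes removed from [nu]. *)
  set (K := 2 * (256 * c) ^ 2).
  assert (K0 : 0 < K) by (unfold K; assert (0 < (256 * c) ^ 2) by (apply pow_lt; lra); lra).
  (* One half of the spare power T^k bounds the growth 6^|Q| of the masses, the other half beats the
     constant 2 B. *)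
  destruct (coprime_primes s K (k / 2) Hs K0 ltac:(lra)) as [Tb [Tb1 HTb]].
  destruct (Rpower_eventually_ge (k / 2) (2 * B) ltac:(lra)) as [Ta [Ta1 HTa]].
  assert (z1 : 1 <= zeta_2s s) by (apply zeta_ge1; lra).
  destruct (budget_large_T s (zeta_2s s) (T0 + Ta + Tb) ltac:(lra) ltac:(lra) ltac:(lra)) as [cs [cs0 H]].
  exists cs; split; [exact cs0|]; intros nu e T M Hnu Hcs He HT HB HM.
  assert (nu1 : (1 <= nu)%nat) by lia.
  assert (TT : T0 + Ta + Tb <= T).
  { apply (H nu e T Hnu Hcs HT); [|exact HB].
    apply resonance_sum_le_sigma; [lra|exact nu1]. }
  assert (M0 := sup_ge0 s T M HT HM).
  assert (P : forall k, 0 <= weight e k) by (intros; left; apply Rpower_pos).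
  destruct (HTb nu e T Hnu He ltac:(lra) HB) as [nu' [Q [N1 [N2 [Q1 [Q2 [Q3 [Q4 Q5]]]]]]]].
  destruct (adjoin_primes s Q nu' (weight e) Q1 Q2 N1 P ltac:(lra))
    as [mu [r [A1 [A2 [_ [A3 [A4 A5]]]]]]].
  assert (F0 := energy_ge0 nu' (dconv s (weight e))).
  set (F := energy nu' (dconv s (weight e))) in *.
  set (S := sum_over Q (fun q => Rpower (INR q) (- s))) in *.
  assert (P1 : 1 <= 2 ^ length Q) by (apply pow_R1_Rle; lra).
  assert (FF : F <= energy mu (dconv s r)).
  { eapply Rle_trans; [|exact A5].
    rewrite <- (Rmult_1_l F) at 1; apply Rmult_le_compat_r; nra. }
  assert (MB : mass nu' (weight e) * mass nu' (dconv s (weight e)) <=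
               2 * B * Rpower T (2 * s - 1) * F).
  { eapply Rle_trans; [apply mass_product_le; [lra|lra|exact N1]|].
    assert (D : forall u, 0 <= divisor_sigma u nu' <= divisor_sigma u nu).
    { intros u; split; [assert (Z := divisor_sigma_ge1 u nu' N1); lra|].
      now apply divisor_sigma_incl. }
    apply Rle_trans with
      (2 * divisor_sigma (- (1)) nu * (divisor_sigma (- e) nu * divisor_sigma (1 - s - e) nu)).
    - assert (D1 := D (- (1))); assert (D2 := D (- e)); assert (D3 := D (1 - s - e)).
      apply Rmult_le_compat; [lra|apply Rmult_le_pos; lra|lra|apply Rmult_le_compat; lra].
    - eapply Rle_trans; [apply (HBm nu e T Hnu He HT HB)|].
      rewrite resonance_sum_energy.
      replace (2 * B * Rpower T (2 * s - 1) * F) with (B * Rpower T (2 * s - 1) * (2 * F)) by ring.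
      apply Rmult_le_compat_l; [left; apply Rmult_lt_0_compat; [lra|apply Rpower_pos]|exact Q5]. }
  assert (MR : mass mu r * mass mu (dconv s r) <= Rpower T (2 * s - 1 + k) * energy mu (dconv s r)).
  { eapply Rle_trans; [exact A4|].
    replace (2 * s - 1 + k) with (k / 2 + (k / 2 + (2 * s - 1))) by field; rewrite !Rpower_plus.
    set (W := Rpower T (2 * s - 1)) in *; assert (W0 : 0 < W) by apply Rpower_pos.
    assert (V := HTa T ltac:(lra)); set (U := Rpower T (k / 2)) in *.
    assert (U0 : 0 < U) by apply Rpower_pos.
    apply Rle_trans with (U * (U * W * F)).
    - apply Rmult_le_compat; [left; apply pow_lt; lra| |exact Q4|].
      + apply Rmult_le_pos; apply mass_ge0; trivial; intros; now apply dconv_ge0.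
      + eapply Rle_trans; [exact MB|]; apply Rmult_le_compat_r; [exact F0|].
        apply Rmult_le_compat_r; lra.
    - replace (U * (U * W * F)) with (U * (U * W) * F) by ring.
      apply Rmult_le_compat_l; [left; repeat apply Rmult_lt_0_compat; assumption|exact FF]. }
  assert (X := RB T M mu r ltac:(lra) M0 A1 A2 HM MR).
  assert (E0 := energy_ge0 nu (weight e)).
  assert (EE : energy nu' (weight e) <= energy nu (weight e)).
  { rewrite <- !divisor_sigma_energy; now apply divisor_sigma_incl. }
  assert (G : K / 2 * energy nu (dconv s (weight e)) <= (256 * M) ^ 2 * energy nu (weight e)).
  { assert (X2 : energy mu (dconv s r) <= (256 * M) ^ 2 * energy mu r).
    { rewrite <- (pow2_sqrt (energy mu (dconv s r))), <- (pow2_sqrt (energy mu r)), <- Rpow_mult_distr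
        by apply energy_ge0.
      apply pow_incr; split; [apply sqrt_pos|exact X]. }
    rewrite A3 in X2.
    assert (M2 : 0 <= (256 * M) ^ 2) by apply pow2_ge_0.
    assert (Y : (1 + S) * F <= (256 * M) ^ 2 * energy nu' (weight e)).
    { apply Rmult_le_reg_l with (2 ^ length Q); [lra|]; lra. }
    apply Rle_trans with (K * F); [nra|].
    apply Rle_trans with ((1 + S) * F); [apply Rmult_le_compat_r; lra|].
    eapply Rle_trans; [exact Y|]; now apply Rmult_le_compat_l. }
  apply lower_bound_of_energy with (k := / c); trivial; try lra.
  - left; now apply Rinv_0_lt_compat.
  - right; field; lra.
  - assert (ic : 0 < / c) by (now apply Rinv_0_lt_compat).
    rewrite <- (sqrt_pow2 (/ c * M)) by (apply Rmult_le_pos; lra).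
    rewrite <- sqrt_mult_alt by (apply pow2_ge_0); apply sqrt_le_1_alt.
    apply Rmult_le_reg_l with (K / 2); [lra|]; eapply Rle_trans; [exact G|].
    right; unfold K; field; lra.
Qed.

(** Holomorphy gives continuity on the segment, which avoids the pole because t >= 1. *)
Lemma zeta_sup_attained s T : 1 / 2 < s -> 1 <= T ->
  exists t, 1 <= t <= T /\ forall u, 1 <= u <= T -> Cmod (zeta (s, u)) <= Cmod (zeta (s, t)).
Proof.
  intros Hs HT.
  destruct (continuity_ab_maj (fun t => Cmod (zeta (s, t))) 1 T HT) as [t [H1 H2]].
  - intros t Ht; apply continuity_pt_filterlim.
    assert (Hh := zeta_holomorphic (s, t) ltac:(simpl; lra) (im_neq_1 s t ltac:(lra))).
    apply (ex_derive_continuous (K := C_AbsRing) (V := C_NormedModule)) in Hh.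
    eapply filterlim_comp; [|apply (filterlim_norm (K := C_AbsRing) (V := C_NormedModule))].
    eapply filterlim_comp; [|exact Hh].
    intros P [d Hd]; exists d; intros y Hy; apply Hd.
    change (Cmod ((s, y) - (s, t))%C < d); change (Rabs (y - t) < d) in Hy.
    eapply Rle_lt_trans; [apply Cmod_le_parts|]; simpl.
    rewrite Rplus_opp_r, Rabs_R0, Rplus_0_l; exact Hy.
  - exists t; split; [exact H2|exact H1].
Qed.

(** Both k and l divide [nu] and their gcd is at least 1. This inequality is what transfers the
    lower bound on the maximum to [nu]. *)
Lemma maximum_eq_nu nu m : (2 <= nu)%nat ->
  is_maximum (fun x => exists k l : nat, Nat.divide (Nat.lcm k l) nu /\
     x = INR (Nat.max k l) / INR (Nat.gcd k l)) m -> m <= INR nu.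
Proof.
  intros Hnu [[k [l [D E]]] _].
  (* An lcm with 0 is 0, which divides no positive [nu]. *)
  assert (k0 : k <> 0%nat) by (intros ->; rewrite Nat.lcm_0_l in D; destruct D; lia).
  assert (l0 : l <> 0%nat).
  { intros ->; rewrite Nat.lcm_0_r in D; destruct D; lia. }
  assert (g1 : (1 <= Nat.gcd k l)%nat).
  { destruct (Nat.gcd k l) eqn:G; [apply Nat.gcd_eq_0 in G; tauto|lia]. }
  assert (B : (Nat.max k l <= nu)%nat).
  { assert (k <= nu)%nat.
    { apply Nat.divide_pos_le; [lia|]; apply Nat.divide_trans with (Nat.lcm k l);
        [apply Nat.divide_lcm_l|exact D]. }
    assert (l <= nu)%nat; [|lia].
    apply Nat.divide_pos_le; [lia|]; apply Nat.divide_trans with (Nat.lcm k l);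
        [apply Nat.divide_lcm_r|exact D]. }
  rewrite E; apply INR_pos in g1; apply le_INR in B.
  apply Rmult_le_reg_r with (INR (Nat.gcd k l)); [lra|].
  unfold Rdiv; rewrite Rmult_assoc, Rinv_l, Rmult_1_r by lra.
  assert (Z := pos_INR nu); nra.
Qed.

Theorem theorem2p10 :
  exists C0 : R, 0 < C0 /\
  forall s : R, 1 / 2 < s ->
  exists cs : R, 0 < cs /\
  let c := Re (zeta (RtoC (2 * s))) / (2 * sqrt (1 + C0)) in
  forall (nu : nat) (m : R),
    (2 <= nu)%nat ->
    is_maximum
      (fun x => exists k l : nat,
         Nat.divide (Nat.lcm k l) nu /\
         x = INR (Nat.max k l) / INR (Nat.gcd k l)) m ->
    cs <= m ->
  forall e : R, 0 <= e < s ->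
  forall T : R, 1 <= T ->
    divisor_sigma (- e) nu * divisor_sigma (1 - s - e) nu * ln (INR nu * T)
      / resonance_sum s e nu
      <= sqrt (Re (zeta (RtoC (2 * s)))) / 4 * Rpower T (2 * s - 1) ->
  exists M : R,
    is_maximum
      (fun x => exists t : R, 1 <= t <= T /\ x = Cmod (zeta (s, t))) M /\
    c * sqrt (1 / divisor_sigma (- (2 * e)) nu * resonance_sum s e nu) <= M.
Proof.
  (* This value makes c = zeta(2s) / 20000. *)
  exists (10000 ^ 2 - 1); split; [lra|]; intros s Hs.
  assert (z1 := zeta_ge1 (2 * s) ltac:(lra)).
  set (c := Re (zeta (RtoC (2 * s))) / (2 * sqrt (1 + (10000 ^ 2 - 1)))).
  assert (Ec : c = Re (zeta (RtoC (2 * s))) / 20000).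
  { unfold c; replace (1 + (10000 ^ 2 - 1)) with (10000 ^ 2) by ring.
    rewrite sqrt_pow2 by lra; f_equal; ring. }
  assert (c0 : 0 < c) by lra.
  assert (LB : lower_bound_at s c).
  { destruct (Rlt_le_dec s (13 / 25)) as [H|H]; [now apply lower_bound_near_half|].
    (* From 13/25 on, zeta(2s) <= 1 + 25, so that c <= 26/20000 < 1/256 as the remaining cases
       require. *)
    assert (zl := zeta_le (2 * s) ltac:(lra)).
    assert (I : / (2 * s - 1) <= 25).
    { replace 25 with (/ (1 / 25)) by field; apply Rinv_le_contravar; lra. }
    destruct (Rtotal_order s 1) as [L|[->|L]].
    - apply lower_bound_strip; lra.
    - apply lower_bound_one; lra.
    - apply lower_bound_gt1; lra. }
  destruct LB as [cs [cs0 HLB]]; exists cs; split; [exact cs0|].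
  intros c' nu m Hnu Hm Hcs e He T HT HB.
  destruct (zeta_sup_attained s T Hs HT) as [t [Ht Hmax]].
  exists (Cmod (zeta (s, t))); split.
  - split; [now exists t|]; intros x [u [Hu ->]]; now apply Hmax.
  - apply (HLB nu e T _ Hnu); trivial.
    eapply Rle_trans; [exact Hcs|now apply maximum_eq_nu].
Qed.
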